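(* Let $B$ be a connected skew-symmetrizable $n\times n$ integer matrix such that the cluster algebra $\mathcal{A}(B)$ is acyclic, i.e. $B$ is mutation equivalent to an acyclic skew-symmetrizable matrix. Then the $g$-vector fan $\mathcal{F}(B)$ is dense in $\mathbb{R}^n$ if and only if $B$ is of finite type or of affine type.
   Context: An $n\times n$ integer matrix $B=(b_{ij})$ is skew-symmetrizable if there is a diagonal matrix $D=\mathrm{diag}(d_1,\dots,d_n)$ with positive integer entries such that $d_ib_{ij}=-d_jb_{ji}$ for all $i,j$. For an $m\times n$ integer matrix $B=(b_{ij})$ ($m\ge n$) whose upper $n\times n$ part is skew-symmetrizable and $1\le k\le n$, the mutation $\mu_kB=(b'_{ij})$ is defined by $b'_{ij}=-b_{ij}$ if $i=k$ or $j=k$, and $b'_{ij}=b_{ij}+b_{ik}[b_{kj}]_++[-b_{ik}]_+b_{kj}$ otherwise, where $[a]_+=\max(a,0)$. Two matrices are mutation equivalent if one is obtained from the other by a finite sequence of mutations. The diagram $\Gamma(B)$ of a skew-symmetrizable $n\times n$ matrix $B$ is the weighted directed graph on vertices $1,\dots,n$ with an arrow $j\to i$ of weight $|b_{ij}b_{ji}|$ whenever $b_{ij}>0$. $B$ is connected if $\Gamma(B)$ is connected and acyclic if $\Gamma(B)$ has no oriented cycle. $B$ is of finite type (resp. affine type) if it is mutation equivalent to an acyclic skew-symmetrizable matrix $B'$ whose Cartan companion $A=(a_{ij})$, $a_{ii}=2$, $a_{ij}=-|b'_{ij}|$ ($i\ne j$), is a Cartan matrix of finite type (resp. a generalized Cartan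 matrix of affine type); equivalently, the underlying weighted graph of $\Gamma(B')$ is a Dynkin graph $A_n,B_n(=C_n),D_n,E_6,E_7,E_8,F_4,G_2$ (resp. an extended Dynkin graph $A_1^{(1)}$ (two vertices, weight 4), $A_n^{(1)}$ (a cycle, not oriented cyclically), $B_n^{(1)},C_n^{(1)},D_n^{(1)},E_6^{(1)},E_7^{(1)},E_8^{(1)},F_4^{(1)},G_2^{(1)}$). Cluster algebra with principal coefficients: let $\mathcal{F}$ be the field of rational functions over $\mathbb{Q}$ in $2n$ variables. A seed is a pair $(\mathbf{x},C)$ with $\mathbf{x}=(x_1,\dots,x_n,y_1,\dots,y_n)$ a free generating set of $\mathcal{F}$ and $C=(c_{ij})$ a $2n\times n$ integer matrix with skew-symmetrizable upper part, rows indexed by $1,\dots,n,1',\dots,n'$. Its mutation at $k$ replaces $C$ by $\mu_kC$ and $x_k$ by $x_k'$ with $x_kx_k'=\prod_i x_i^{[c_{ik}]_+}+\prod_i x_i^{[-c_{ik}]_+}$ (with $x_{i'}=y_i$), other entries unchanged. Let $\hat B$ be the $2n\times n$ matrix with upper part $B$ and lower part the identity. $\mathcal{A}(B)$ is the $\mathbb{Z}$-subalgebra of $\mathcal{F}$ generated by all cluster variables and coefficients of all seeds obtained from $(\mathbf{x},\hat B)$ by sequences of mutations; the $n$-tuples $(x_1,\dots,x_n)$ of these seeds are clusters. Every cluster variable lies in $\mathbb{Z}[x_1^{\pm1},\dots,x_n^{\pm1},y_1,\dots,y_n]$ and is homogeneous for the $\mathbb{Z}^n$-grading $\deg x_i=e_i$,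 $\deg y_j=-\sum_i b_{ij}e_i$; its degree is its $g$-vector. The $g$-vector fan $\mathcal{F}(B)$ is the simplicial fan in $\mathbb{R}^n$ whose maximal cones are the cones spanned by the $g$-vectors of the cluster variables of a cluster (and their faces). $\mathcal{F}(B)$ is dense if the union of its cones is dense in $\mathbb{R}^n$. *)

(* Defs.v *)
From HB Require Import structures.
From mathcomp Require Import all_boot all_order all_algebra fraction.
From mathcomp Require Import reals.
From mathcomp Require Import mpoly.

Set Implicit Arguments.
Unset Strict Implicit.
Unset Printing Implicit Defensive.

Import Order.TTheory GRing.Theory Num.Theory.
Local Open Scope ring_scope.

Definition posp (a : int) : int := Num.max a 0.

Definition skew_symmetrizable (n : nat) (B : 'M[int]_n) : Prop :=
  exists d : 'I_n -> nat,
    (forall i, (0 < d i)%N) /\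
    (forall i j, (d i)%:Z * B i j = - ((d j)%:Z * B j i)).

(* Mutation at k of an m x n matrix C whose upper n x n part is indexed by
   the rows [r i]; b'_ij = -b_ij if i = k or j = k, and
   b_ij + b_ik [b_kj]_+ + [-b_ik]_+ b_kj otherwise. *)
Definition mutf (m n : nat) (r : 'I_n -> 'I_m) (k : 'I_n) (C : 'M[int]_(m, n))
  : 'M[int]_(m, n) :=
  \matrix_(i, j)
    if (i == r k) || (j == k) then - C i j
    else C i j + C i k * posp (C (r k) j) + posp (- C i k) * C (r k) j.

Definition mut_sq (n : nat) (k : 'I_n) (B : 'M[int]_n) : 'M[int]_n :=
  mutf id k B.

Inductive mut_equiv (n : nat) (B : 'M[int]_n) : 'M[int]_n -> Prop :=
| mut_equiv_refl : mut_equiv B B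
| mut_equiv_step (C : 'M[int]_n) (k : 'I_n) :
    mut_equiv B C -> mut_equiv B (mut_sq k C).

Definition arrow (n : nat) (B : 'M[int]_n) : rel 'I_n := fun j i => 0 < B i j.

Definition acyclic (n : nat) (B : 'M[int]_n) : Prop :=
  forall i j, arrow B j i -> ~~ connect (arrow B) i j.

Definition connected (n : nat) (B : 'M[int]_n) : Prop :=
  forall i j, connect (fun a b => B a b != 0) i j.

Definition cartan_companion (n : nat) (B : 'M[int]_n) : 'M[int]_n :=
  \matrix_(i, j) if i == j then 2 else - `|B i j|.

Definition pos_vec (R : realType) (n : nat) (u : 'cV[R]_n) : Prop :=
  forall i, 0 < u i 0.
Definition nneg_vec (R : realType) (n : nat) (u : 'cV[R]_n) : Prop :=
  forall i, 0 <= u i 0.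

Definition realmx (R : realType) (n : nat) (A : 'M[int]_n) : 'M[R]_n :=
  map_mx (fun z : int => z%:~R) A.

(* Kac, Infinite dimensional Lie algebras, Thm 4.3, condition (Fin) *)
Definition finite_type_GCM (R : realType) (n : nat) (A : 'M[int]_n) : Prop :=
  let AR := realmx R A in
  [/\ \det AR != 0,
      exists u : 'cV[R]_n, pos_vec u /\ pos_vec (AR *m u)
    & forall u : 'cV[R]_n, nneg_vec (AR *m u) -> pos_vec u \/ u = 0].

(* Kac, Thm 4.3, condition (Aff) *)
Definition affine_type_GCM (R : realType) (n : nat) (A : 'M[int]_n) : Prop :=
  let AR := realmx R A in
  [/\ (\rank AR).+1 = n,
      exists u : 'cV[R]_n, pos_vec u /\ AR *m u = 0
    & forall u : 'cV[R]_n, nneg_vec (AR *m u) -> AR *m u = 0].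

Definition finite_type (R : realType) (n : nat) (B : 'M[int]_n) : Prop :=
  exists B' : 'M[int]_n, [/\ mut_equiv B B', skew_symmetrizable B', acyclic B'
                           & finite_type_GCM R (cartan_companion B')].

Definition affine_type (R : realType) (n : nat) (B : 'M[int]_n) : Prop :=
  exists B' : 'M[int]_n, [/\ mut_equiv B B', skew_symmetrizable B', acyclic B'
                           & affine_type_GCM R (cartan_companion B')].

Definition PR (n : nat) := {mpoly rat[n + n]}.
Definition FF (n : nat) := {fraction {mpoly rat[n + n]}}.

Definition tofracP (n : nat) (p : {mpoly rat[n + n]}) : FF n :=
  @FracField.tofrac {mpoly rat[n + n]} p.

Definition xvar (n : nat) (i : 'I_n) : FF n := tofracP 'X_(lshift n i).
Definition yvar (n : nat) (i : 'I_n) : FF n := tofracP 'X_(rshift n i).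

Definition extvar (n : nat) (xs : 'I_n -> FF n) (i : 'I_(n + n)) : FF n :=
  match split i with inl j => xs j | inr j => yvar j end.

Record seed (n : nat) := Seed { sx : 'I_n -> FF n; sC : 'M[int]_(n + n, n) }.

Definition seed_mut (n : nat) (k : 'I_n) (s : seed n) : seed n :=
  Seed (fun j => if j == k then
          ((\prod_(i < n + n) extvar (sx s) i ^+ absz (posp (sC s i k)))
           + (\prod_(i < n + n) extvar (sx s) i ^+ absz (posp (- sC s i k))))
          / sx s k
        else sx s j)
       (mutf (lshift n) k (sC s)).

Inductive reachable (n : nat) (B : 'M[int]_n) : seed n -> Prop :=
| reachable0 : reachable B (Seed (@xvar n) (col_mx B 1%:M))
| reachableS (s : seed n) (k : 'I_n) : reachable B s -> reachable B (seed_mut k s).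

(* degree of a monomial: deg x_i = e_i, deg y_j = - sum_i b_ij e_i *)
Definition mdeg (n : nat) (B : 'M[int]_n) (m : 'X_{1..n + n}) : 'I_n -> int :=
  fun i => (m (lshift n i))%:Z - \sum_(j < n) (m (rshift n j))%:Z * B i j.

Definition homog_of (n : nat) (B : 'M[int]_n) (p : {mpoly rat[n + n]})
  (g : 'I_n -> int) : Prop :=
  forall m, m \in msupp p -> forall i, mdeg B m i = g i.

Definition degree_of (n : nat) (B : 'M[int]_n) (f : FF n) (g : 'I_n -> int) : Prop :=
  exists (p q : {mpoly rat[n + n]}) (a b : 'I_n -> int),
    [/\ p != 0, q != 0, homog_of B p a, homog_of B q b &
        f = tofracP p / tofracP q /\ forall i, g i = a i - b i].

Definition in_gfan (R : realType) (n : nat) (B : 'M[int]_n) (v : 'I_n -> R) : Prop :=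
  exists s : seed n, reachable B s /\
  exists g : 'I_n -> 'I_n -> int, (forall j, degree_of B (sx s j) (g j)) /\
  exists lam : 'I_n -> R, (forall j, 0 <= lam j) /\
    forall i, v i = \sum_(j < n) lam j * (g j i)%:~R.

Definition gfan_dense (R : realType) (n : nat) (B : 'M[int]_n) : Prop :=
  forall (v : 'I_n -> R) (eps : R), 0 < eps ->
    exists w : 'I_n -> R, in_gfan B w /\ forall i, `|v i - w i| < eps.

(* Main.v *)
(* A path of mutations is encoded by its C-matrix and its G-matrix. The Laurent
   phenomenon makes the F-polynomials polynomials; comparing their restrictions to
   the coordinate axes in the initial chart and in a neighbouring chart shows that
   the rows of G are sign-coherent, and reversing paths transfers this to the
   columns of C. Hence a change of the initial seed acts on the fan by a piecewise
   linear homeomorphism, density is invariant under mutation, and B may be taken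
   acyclic. Let d be a symmetrizer, D = diag(d), N = [-B]_+, and let q be the form
   of the symmetrized Cartan companion S, so that q(v) = 2 v^T D (1 - N) v.

   If p is not in the closure of the fan, then p is negative at every source,
   because a source with p_k >= 0 reduces to lower rank. Reflecting once at all
   vertices again and again yields positive vectors u_m with
   E^T u_(m+1) = - E u_m, where S = E + E^T. This is impossible if q is positive
   definite, and if q is semidefinite with kernel spanned by delta > 0 it forces
   sum_i delta_i d_i p_i = 0, while the complement of the closure is open.

   Conversely let p = -(1 - N) v with v > 0 lie in the cone of G = -(1 - N) V.
   Along the direction D p the F-polynomials tend to 1, and along the diagonal
   direction F_j is asymptotic to the monomial y^(V_j). Thus V_j is in the support
   of F_j and pairs nonpositively with D G, which gives q(v) >= 0. So density
   forces q >= 0, and a connected Cartan matrix with q >= 0 is of finite or affine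
   type. *)
Require Import Defs.
From HB Require Import structures.
From mathcomp Require Import all_boot all_order all_algebra fraction.
From mathcomp Require Import reals.
From mathcomp Require Import mpoly.
From mathcomp Require Import zify ring lra.
From mathcomp Require boolp.

Set Implicit Arguments.
Unset Strict Implicit.
Unset Printing Implicit Defensive.

Import Order.TTheory GRing.Theory Num.Theory.
Local Open Scope ring_scope.

(** * Mutation of exchange matrices, c-vectors and g-vectors *)

(** The recursion for G uses the sign of a column of C, and the coherence of these columns is itself
    to be proved. Facts about a path are therefore first shown under [okpath], which concerns only
    the proper prefixes of the path. This gap of one step drives an induction on length, and since
    the reversed path starts at - [Bp B ks], the induction ranges over all skew-symmetrizable
    matrices at once.

    Cluster variables are treated as functions of positive rational points: no exchange relation
    divides by zero there, and polynomials that agree there are equal.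

    The covering half never locates a cone. At an uncovered point every piecewise linear step of a
    round is linear, so repeated rounds follow an orbit of the Coxeter transformation, an isometry
    of q. Positivity of the whole orbit is what becomes impossible. In the semidefinite case it
    yields only an inequality for p; rounds with the opposite sign [s] give the reverse one, hence
    an equation. *)

Definition sg (b : bool) : int := if b then -1 else 1.

Lemma sgN b : sg (~~ b) = - sg b. Proof. by case: b. Qed.
Lemma sgM b (x : int) : sg b * x = if b then - x else x.
Proof. by case: b; rewrite /sg ?mulN1r ?mul1r. Qed.

Lemma posp_ge0 a : 0 <= posp a. Proof. by rewrite /posp le_max lexx orbT. Qed.
Lemma posp_id a : 0 <= a -> posp a = a. Proof. by move=> h; rewrite /posp; apply/max_idPl. Qed.
Lemma posp_0 a : a <= 0 -> posp a = 0. Proof. by move=> h; rewrite /posp; apply/max_idPr. Qed.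
Lemma posp0 : posp 0 = 0. Proof. exact: posp_0. Qed.
Lemma pospB a : posp a - posp (- a) = a.
Proof. by rewrite /posp; lia. Qed.
Lemma pospM (c a : int) : 0 <= c -> posp (c * a) = c * posp a.
Proof.
move=> c0; case: (lerP 0 a) => h.
  by rewrite !posp_id // mulr_ge0.
by rewrite (posp_0 (ltW h)) posp_0 ?mulr0 // mulr_ge0_le0 // ltW.
Qed.

Section Mutation.
Variable n : nat.
Implicit Types (B C G : 'M[int]_n) (k : 'I_n) (d : 'I_n -> nat) (s : bool).

(** Involutions that realise mutation as H B E for either sign [s]. With [s] the sign of column k of
    C, the same E and H also mutate C and G. *)
Definition Emat B k s : 'M[int]_n :=
  \matrix_(i, j) if i == k then (if j == k then -1 else posp (sg s * B k j))
                 else (i == j)%:R.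

Definition Hmat B k s : 'M[int]_n :=
  \matrix_(i, j) if j == k then (if i == k then -1 else posp (- (sg s * B i k)))
                 else (i == j)%:R.

Lemma mulmxE m (C : 'M[int]_(m, n)) B k s i j :
  (C *m Emat B k s) i j =
    if j == k then - C i k else C i j + C i k * posp (sg s * B k j).
Proof.
rewrite mxE (bigD1 k) //= !mxE eqxx; case: eqP => [->|/eqP jk].
  rewrite mulrN1 big1 ?addr0 // => l lk.
  by rewrite mxE (negPf lk) mulr0.
rewrite addrC (bigD1 j) //= !mxE (negPf jk) eqxx mulr1 big1 ?addr0 // => l /andP[lk lj].
by rewrite mxE (negPf lk) (negPf lj) mulr0.
Qed.

Lemma mulmxH m (C : 'M[int]_(m, n)) B k s i j :
  (C *m Hmat B k s) i j =
    if j == k then - C i k + \sum_(l | l != k) C i l * posp (- (sg s * B l k))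
    else C i j.
Proof.
rewrite mxE (bigD1 k) //= !mxE eqxx; case: eqP => [->|/eqP jk].
  rewrite mulrN1; congr (_ + _); apply: eq_bigr => l lk.
  by rewrite mxE eqxx (negPf lk).
rewrite eq_sym (negPf jk) mulr0 add0r (bigD1 j) //= !mxE eqxx (negPf jk) mulr1.
rewrite big1 ?addr0 // => l /andP[lk lj].
by rewrite mxE (negPf jk) (negPf lj) mulr0.
Qed.

Lemma mulEmx m (C : 'M[int]_(n, m)) B k s i j :
  (Emat B k s *m C) i j =
    if i == k then - C k j + \sum_(l | l != k) posp (sg s * B k l) * C l j
    else C i j.
Proof.
rewrite mxE (bigD1 k) //= !mxE eqxx; case: eqP => [->|/eqP ik].
  rewrite mulN1r; congr (_ + _); apply: eq_bigr => l lk.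
  by rewrite mxE eqxx (negPf lk).
rewrite mul0r add0r (bigD1 i) //= !mxE eqxx (negPf ik) mul1r.
rewrite big1 ?addr0 // => l /andP[lk li].
by rewrite mxE (negPf ik) eq_sym (negPf li) mul0r.
Qed.

Lemma mulHmx m (C : 'M[int]_(n, m)) B k s i j :
  (Hmat B k s *m C) i j =
    if i == k then - C k j else C i j + posp (- (sg s * B i k)) * C k j.
Proof.
rewrite mxE (bigD1 k) //= !mxE eqxx; case: eqP => [->|/eqP ik].
  rewrite mulN1r big1 ?addr0 // => l lk.
  by rewrite mxE (negPf lk) eq_sym (negPf lk) mul0r.
rewrite addrC (bigD1 i) //= !mxE (negPf ik) eqxx mul1r big1 ?addr0 // => l /andP[lk li].
by rewrite mxE (negPf lk) eq_sym (negPf li) mul0r.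
Qed.

Lemma EmatK B k s : Emat B k s *m Emat B k s = 1%:M.
Proof.
apply/matrixP=> i j; rewrite mulmxE !mxE !eqxx.
case: (eqVneq j k) => [->|jk]; first by case: eqP; rewrite ?opprK ?oppr0.
case: (eqVneq i k) => [->|ik]; last by rewrite mul0r addr0.
by rewrite mulN1r addrN eq_sym (negPf jk).
Qed.

Lemma HmatK B k s : Hmat B k s *m Hmat B k s = 1%:M.
Proof.
apply/matrixP=> i j; rewrite mulHmx !mxE !eqxx.
case: (eqVneq j k) => [->|jk].
  by case: (eqVneq i k) => [_|ik]; rewrite ?opprK ?mulrN1 ?addrN.

case: (eqVneq i k) => [->|ik]; first by rewrite eq_sym (negPf jk) oppr0.
by rewrite mulr0 addr0.
Qed.

Definition skewD d B := (forall i, (0 < d i)%N) /\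
    (forall i j, (d i)%:Z * B i j = - ((d j)%:Z * B j i)).

Lemma skewD_gt0 d B i : skewD d B -> 0 < (d i)%:Z.
Proof. by case=> h _; have := h i; lia. Qed.

Lemma skewD_diag d B i : skewD d B -> B i i = 0.
Proof.
move=> h; have := skewD_gt0 i h; case: h => _ /(_ i i) h d0.
have : (d i)%:Z * B i i = 0 by lia.
by move/eqP; rewrite mulf_eq0 gt_eqF //= => /eqP.
Qed.

Lemma skewD_posp d B i j : skewD d B ->
  (d i)%:Z * posp (B i j) = (d j)%:Z * posp (- B j i).
Proof.
move=> h; have [di dj] := (skewD_gt0 i h, skewD_gt0 j h); case: h => _ h.
by rewrite -!pospM ?ltW // h mulrN.
Qed.

Lemma skewDN d B : skewD d B -> skewD d (- B).
Proof. by case=> h1 h2; split=> // i j; rewrite !mxE !mulrN h2 opprK. Qed.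

Lemma skewD_pospg d B i j s : skewD d B ->
  (d i)%:Z * posp (sg s * B i j) = (d j)%:Z * posp (- (sg s * B j i)).
Proof.
move=> h; rewrite !sgM; case: s; last exact: skewD_posp.
by have := skewD_posp i j (skewDN h); rewrite !mxE.
Qed.

Definition Dmx d : 'M[int]_n := \matrix_(i, j) if i == j then (d i)%:Z else 0.

Lemma mulDmx d m (C : 'M[int]_(n, m)) i j : (Dmx d *m C) i j = (d i)%:Z * C i j.
Proof.
rewrite mxE (bigD1 i) //= !mxE eqxx big1 ?addr0 // => l li.
by rewrite mxE eq_sym (negPf li) mul0r.
Qed.

Lemma mulmxD d m (C : 'M[int]_(m, n)) i j : (C *m Dmx d) i j = C i j * (d j)%:Z.
Proof.
rewrite mxE (bigD1 j) //= !mxE eqxx big1 ?addr0 // => l lj.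
by rewrite mxE (negPf lj) mulr0.
Qed.

Lemma trDmx d : (Dmx d)^T = Dmx d.
Proof. by apply/matrixP=> i j; rewrite !mxE eq_sym; case: eqP => [->|]. Qed.

Lemma DHE d B k s : skewD d B -> Dmx d *m Hmat B k s = (Emat B k s)^T *m Dmx d.
Proof.
move=> h; apply/matrixP=> i j; rewrite mulDmx mulmxD !mxE.
case: (eqVneq j k) => [->|jk].
  case: (eqVneq i k) => [->|ik]; first by rewrite mulrC.
  by rewrite -(skewD_pospg k i s h) mulrC.
by rewrite (eq_sym j); case: eqP => [->|_]; rewrite ?mulr0 ?mul0r // mulrC.
Qed.

Lemma mut_HBE d B k s : skewD d B -> mut_sq k B = Hmat B k s *m B *m Emat B k s.
Proof.
move=> h; have kk := skewD_diag k h.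
apply/matrixP=> i j; rewrite mulmxE !mulHmx !mxE.
case: (eqVneq j k) => [->|jk]; rewrite ?orbT ?orbF.
  by rewrite kk mulr0 addr0; case: eqP => [->|//]; rewrite kk !oppr0.
case: (eqVneq i k) => [->|ik]; first by rewrite kk oppr0 mul0r addr0.
rewrite kk mulr0 addr0 !sgM; case: s => /=; last first.
  by rewrite -addrA [X in _ + X]addrC addrA.
rewrite opprK; have := pospB (B k j); have := pospB (B i k).
move: (posp _) (posp _) (posp _) (posp _) => a b c e <- <-.
ring.
Qed.

Lemma mut_skewD d B k : skewD d B -> skewD d (mut_sq k B).
Proof.
move=> h; split; first by case: h.
(* D B changes by the congruence with E, which preserves skew-symmetry. *)
have e0 : Dmx d *m mut_sq k B = (Emat B k false)^T *m (Dmx d *m B) *m Emat B k false.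
  by rewrite (mut_HBE k false h) !mulmxA (DHE _ _ h).
have e1 : (Dmx d *m B)^T = - (Dmx d *m B).
  by apply/matrixP=> i j; rewrite mxE mulDmx mxE mulDmx (proj2 h).
have e : Dmx d *m mut_sq k B = - (Dmx d *m mut_sq k B)^T.
  rewrite e0 [in RHS]trmx_mul [X in - (_ *m X)]trmx_mul trmxK e1.
  by rewrite mulNmx mulmxN opprK !mulmxA.
move=> i j; move/matrixP/(_ i j): e; rewrite mulDmx => ->.
by rewrite mxE mxE mulDmx.
Qed.

Lemma Emat_mut B k s : Emat (mut_sq k B) k s = Emat B k (~~ s).
Proof.
by apply/matrixP=> i j; rewrite !mxE eqxx /= sgN mulrN mulNr.
Qed.

Lemma Hmat_mut B k s : Hmat (mut_sq k B) k s = Hmat B k (~~ s).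
Proof.
by apply/matrixP=> i j; rewrite !mxE eqxx orbT /= sgN mulrN mulNr.
Qed.

Lemma EmatN B k s : Emat (- B) k s = Emat B k (~~ s).
Proof. by apply/matrixP=> i j; rewrite !mxE sgN mulrN mulNr. Qed.

Lemma HmatN B k s : Hmat (- B) k s = Hmat B k (~~ s).
Proof. by apply/matrixP=> i j; rewrite !mxE sgN mulrN mulNr. Qed.

(** Mutation negates row and column k, so E and H of the second step with sign [s] are those of the
    first with sign [~~ s], and they cancel. *)
Lemma mut_sqK d B k : skewD d B -> mut_sq k (mut_sq k B) = B.
Proof.
move=> h; rewrite (mut_HBE k false (mut_skewD k h)) Emat_mut Hmat_mut /=.
by rewrite (mut_HBE k true h) !mulmxA HmatK mul1mx -mulmxA EmatK mulmx1.
Qed.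

Lemma mut_sqN d B k : skewD d B -> mut_sq k (- B) = - mut_sq k B.
Proof.
move=> h; rewrite (mut_HBE k false (skewDN h)) EmatN HmatN /=.
by rewrite (mut_HBE k true h) mulmxN mulNmx.
Qed.

Definition Bp B ks := foldl (fun B k => mut_sq k B) B ks.

Lemma Bp_skewD d B ks : skewD d B -> skewD d (Bp B ks).
Proof. by elim: ks B => //= k ks IH B h; apply: IH; apply: mut_skewD. Qed.

Lemma Bp_rcons B ks k : Bp B (rcons ks k) = mut_sq k (Bp B ks).
Proof. by rewrite /Bp foldl_rcons. Qed.

Lemma Bp_rev d B ks : skewD d B -> Bp (Bp B ks) (rev ks) = B.
Proof.
move=> h; elim/last_ind: ks => // ks k IH.
by rewrite Bp_rcons rev_rcons /= (mut_sqK _ (Bp_skewD ks h)).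
Qed.

Lemma BpN d B ks : skewD d B -> Bp (- B) ks = - Bp B ks.
Proof.
by elim: ks B => //= k ks IH B h; rewrite (mut_sqN _ h) IH //; apply: mut_skewD.
Qed.

Definition Cmut B k C : 'M[int]_n :=
  \matrix_(i, j) if j == k then - C i k
                 else C i j + C i k * posp (B k j) + posp (- C i k) * B k j.

(* The sign of column k is [true] for negative; meaningful only when the
   column is sign-coherent. *)
Definition csgn C k : bool := ~~ [forall i, 0 <= C i k].
Definition coh C k : bool := [forall i, 0 <= C i k] || [forall i, C i k <= 0].

Lemma cohP C k : coh C k -> forall i, 0 <= sg (csgn C k) * C i k.
Proof.
rewrite /coh /csgn; case: forallP => [h _ i|_ /= /forallP h i].
  by rewrite mul1r.
by rewrite mulN1r oppr_ge0.
Qed.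

Lemma coh_intro C k s : (forall i, 0 <= sg s * C i k) -> coh C k.
Proof.
case: s => h; apply/orP; [right|left]; apply/forallP=> i; have := h i.
  by rewrite mulN1r oppr_ge0.
by rewrite mul1r.
Qed.

Lemma Cmut_E B k C s : (forall i, 0 <= sg s * C i k) -> Cmut B k C = C *m Emat B k s.
Proof.
move=> h; apply/matrixP=> i j; rewrite mulmxE mxE; case: eqP => // _.
have := h i; rewrite !sgM; case: s {h} => h.
  rewrite (posp_id h); have := pospB (B k j).
  move: (posp (B k j)) (posp (- B k j)) => p q <-; ring.
by rewrite (posp_0 (a := - _)) ?oppr_le0 // mul0r addr0.
Qed.

(** The three matrices are folded together because G mutates with the sign of column k of the
    current C. *)
Definition CG B0 ks : 'M[int]_n * 'M[int]_n * 'M[int]_n :=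
  foldl (fun t k => let: (B, C, G) := t in
           (mut_sq k B, Cmut B k C, G *m Hmat B k (csgn C k))) (B0, 1%:M, 1%:M) ks.
Definition Cp B ks := (CG B ks).1.2.
Definition Gp B ks := (CG B ks).2.

Lemma CG1 B ks : (CG B ks).1.1 = Bp B ks.
Proof.
elim/last_ind: ks => // ks k IH; rewrite /CG foldl_rcons -/(CG B ks) Bp_rcons -IH.
by case: (CG B ks) => [[]].
Qed.

Lemma Cp_rcons B ks k : Cp B (rcons ks k) = Cmut (Bp B ks) k (Cp B ks).
Proof.
rewrite /Cp -CG1 /CG foldl_rcons -/(CG B ks).
by case: (CG B ks) => [[]].
Qed.

Lemma Gp_rcons B ks k :
  Gp B (rcons ks k) = Gp B ks *m Hmat (Bp B ks) k (csgn (Cp B ks) k).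
Proof.
rewrite /Gp /Cp -CG1 /CG foldl_rcons -/(CG B ks).
by case: (CG B ks) => [[]].
Qed.

(** Coherence is asked only of the column about to be mutated, never of the final C-matrix. *)
Definition okpath B ks :=
  forall ks1 l ks2, ks = rcons ks1 l ++ ks2 -> coh (Cp B ks1) l.

Lemma okpath_rcons B ks k : okpath B (rcons ks k) -> okpath B ks /\ coh (Cp B ks) k.
Proof.
move=> h; split; last by apply: (h ks k [::]); rewrite cats0.
by move=> ks1 l ks2 e; apply: (h ks1 l (rcons ks2 k)); rewrite e rcons_cat.
Qed.

Lemma okpath_ind B (P : seq 'I_n -> Prop) : P [::] ->
  (forall ks k, okpath B (rcons ks k) -> okpath B ks -> coh (Cp B ks) k ->
     P ks -> P (rcons ks k)) ->
  forall ks, okpath B ks -> P ks.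
Proof.
move=> h0 hS; elim/last_ind => // ks k IH ok.
by have [ok1 ck] := okpath_rcons ok; apply: hS => //; apply: IH.
Qed.

Lemma Cp_rconsE B ks k : coh (Cp B ks) k ->
  Cp B (rcons ks k) = Cp B ks *m Emat (Bp B ks) k (csgn (Cp B ks) k).
Proof. by move=> /cohP h; rewrite Cp_rcons (Cmut_E _ h). Qed.

(** By [DHE] a step inserts E twice, and E is an involution. This duality carries information
    between the rows of G and the columns of C. *)
Lemma GDC d B ks : skewD d B -> okpath B ks ->
  (Gp B ks)^T *m Dmx d *m Cp B ks = Dmx d.
Proof.
move=> h; elim/okpath_ind => [|{}ks k _ _ ck IH].
  by rewrite /Gp /Cp /= trmx1 mul1mx mulmx1.
rewrite Cp_rconsE // Gp_rcons; set s := csgn _ _; set B' := Bp B ks.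
have HD : (Hmat B' k s)^T *m Dmx d = Dmx d *m Emat B' k s.
  by rewrite -{1}(trDmx d) -trmx_mul (DHE _ _ (Bp_skewD ks h)) trmx_mul trmxK trDmx.
have -> : (Gp B ks *m Hmat B' k s)^T *m Dmx d *m (Cp B ks *m Emat B' k s)
    = (Hmat B' k s)^T *m ((Gp B ks)^T *m Dmx d *m Cp B ks) *m Emat B' k s.
  by rewrite trmx_mul !mulmxA.
by rewrite IH HD -mulmxA EmatK mulmx1.
Qed.

(** The factors H of G and of H B E cancel. This identity says that the variables [Yh] have degree
    0. *)
Lemma GB d B ks : skewD d B -> okpath B ks -> Gp B ks *m Bp B ks = B *m Cp B ks.
Proof.
move=> h; elim/okpath_ind => [|{}ks k _ _ ck IH].
  by rewrite /Gp /Cp /= mul1mx mulmx1.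
rewrite Cp_rconsE // Gp_rcons Bp_rcons (mut_HBE k (csgn (Cp B ks) k) (Bp_skewD ks h)).
by rewrite !mulmxA -[_ *m Hmat _ _ _ *m Hmat _ _ _]mulmxA HmatK mulmx1 IH.
Qed.

Lemma Emat_unit B k s : Emat B k s \in unitmx.
Proof. exact: (proj1 (mulmx1_unit (EmatK B k s))). Qed.
Lemma Hmat_unit B k s : Hmat B k s \in unitmx.
Proof. exact: (proj1 (mulmx1_unit (HmatK B k s))). Qed.

Lemma Cp_unit B ks : okpath B ks -> Cp B ks \in unitmx.
Proof.
elim/okpath_ind => [|{}ks k _ _ ck IH]; first by rewrite /Cp /= unitmx1.
by rewrite Cp_rconsE // unitmx_mul IH Emat_unit.
Qed.

Lemma Gp_unit B ks : Gp B ks \in unitmx.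
Proof.
elim/last_ind: ks => [|ks k IH]; first by rewrite /Gp /= unitmx1.
by rewrite Gp_rcons unitmx_mul IH Hmat_unit.
Qed.

End Mutation.

(** * Exchange relations evaluated at points *)

Section ClusterVariables.
Variables (m n : nat) (r : 'I_n -> 'I_m) (K : fieldType).
Implicit Types (Ct : 'M[int]_(m, n)) (x : 'I_m -> K).

Definition mon p (x : 'I_p -> K) (a : 'I_p -> int) : K := \prod_i x i ^ a i.

Definition Xmut k Ct x : 'I_m -> K := fun i =>
  if i == r k then (mon x (fun i => posp (Ct i k)) + mon x (fun i => posp (- Ct i k)))
                   / x (r k)
  else x i.

(** The path is consumed from the initial seed, so that its head changes the initial cluster;
    [Xp_rcons] gives mutation at the far end. *)
Fixpoint Xp Ct ks x : 'I_m -> K :=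
  if ks is k :: ks' then Xp (mutf r k Ct) ks' (Xmut k Ct x) else x.

Definition Ctp Ct ks := foldl (fun Ct k => mutf r k Ct) Ct ks.

Lemma Xp_rcons Ct ks k x : Xp Ct (rcons ks k) x = Xmut k (Ctp Ct ks) (Xp Ct ks x).
Proof. by elim: ks Ct x => //= l ks IH Ct x; rewrite IH. Qed.

Definition up Ct : 'M[int]_n := \matrix_(i, j) Ct (r i) j.

Hypothesis r_inj : injective r.

Lemma up_mutf k Ct : up (mutf r k Ct) = mut_sq k (up Ct).
Proof. by apply/matrixP=> i j; rewrite !mxE (inj_eq r_inj). Qed.

Lemma mutfK k Ct : Ct (r k) k = 0 -> mutf r k (mutf r k Ct) = Ct.
Proof.
move=> kk; apply/matrixP=> i j; rewrite !mxE !eqxx /= orbT.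
case: (eqVneq i (r k)) => [->|ik]; first by rewrite /= opprK.
case: (eqVneq j k) => [->|jk]; rewrite /= ?opprK //.
have := pospB (Ct i k); have := pospB (Ct (r k) j).
move: (posp _) (posp _) (posp _) (posp _) => a b c e <- <-; ring.
Qed.

Lemma mutfN k Ct : mutf r k (- Ct) = - mutf r k Ct.
Proof.
apply/matrixP=> i j; rewrite !mxE; case: ifP => // _; rewrite !opprK.
have := pospB (Ct i k); have := pospB (Ct (r k) j).
move: (posp _) (posp _) (posp _) (posp _) => a b c e <- <-; ring.
Qed.

Lemma XmutN k Ct x : Xmut k (- Ct) x =1 Xmut k Ct x.
Proof.
move=> i; rewrite /Xmut; case: ifP => // _; congr (_ / _).
rewrite addrC; congr (_ + _); apply: eq_bigr => l _; by rewrite !mxE ?opprK.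
Qed.

Lemma eq_mon p (x y : 'I_p -> K) a b : x =1 y -> a =1 b -> mon x a = mon y b.
Proof. by move=> e1 e2; apply: eq_bigr => i _; rewrite e1 e2. Qed.

Lemma eq_Xmut k Ct x y : x =1 y -> Xmut k Ct x =1 Xmut k Ct y.
Proof.
move=> e i; rewrite /Xmut; case: ifP => // _.
by rewrite e; congr ((_ + _) / _); apply: eq_mon.
Qed.

Lemma eq_Xp Ct ks x y : x =1 y -> Xp Ct ks x =1 Xp Ct ks y.
Proof. by elim: ks Ct x y => //= k ks IH Ct x y e; apply: IH; apply: eq_Xmut. Qed.

Lemma XpN Ct ks x : Xp (- Ct) ks x =1 Xp Ct ks x.
Proof.
elim: ks Ct x => //= k ks IH Ct x i.
by rewrite mutfN IH; apply: eq_Xp; apply: XmutN.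
Qed.

Lemma Xmut_other k Ct x i : i != r k -> Xmut k Ct x i = x i.
Proof. by rewrite /Xmut => /negPf->. Qed.

Lemma eq_mon_off k x y (a : 'I_m -> int) : (forall i, i != r k -> x i = y i) -> a (r k) = 0 ->
  mon x a = mon y a.
Proof.
move=> e ak; apply: eq_bigr => i _; case: (eqVneq i (r k)) => [->|ik]; last by rewrite e.
by rewrite ak !expr0z.
Qed.

Lemma XmutK k Ct x : Ct (r k) k = 0 -> x (r k) != 0 ->
  mon x (fun i => posp (Ct i k)) + mon x (fun i => posp (- Ct i k)) != 0 ->
  Xmut k (mutf r k Ct) (Xmut k Ct x) =1 x.
Proof.
move=> kk xk P0 i; rewrite {1}/Xmut; case: (eqVneq i (r k)) => [->|ik]; last first.
  by rewrite Xmut_other.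
have e1 : mon (Xmut k Ct x) (fun i => posp (mutf r k Ct i k)) = mon x (fun i => posp (- Ct i k)).
  rewrite (@eq_mon_off k _ x) => [||]; last by rewrite mxE eqxx /= kk oppr0 posp0.
    by apply: eq_mon => // j; rewrite mxE eqxx orbT.
  by move=> j jk; rewrite Xmut_other.
have e2 : mon (Xmut k Ct x) (fun i => posp (- mutf r k Ct i k)) = mon x (fun i => posp (Ct i k)).
  rewrite (@eq_mon_off k _ x) => [||]; last by rewrite mxE eqxx /= kk !oppr0 posp0.
    by apply: eq_mon => // j; rewrite mxE eqxx orbT opprK.
  by move=> j jk; rewrite Xmut_other.
rewrite e1 e2 /Xmut eqxx; set P := _ + _ in P0 *.
by rewrite addrC -/P invf_div mulrCA divff ?mulr1.
Qed.

End ClusterVariables.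

Section Monomials.
Variables (p : nat) (K : fieldType).
Implicit Types (x : 'I_p -> K) (a b : 'I_p -> int).

Lemma mon_neq0 x a : (forall i, x i != 0) -> mon x a != 0.
Proof. by move=> h; apply/prodf_neq0 => i _; rewrite expfz_neq0. Qed.

Lemma monD x a b : (forall i, x i != 0) -> mon x (fun i => a i + b i) = mon x a * mon x b.
Proof. by move=> h; rewrite -big_split; apply: eq_bigr => i _; rewrite expfzDr. Qed.

Lemma monN x a : (forall i, x i != 0) -> mon x (fun i => - a i) = (mon x a)^-1.
Proof. by move=> h; rewrite -prodfV; apply: eq_bigr => i _; rewrite invr_expz. Qed.

Lemma mon0 x : mon x (fun=> 0) = 1.
Proof. by apply: big1 => i _; rewrite expr0z. Qed.

Lemma monMz x a (c : int) : mon x (fun i => a i * c) = mon x a ^ c.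
Proof.
have expn (e : nat) : mon x a ^+ e = \prod_i (x i ^ a i) ^+ e by rewrite prodrXl.
case: c => e; first by rewrite -exprnP expn; apply: eq_bigr => i _; rewrite -exprz_exp.
rewrite NegzE -exprnN expn -prodfV; apply: eq_bigr => i _.
by rewrite exprnN exprz_exp.
Qed.

Lemma monXl q x (A : 'I_p -> 'I_q -> int) (b : 'I_q -> int) : (forall i, x i != 0) ->
  \prod_j mon x (A^~ j) ^ b j = mon x (fun i => \sum_j A i j * b j).
Proof.
move=> h; have -> : mon x (fun i => \sum_j A i j * b j) = \prod_i \prod_j x i ^ (A i j * b j).
  apply: eq_bigr => i _; elim/big_rec2: _ => [|j y z _ <-]; first by rewrite expr0z.
  by rewrite expfzDr.
by rewrite exchange_big; apply: eq_bigr => j _; rewrite -monMz.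
Qed.

End Monomials.

Lemma mon_gt0 (p : nat) (K : numFieldType) (x : 'I_p -> K) a :
  (forall i, 0 < x i) -> 0 < mon x a.
Proof. by move=> h; apply: prodr_gt0 => i _; apply: exprz_gt0. Qed.

Lemma Xmut_gt0 (m n : nat) (r : 'I_n -> 'I_m) (K : numFieldType) k Ct (x : 'I_m -> K) :
  (forall i, 0 < x i) -> forall i, 0 < Xmut r k Ct x i.
Proof.
by move=> h i; rewrite /Xmut; case: ifP => // _; rewrite divr_gt0 // addr_gt0 // mon_gt0.
Qed.

Lemma Xp_gt0 (m n : nat) (r : 'I_n -> 'I_m) (K : numFieldType) Ct ks (x : 'I_m -> K) :
  (forall i, 0 < x i) -> forall i, 0 < Xp r Ct ks x i.
Proof. by elim: ks Ct x => //= k ks IH Ct x h; apply: IH; apply: Xmut_gt0. Qed.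

(** * The Laurent phenomenon *)

Section LaurentFunctions.
Variables (m : nat) (Q : rat -> Prop).
Hypothesis Q0 : forall x, Q x -> x != 0.
Implicit Types (f g : ('I_m -> rat) -> rat).

Definition allQ (x : 'I_m -> rat) := forall i, Q (x i).

(** Laurent polynomials as functions on the points with coordinates in Q. Positive points keep
    exchange denominators nonzero; nonzero points allow evaluation where a coordinate is -1. *)
Definition Laur f := exists (p : {mpoly rat[m]}) (e : nat),
  forall x, allQ x -> f x * (\prod_i x i) ^+ e = p.@[x].

Definition mprod : {mpoly rat[m]} := \prod_i 'X_i.

Lemma mprodE x : mprod.@[x] = \prod_i x i.
Proof. by rewrite rmorph_prod /=; apply: eq_bigr => i _; rewrite mevalXU. Qed.

Lemma prodQ x : allQ x -> \prod_i x i != 0.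
Proof. by move=> h; apply/prodf_neq0 => i _; apply: Q0. Qed.

Lemma Laur_eq f g : (forall x, allQ x -> f x = g x) -> Laur f -> Laur g.
Proof. by move=> h [p [e H]]; exists p, e => x hx; rewrite -h // H. Qed.

Lemma Laur_cst c : Laur (fun=> c).
Proof. by exists c%:MP, 0%N => x _; rewrite mulr1 mevalC. Qed.

Lemma Laur_var i : Laur (fun x => x i).
Proof. by exists 'X_i, 0%N => x _; rewrite mulr1 mevalXU. Qed.

Lemma Laur_inv i : Laur (fun x => (x i)^-1).
Proof.
exists (\prod_(j | j != i) 'X_j), 1%N => x hx.
rewrite rmorph_prod /= (bigD1 i) //= expr1 mulKf; last exact: Q0.
by apply: eq_bigr => j _; rewrite mevalXU.
Qed.

Lemma LaurD f g : Laur f -> Laur g -> Laur (fun x => f x + g x).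
Proof.
move=> [p [e H]] [q [e' H']]; exists (p * mprod ^+ e' + q * mprod ^+ e), (e + e')%N => x hx.
by rewrite mevalD !mevalM !rmorphXn /= mprodE -H // -H' // exprD; ring.
Qed.

Lemma LaurM f g : Laur f -> Laur g -> Laur (fun x => f x * g x).
Proof.
move=> [p [e H]] [q [e' H']]; exists (p * q), (e + e')%N => x hx.
by rewrite mevalM -H // -H' // exprD; ring.
Qed.

Lemma LaurX f e : Laur f -> Laur (fun x => f x ^+ e).
Proof.
move=> h; elim: e => [|e IH]; first exact: Laur_cst.
by apply: Laur_eq (LaurM h IH) => x _; rewrite exprS.
Qed.

Lemma Laur_sum (I : Type) (s : seq I) (P : pred I) F : (forall i, Laur (F i)) ->
  Laur (fun x => \sum_(i <- s | P i) F i x).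
Proof.
move=> h; elim: s => [|a s IH].
  by apply: Laur_eq (Laur_cst 0) => x _; rewrite big_nil.
case Pa: (P a).
  by apply: Laur_eq (LaurD (h a) IH) => x _; rewrite big_cons Pa.
by apply: Laur_eq IH => x _; rewrite big_cons Pa.
Qed.

Lemma Laur_prod (I : Type) (s : seq I) (P : pred I) F : (forall i, P i -> Laur (F i)) ->
  Laur (fun x => \prod_(i <- s | P i) F i x).
Proof.
move=> h; elim: s => [|a s IH].
  by apply: Laur_eq (Laur_cst 1) => x _; rewrite big_nil.
case Pa: (P a).
  by apply: Laur_eq (LaurM (h a Pa) IH) => x _; rewrite big_cons Pa.
by apply: Laur_eq IH => x _; rewrite big_cons Pa.
Qed.

Lemma Laur_exprz i (a : int) : Laur (fun x => x i ^ a).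
Proof.
case: a => e; first by apply: LaurX; apply: Laur_var.
by apply: Laur_eq (LaurX e.+1 (Laur_inv i)) => x _; rewrite NegzE -exprnN exprVn.
Qed.

Lemma Laur_mon (a : 'I_m -> int) : Laur (fun x => mon x a).
Proof. by apply: Laur_prod => i _; apply: Laur_exprz. Qed.

Lemma Laur_meval p (s : ('I_m -> rat) -> 'I_p -> rat) (P : {mpoly rat[p]}) :
  (forall i, Laur (fun x => s x i)) -> Laur (fun x => P.@[s x]).
Proof.
move=> h; apply: (@Laur_eq (fun x => \sum_(a <- msupp P) P@_a * \prod_i s x i ^+ a i)).
  by move=> x _; rewrite mevalE.
apply: Laur_sum => a; apply: LaurM; first exact: Laur_cst.
by apply: Laur_prod => i _; apply: LaurX.
Qed.

End LaurentFunctions.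

Definition posQ (x : rat) : Prop := 0 < x.
Definition nzQ (x : rat) : Prop := x != 0.
Lemma posQ0 x : posQ x -> x != 0. Proof. by move/lt0r_neq0. Qed.
Notation LaurP := (@Laur _ posQ).
Notation LaurN := (@Laur _ nzQ).

Lemma LaurNP m (f : ('I_m -> rat) -> rat) : LaurN f -> LaurP f.
Proof. by move=> [p [e H]]; exists p, e => x hx; apply: H => i; apply: posQ0. Qed.

(** The denominator of f turns into a power of the product of the s_i, hence the separate condition
    on its inverse. *)
Lemma Laur_comp p q Q (s : ('I_p -> rat) -> 'I_q -> rat) (f : ('I_q -> rat) -> rat) :
  (forall x, Q x -> x != 0) ->
  (forall i, @Laur p Q (fun x => s x i)) -> @Laur p Q (fun x => (\prod_i s x i)^-1) ->
  (forall x, allQ Q x -> allQ posQ (s x)) ->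
  LaurP f -> @Laur p Q (fun x => f (s x)).
Proof.
move=> Q0 h1 h2 h3 [P [e H]].
apply: (@Laur_eq _ _ (fun x => P.@[s x] * (\prod_i s x i)^-1 ^+ e)).
  move=> x hx; rewrite -H; last exact: h3.
  by rewrite exprVn mulfK // expf_neq0 //; apply: (prodQ posQ0); apply: h3.
by apply: LaurM; [exact: Laur_meval|exact: LaurX].
Qed.

Lemma poly_pos0 (p : {poly rat}) : (forall x : rat, 0 < x -> p.[x] = 0) -> p = 0.
Proof.
move=> h; apply: (@roots_geq_poly_eq0 _ _ [seq (i.+1)%:R | i <- iota 0 (size p)]).
- by apply/allP=> x /mapP[i _ ->]; apply/eqP; apply: h; rewrite ltr0n.
- rewrite map_inj_uniq ?iota_uniq // => i j /eqP; rewrite eqr_nat => /eqP; lia.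
- by rewrite size_map size_iota.
Qed.

Lemma meval_muni m (p : {mpoly rat[m.+1]}) x :
  p.@[x] = (map_poly (meval (fun i => x (widen_ord (leqnSn m) i))) (muni p)).[x ord_max].
Proof.
rewrite muniE raddf_sum /= horner_sum mevalE; apply: eq_bigr => a _.
rewrite map_polyZ /= map_polyXn hornerZ hornerXn mevalZ mevalX big_ord_recr /= mulrA.
congr (_ * _ * _); apply: eq_bigr => i _; rewrite mnmE; congr (x _ ^+ a _); exact: val_inj.
Qed.

Lemma muni_eq0 m (p : {mpoly rat[m.+1]}) : muni p = 0 -> p = 0.
Proof.
move=> h; apply/mpolyP=> a; rewrite mcoeff0.
have := congr1 (fun q : {poly _} => q`_(a ord_max)) h.
move/(congr1 (mcoeff [multinom a (widen_ord (leqnSn m) i) | i < m])).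
rewrite coef0 mcoeff0 muniE coef_sum raddf_sum /=.
case: (boolP (a \in msupp p)) => ap; last by move/memN_msupp_eq0: ap.
rewrite (bigD1_seq a) ?msupp_uniq //= coefZ coefXn eqxx mulr1 mcoeffZ mcoeffX eqxx mulr1.
rewrite big1_seq ?addr0 // => b /andP[ba _].
rewrite coefZ coefXn; case: eqP => [e|_]; last by rewrite mulr0 mcoeff0.
rewrite mulr1 mcoeffZ mcoeffX; case: eqP => [e'|_]; last by rewrite mulr0.
case/negP: ba; apply/eqP/mnmP=> i; case: (unliftP ord_max i) => [j ->|->]; last by [].
have /mnmP/(_ j) := e'; rewrite !mnmE.
by have -> : widen_ord (leqnSn m) j = lift ord_max j by apply: val_inj; rewrite /= /bump leqNgt ltn_ord.
Qed.

Lemma mpoly_pos0 m (p : {mpoly rat[m]}) :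
  (forall x : 'I_m -> rat, (forall i, 0 < x i) -> p.@[x] = 0) -> p = 0.
Proof.
elim: m p => [|m IH] p h.
  have := h (fun=> 0) (fun i => match i with Ordinal _ H => False_rect _ (notF H) end).
  by rewrite [p]nvar0_mpolyC mevalC => ->; rewrite mpolyC0.
apply: muni_eq0; apply/polyP=> j; rewrite coef0; apply: IH => y hy.
have : map_poly (meval y) (muni p) = 0.
  apply: poly_pos0 => s s0.
  pose x i := if unlift ord_max i is Some k then y k else s.
  have hx i : 0 < x i by rewrite /x; case: (unlift _ _).
  have := h x hx; rewrite meval_muni; have -> : x ord_max = s by rewrite /x unlift_none.
  move=> e; rewrite -[RHS]e; congr (_.[_]); apply: eq_map_poly => q; apply: meval_eq => i.
  rewrite /x; have -> : widen_ord (leqnSn m) i = lift ord_max i.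
    by apply: val_inj; rewrite /= /bump leqNgt ltn_ord.
  by rewrite liftK.
by move/(congr1 (fun q : {poly _} => q`_j)); rewrite coef_map coef0.
Qed.

Lemma mpoly_eq_pos m (p q : {mpoly rat[m]}) :
  (forall x : 'I_m -> rat, (forall i, 0 < x i) -> p.@[x] = q.@[x]) -> p = q.
Proof.
by move=> h; apply/eqP; rewrite -subr_eq0; apply/eqP/mpoly_pos0 => x hx; rewrite mevalB h // subrr.
Qed.

Section Divide.
Variables (m : nat) (u : 'I_m) (c : rat).
Implicit Types (p q : {mpoly rat[m]}).

Definition subst_cst p : {mpoly rat[m]} :=
  p \mPo [tuple if i == u then c%:MP else 'X_i | i < m].

Lemma subst_cstM p q : subst_cst (p * q) = subst_cst p * subst_cst q.
Proof. exact: rmorphM. Qed.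

Lemma subst_cstE p x : (subst_cst p).@[x] = p.@[fun i => if i == u then c else x i].
Proof.
rewrite comp_mpoly_meval; apply: meval_eq => i; rewrite tnth_mktuple.
by case: ifP; rewrite ?mevalC ?mevalXU.
Qed.

Lemma subst_cst_div p : exists q, p = subst_cst p + ('X_u - c%:MP) * q.
Proof.
have lin (a : rat) p1 p2 : (exists q, p1 = subst_cst p1 + ('X_u - c%:MP) * q) ->
    (exists q, p2 = subst_cst p2 + ('X_u - c%:MP) * q) ->
    exists q, a%:MP * p1 + p2 = subst_cst (a%:MP * p1 + p2) + ('X_u - c%:MP) * q.
  move=> [q1 e1] [q2 e2]; exists (a%:MP * q1 + q2).
  have -> : subst_cst (a%:MP * p1 + p2) = a%:MP * subst_cst p1 + subst_cst p2.
    by rewrite /subst_cst comp_mpolyD -/(subst_cst _) subst_cstM /subst_cst comp_mpolyC.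
  by rewrite [in LHS]e1 [in LHS]e2; ring.
elim/mpolyind: p => [|a b p _ _ IHp].
  by exists 0; rewrite /subst_cst comp_mpoly0 mulr0 addr0.
suff IHb : exists q', 'X_[b] = subst_cst 'X_[b] + ('X_u - c%:MP) * q' :> {mpoly rat[m]}.
  by rewrite -mul_mpolyC; exact: lin.
have step (s : seq 'I_m) : exists q', \prod_(i <- s) 'X_i ^+ b i =
    subst_cst (\prod_(i <- s) 'X_i ^+ b i) + ('X_u - c%:MP) * q' :> {mpoly rat[m]}.
  have mulP p1 p2 : (exists q1, p1 = subst_cst p1 + ('X_u - c%:MP) * q1) ->
      (exists q2, p2 = subst_cst p2 + ('X_u - c%:MP) * q2) ->
      exists q3, p1 * p2 = subst_cst (p1 * p2) + ('X_u - c%:MP) * q3.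
    move=> [q1 e1] [q2 e2]; exists (q1 * p2 + subst_cst p1 * q2).
    have e3 : p1 * p2 = subst_cst p1 * p2 + ('X_u - c%:MP) * q1 * p2 by rewrite {1}e1; ring.
    by rewrite subst_cstM e3 {1}e2; ring.
  have one : exists q1, 1 = subst_cst 1 + ('X_u - c%:MP) * q1.
    by exists 0; rewrite /subst_cst comp_mpoly1 mulr0 addr0.
  elim: s => [|i s IH]; first by rewrite big_nil.
  rewrite big_cons; apply: (mulP _ _) => //; elim: (b i) => [|e0 IHe]; first by rewrite expr0.
  rewrite exprS; apply: (mulP _ _) => //.
  rewrite /subst_cst comp_mpolyXU -tnth_nth tnth_mktuple.
  by case: eqP => [->|_]; [exists 1; rewrite mulr1 addrC subrK | exists 0; rewrite mulr0 addr0].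
by have [q' e'] := step (index_enum _); exists q'; rewrite mpolyXE_id.
Qed.

Lemma subst_cst0 p : subst_cst p = 0 -> exists q, p = ('X_u - c%:MP) * q.
Proof. by have [q e] := subst_cst_div p => h; exists q; rewrite {1}e h add0r. Qed.

End Divide.

(** Coprimality: [q z0 != 0] on the hyperplane z_u = -1 shows that 1 + z_u does not divide q. Hence
    it divides the numerator of the other expansion, and its exponent can be lowered one at a
    time. *)
Lemma Laur_divide m (u : 'I_m) (H q : ('I_m -> rat) -> rat) (z0 : 'I_m -> rat) a e :
  z0 u = -1 -> (forall i, z0 i != 0) -> LaurN q -> q z0 != 0 ->
  LaurP (fun z => H z * q z ^+ e) -> LaurP (fun z => H z * (1 + z u) ^+ a) -> LaurP H.
Proof.
move=> zu z0n [pq [e3 Hq]] qz0 [p2 [e2 H2]]; elim: a => [|a IH] Ha.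
  by apply: Laur_eq Ha => x _; rewrite expr0 mulr1.
case: Ha => [p1 [e1 H1]].
(* Both expansions of H with denominators cleared. Substituting z_u = -1 kills the right side, while
   the factors of p1 on the left survive. *)
have id : p1 * pq ^+ e * mprod m ^+ e2 =
          p2 * (1 + 'X_u) ^+ a.+1 * mprod m ^+ e1 * mprod m ^+ (e3 * e).
  apply: mpoly_eq_pos => x hx.
  rewrite !mevalM !rmorphXn /= !mprodE mevalD meval1 mevalXU -H1 // -H2 // -Hq => [|i]; last exact: lt0r_neq0.
  by rewrite exprMn exprM; ring.
have ev : (subst_cst u (-1) pq).@[z0] != 0.
  rewrite subst_cstE (@meval_eq _ _ _ z0) => [|i]; last by case: eqP => [->|].
  by rewrite -Hq // mulf_neq0 // expf_neq0 //; apply/prodf_neq0 => i _.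
have pqn : subst_cst u (-1) pq != 0 by apply: contraNneq ev => ->; rewrite meval0.
have prn : subst_cst u (-1) (mprod m) != 0.
  have : (subst_cst u (-1) (mprod m)).@[z0] != 0.
    rewrite subst_cstE mprodE; apply/prodf_neq0 => i _; by case: ifP.
  by apply: contraNneq => ->; rewrite meval0.
have p10 : subst_cst u (-1) p1 = 0.
  have := congr1 (subst_cst u (-1)) id; rewrite !subst_cstM.
  have -> : subst_cst u (-1) ((1 + 'X_u) ^+ a.+1) = 0.
    rewrite /subst_cst rmorphXn /= comp_mpolyD comp_mpoly1 comp_mpolyXU -tnth_nth tnth_mktuple eqxx.
    by rewrite mpolyCN mpolyC1 subrr expr0n.
  rewrite mulr0 !mul0r => /eqP; rewrite !mulf_eq0 /subst_cst !rmorphXn /= !expf_eq0.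
  by rewrite (negPf pqn) (negPf prn) !andbF !orbF => /eqP.
have [p1' ep] := subst_cst0 p10.
apply: IH; exists p1', e1 => x hx.
have xu : 1 + x u != 0 by apply: lt0r_neq0; rewrite addr_gt0 //; apply: hx.
apply: (mulfI xu); have := H1 x hx; rewrite ep mevalM mevalB mevalC mevalXU opprK (addrC (x u)) => <-.
by rewrite exprS; ring.
Qed.

Lemma mon_upd (p : nat) (K : fieldType) (x y : 'I_p -> K) (i : 'I_p) a :
  (forall l, l != i -> y l = x l) ->
  mon y a = y i ^ a i * mon x (fun l => if l == i then 0 else a l).
Proof.
move=> h; rewrite /mon (bigD1 i) //= [in RHS](bigD1 i) //= eqxx expr0z mul1r.
by congr (_ * _); apply: eq_bigr => l li; rewrite (negPf li) h.
Qed.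

Lemma prod_upd (p : nat) (K : fieldType) (x y : 'I_p -> K) (i : 'I_p) :
  (forall l, l != i -> y l = x l) -> \prod_l y l = y i * \prod_(l | l != i) x l.
Proof. by move=> h; rewrite (bigD1 i) //=; congr (_ * _); apply: eq_bigr. Qed.

(** * Laurent expansions across three mutations at j, k, j *)

Section LaurentStep.
Variables (n m : nat) (r : 'I_n -> 'I_m) (d : 'I_n -> nat) (Ct : 'M[int]_(m, n)).
Variables (j k : 'I_n) (u : 'I_m) (rest : seq 'I_n) (i : 'I_m).
Hypotheses (r_inj : injective r) (sk : skewD d (up r Ct)) (jk : j != k).
Hypotheses (ur : forall l, u != r l) (uj : Ct u j = 1) (uo : forall l, l != j -> Ct u l = 0).
Hypothesis c0 : 0 <= Ct (r k) j.

(** Successive seeds t1, t2, t3. The target lies at [k :: rest] from t1 and at [j :: rest] from t3,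
    both one step shorter than from Ct. *)
Let Ct1 := mutf r j Ct.
Let Ct2 := mutf r k Ct1.
Let Ct3 := mutf r j Ct2.

Hypothesis h1 : LaurP (fun y => Xp r Ct1 (k :: rest) y i).
Hypothesis h3 : LaurP (fun y => Xp r Ct3 (j :: rest) y i).

Let be l := Ct l j.
Let b := Ct (r j) k.
Let c := Ct (r k) j.
Let s := absz b.
Let cn := absz c.
Let kap l := Ct1 l k.
Let gam l := Ct2 l j.

Let diag l : Ct (r l) l = 0.
Proof. by have := skewD_diag l sk; rewrite mxE. Qed.

Let bc : (d j)%:Z * b = - ((d k)%:Z * c).
Proof. by have := (proj2 sk) j k; rewrite !mxE. Qed.

Let b0 : b <= 0.
Proof.
have dj := skewD_gt0 j sk; have dk := skewD_gt0 k sk.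
by rewrite -(pmulr_rle0 _ dj) bc oppr_le0 mulr_ge0 // ltW.
Qed.

Let bs : b = - s%:Z. Proof. by rewrite /s; have := b0; lia. Qed.
Let ccn : c = cn%:Z. Proof. by rewrite /cn /c; have := c0; lia. Qed.

Let s0c0 : s = 0%N -> cn = 0%N.
Proof.
move=> e; have := bc; rewrite bs ccn e oppr0 mulr0 => /eqP.
rewrite eq_sym oppr_eq0 mulf_eq0 gt_eqF /=; last exact: (skewD_gt0 k sk).
by move=> /eqP; lia.
Qed.

Let rjk : r j != r k. Proof. by rewrite (inj_eq r_inj). Qed.

Let be_j : be (r j) = 0. Proof. exact: diag. Qed.
Let be_k : be (r k) = cn%:Z. Proof. exact: ccn. Qed.
Let be_u : be u = 1. Proof. exact: uj. Qed.

Let kap_j : kap (r j) = s%:Z.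
Proof. by rewrite /kap mxE eqxx -/b bs opprK. Qed.

Let kap_k : kap (r k) = 0.
Proof.
rewrite /kap mxE eq_sym (negPf rjk) eq_sym (negPf jk) /= diag add0r -/c -/b.
rewrite (posp_0 (a := - c)) ?oppr_le0 ?ccn // mul0r addr0.
by rewrite (posp_0 b0) mulr0.
Qed.

Let kap_u : kap u = 0.
Proof.
rewrite /kap mxE (negPf (ur j)) eq_sym (negPf jk) /= uo ?(eq_sym k) // uj add0r -/b.
by rewrite (posp_0 b0) mulr0 add0r (posp_0 (a := -1)) // mul0r.
Qed.

Let ct1kj : Ct1 (r k) j = - c.
Proof. by rewrite /Ct1 mxE eqxx orbT. Qed.

Let gamE l : l != r k -> l != r j -> gam l = - be l - c * posp (- kap l).
Proof.
move=> lk lj; rewrite /gam /Ct2 mxE (negPf lk) (negPf jk) /= -/(kap l) ct1kj.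
have -> : Ct1 l j = - be l by rewrite /Ct1 mxE eqxx orbT.
by rewrite (posp_0 (a := - c)) ?oppr_le0 // mulr0 addr0 mulrN mulrC.
Qed.

Let gam_k : gam (r k) = cn%:Z.
Proof. by rewrite /gam /Ct2 mxE eqxx /= ct1kj opprK ccn. Qed.

Let gam_j : gam (r j) = 0.
Proof.
rewrite /gam /Ct2 mxE (negPf rjk) (negPf jk) /= -/(kap _) kap_j ct1kj.
have -> : Ct1 (r j) j = 0 by rewrite /Ct1 mxE eqxx /= diag oppr0.
rewrite (posp_0 (a := - c)) ?oppr_le0 // mulr0 !add0r.
by rewrite (posp_0 (a := - _)) ?mul0r // oppr_le0.
Qed.

Let gam_u : gam u = -1.
Proof. by rewrite gamE // kap_u oppr0 posp0 mulr0 subr0 be_u. Qed.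

Implicit Types x : 'I_m -> rat.
Let off2 (a : 'I_m -> int) l := if (l == r j) || (l == r k) then 0 else a l.
Let off1 (a : 'I_m -> int) l := if l == r j then 0 else a l.
Let A x : rat := mon x (off1 (fun l => posp (kap l))).
Let A' x : rat := mon x (off1 (fun l => posp (- kap l))).
Let Gp' x : rat := mon x (off2 (fun l => posp (gam l))).
Let Gm' x : rat := mon x (off2 (fun l => posp (- gam l))).
Let T x : rat := ((mon x (fun l => posp (be l)) : rat) + (mon x (fun l => posp (- be l)) : rat)) / x (r j).
Let Y x : rat := A x * T x ^+ s + A' x.
Let Xk2 x : rat := Y x / x (r k).
(** Variable j of t3 with the division by T carried out: Y = A T^s + A' makes Y^cn - A'^cn divisible
    by T, and what remains of the binomial is a monomial times the numerator of T. The value 0 at s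
    = 0 is harmless, since then cn = 0 and the sum is empty. *)
Let R x : rat := Gp' x * x (r k) ^- cn * A x * (if s is s'.+1 then T x ^+ s' else 0) *
             (\sum_(l < cn) Y x ^+ (cn.-1 - l) * A' x ^+ l)
           + x (r j) * Gm' x * (mon x (fun l => - posp (be l)) : rat).

Let x1 x := Xmut r j Ct x.
Let x2 x := Xmut r k Ct1 (x1 x).
Let x3 x := Xmut r j Ct2 (x2 x).

Let x1j x : x1 x (r j) = T x. Proof. by rewrite /x1 /Xmut eqxx. Qed.
Let x1o x l : l != r j -> x1 x l = x l. Proof. exact: Xmut_other. Qed.

Let x2k x : x2 x (r k) = Xk2 x.
Proof.
rewrite /x2 /Xmut eqxx x1o 1?eq_sym //.
rewrite (mon_upd _ (x1o x)) [X in _ + X](mon_upd _ (x1o x)) x1j -!/(kap _).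
rewrite kap_j (posp_0 (a := - _)) ?oppr_le0 // posp_id //.
by rewrite expr0z mul1r -exprnP [T x ^+ s * _]mulrC.
Qed.

Let x2j x : x2 x (r j) = T x. Proof. by rewrite /x2 Xmut_other // x1j. Qed.
Let x2o x l : l != r j -> l != r k -> x2 x l = x l.
Proof. by move=> h h'; rewrite /x2 Xmut_other // x1o. Qed.

Let mon2 x (a : 'I_m -> int) : a (r j) = 0 ->
  mon (x2 x) a = Xk2 x ^ a (r k) * mon x (off2 a).
Proof.
move=> aj; rewrite (@mon_upd _ _ (x1 x) _ (r k)); last first.
  by move=> l lk; rewrite /x2 Xmut_other.
rewrite x2k (@mon_upd _ _ x (x1 x) (r j)); last exact: x1o.
rewrite (negPf rjk) aj expr0z mul1r; congr (_ * _).
by apply: eq_mon => // l; rewrite /off2; case: eqP; case: eqP.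
Qed.

Let nz x := forall l, x l != 0.

Let TR x : nz x -> T x * R x = Xk2 x ^+ cn * Gp' x + Gm' x.
Proof.
move=> hx; have xk := hx (r k); have xj := hx (r j).
have eT : T x * (x (r j) * Gm' x * mon x (fun l => - posp (be l))) =
          Gm' x + Gm' x * mon x (fun l => - be l).
  rewrite /T; set M1 := mon x _; set M2 := mon x _.
  have -> : mon x (fun l => - posp (be l)) = M1^-1 by rewrite monN.
  have -> : mon x (fun l => - be l) = M2 * M1^-1.
    rewrite /M2 /M1 -monN // -monD //; apply: eq_mon => // l.
    by have := pospB (- be l); rewrite opprK => ->.
  have M10 : M1 != 0 by apply: mon_neq0.
  by field; rewrite M10.
have eG : Gm' x * mon x (fun l => - be l) = Gp' x * x (r k) ^- cn * A' x ^+ cn.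
  have -> : A' x ^+ cn = mon x (fun l => off1 (fun l => posp (- kap l)) l * cn%:Z).
    by rewrite monMz.
  have -> : x (r k) ^- cn = mon x (fun l => if l == r k then - cn%:Z else 0).
    rewrite (@mon_upd _ _ x x (r k)) // eqxx exprnN -[LHS]mulr1; congr (_ * _).
    by rewrite -(mon0 x); apply: eq_mon => // l; case: eqP.
  rewrite -!monD //; apply: eq_mon => // l; rewrite /off1 /off2.
  case: (eqVneq l (r j)) => [->|lj] /=.
    by rewrite be_j (negPf rjk) mul0r oppr0 !addr0.
  case: (eqVneq l (r k)) => [->|lk] /=.
    by rewrite be_k kap_k oppr0 posp0 mul0r addr0.
  rewrite gamE // addr0 -ccn; set y := posp (- kap l).
  have := pospB (- be l - c * y); lia.
have eY : T x * (Gp' x * x (r k) ^- cn * A x * (if s is s'.+1 then T x ^+ s' else 0) *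
             (\sum_(l < cn) Y x ^+ (cn.-1 - l) * A' x ^+ l)) =
          Gp' x * x (r k) ^- cn * (Y x ^+ cn - A' x ^+ cn).
  rewrite subrXX /Y addrK; have := s0c0.
  case: s => [/(_ erefl) ->|s' _]; first by rewrite big_ord0 !mulr0.
  by rewrite exprS; ring.
by rewrite /R mulrDr eT eG eY /Xk2 exprMn exprVn; ring.
Qed.

Let pos x := forall l, 0 < x l.
Let pos_nz x : pos x -> nz x. Proof. by move=> h l; rewrite lt0r_neq0. Qed.

Let T_gt0 x : pos x -> 0 < T x.
Proof. by move=> h; rewrite /T divr_gt0 // addr_gt0 // mon_gt0. Qed.

Let x3R x : pos x -> x3 x (r j) = R x.
Proof.
move=> hx; have Tn : T x != 0 by rewrite lt0r_neq0 // T_gt0.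
apply: (mulfI Tn); rewrite TR; last exact: pos_nz.
rewrite /x3 /Xmut eqxx x2j mulrCA divff // mulr1.
rewrite (@mon2 x (fun l => posp (gam l))) ?gam_j ?posp0 //.
rewrite (@mon2 x (fun l => posp (- gam l))) ?gam_j ?oppr0 ?posp0 //.
rewrite gam_k (posp_0 (a := - _)) ?oppr_le0 // expr0z mul1r posp_id //.
Qed.

(* Monomial coordinates in which the binomial exchanged at j is a monomial
   times 1 + z_u. *)
Let tau (z : 'I_m -> rat) l :=
  if l == u then z u * mon z (fun l => if l == u then 0 else - be l) else z l.
Let tau' (x : 'I_m -> rat) l := if l == u then mon x be else x l.

Let tau_nz z : nz z -> nz (tau z).
Proof. by move=> h l; rewrite /tau; case: (l == u) => //; rewrite mulf_neq0 ?mon_neq0. Qed.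
Let tau_pos z : pos z -> pos (tau z).
Proof. by move=> h l; rewrite /tau; case: eqP => // _; rewrite mulr_gt0 ?mon_gt0. Qed.

Let tau_o z l : l != u -> tau z l = z l. Proof. by rewrite /tau => /negPf->. Qed.

Let tau_be z : nz z -> mon (tau z) be = z u.
Proof.
move=> h; rewrite (mon_upd _ (tau_o z)) be_u expr1z {1}/tau eqxx -mulrA -monD //.
rewrite -[RHS]mulr1; congr (_ * _); rewrite -(mon0 z); apply: eq_mon => // l.
by case: eqP => // _; rewrite addNr.
Qed.

Let tauK x : nz x -> tau (tau' x) =1 x.
Proof.
move=> h l; rewrite /tau; case: eqP => [->|/eqP lu]; last by rewrite /tau' (negPf lu).
rewrite (@mon_upd _ _ x (tau' x) u); last by move=> l' lu; rewrite /tau' (negPf lu).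
rewrite eqxx expr0z mul1r /tau' eqxx (@mon_upd _ _ x x u) // be_u expr1z -mulrA -monD //.
rewrite -[RHS]mulr1; congr (_ * _); rewrite -(mon0 x); apply: eq_mon => // l'.
by case: eqP => // _; rewrite addrN.
Qed.

Let Ttau z : nz z -> T (tau z) =
  mon (tau z) (fun l => posp (- be l)) * (1 + z u) / tau z (r j).
Proof.
move=> h; have h' := tau_nz h; rewrite /T; congr (_ / _).
rewrite mulrDr mulr1 addrC; congr (_ + _); rewrite -(tau_be h) -monD //.
apply: eq_mon => // l; have := pospB (be l); lia.
Qed.

Let Ltau l : LaurN (fun z => tau z l).
Proof.
case: (eqVneq l u) => [->|lu].
  apply: (@Laur_eq _ _ (fun z => z u * mon z (fun l => if l == u then 0 else - be l))).
    by move=> z _; rewrite /tau eqxx.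
  by apply: LaurM; [exact: Laur_var|exact: Laur_mon].
by apply: Laur_eq (Laur_var _ l) => z _; rewrite tau_o.
Qed.

Let Ltau1 l : LaurN (fun z => (tau z l)^-1).
Proof.
case: (eqVneq l u) => [->|lu].
  apply: (@Laur_eq _ _ (fun z => (z u)^-1 * mon z (fun l => - (if l == u then 0 else - be l)))).
    by move=> z hz; rewrite /tau eqxx invfM monN.
  by apply: LaurM; [exact: Laur_inv|exact: Laur_mon].
by apply: Laur_eq (@Laur_inv m nzQ (fun t h => h) l) => z _; rewrite tau_o.
Qed.

Let Lexp l (a : int) : LaurN (fun z => tau z l ^ a).
Proof.
case: a => e; first by apply: LaurX.
by apply: Laur_eq (LaurX e.+1 (Ltau1 l)) => x _; rewrite NegzE -exprnN exprVn.
Qed.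

Let Lmon a : LaurN (fun z => mon (tau z) a).
Proof. by apply: Laur_prod => l _. Qed.

Let LT : LaurN (fun z => T (tau z)).
Proof. by rewrite /T; apply: LaurM => //; apply: LaurD. Qed.

Let LA : LaurN (fun z => A (tau z)). Proof. exact: Lmon. Qed.
Let LA' : LaurN (fun z => A' (tau z)). Proof. exact: Lmon. Qed.
Let LGp : LaurN (fun z => Gp' (tau z)). Proof. exact: Lmon. Qed.
Let LGm : LaurN (fun z => Gm' (tau z)). Proof. exact: Lmon. Qed.

Let LY : LaurN (fun z => Y (tau z)).
Proof. by rewrite /Y; apply: LaurD => //; apply: LaurM => //; apply: LaurX. Qed.

Let LXk2 : LaurN (fun z => Xk2 (tau z)).
Proof. by rewrite /Xk2; apply: LaurM. Qed.

Let LR : LaurN (fun z => R (tau z)).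
Proof.
rewrite /R; apply: LaurD; last by apply: LaurM => //; apply: LaurM.
apply: LaurM; last first.
  by apply: Laur_sum => l; apply: LaurM; apply: LaurX.
apply: LaurM; last by case: s => [|s']; [exact: Laur_cst|exact: LaurX].
apply: LaurM => //; apply: LaurM => //.
apply: (@Laur_eq _ _ (fun z => tau z (r k) ^ (- cn%:Z))) => // z _.
by rewrite exprnN.
Qed.

Let z0 (l : 'I_m) : rat := if l == u then -1 else 1.

Let z0n : nz z0. Proof. by move=> l; rewrite /z0; case: (l == u). Qed.

Let mon_z0 a : mon (tau z0) a = (-1) ^ a u.
Proof.
rewrite (@mon_upd _ _ z0 _ u (fun l => a l)); last by move=> l lu; rewrite tau_o.
have m1 (a' : 'I_m -> int) : a' u = 0 -> mon z0 a' = 1.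
  move=> e; apply: big1 => l _; rewrite /z0; case: eqP => [->|_]; first by rewrite e expr0z.
  by rewrite exp1rz.
rewrite m1 ?eqxx // mulr1; congr (_ ^ _); rewrite /tau eqxx m1 ?eqxx // mulr1.
by rewrite /z0 eqxx.
Qed.

Let urj : (u == r j) = false. Proof. exact: negPf (ur j). Qed.
Let urk : (u == r k) = false. Proof. exact: negPf (ur k). Qed.

Let T0 : T (tau z0) = 0.
Proof. by rewrite Ttau // {2}/z0 eqxx subrr mulr0 mul0r. Qed.

Let A0 : A (tau z0) = 1.
Proof. by rewrite /A mon_z0 /off1 urj kap_u posp0. Qed.
Let A'0 : A' (tau z0) = 1.
Proof. by rewrite /A' mon_z0 /off1 urj kap_u oppr0 posp0. Qed.

Let tz0 l : tau z0 (r l) = 1.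
Proof.
have h : (r l == u) = false by rewrite eq_sym; exact: negPf (ur l).
by rewrite tau_o ?h // /z0 h.
Qed.

Let Y0 : Y (tau z0) = 1 + (s == 0%N)%:R.
Proof. by rewrite /Y T0 A0 A'0 mul1r expr0n addrC. Qed.

(** At z0 the variable T vanishes. Then Y and Xk2 are positive, and R is a nonnegative term plus 1,
    so the denominators met in t3 are prime to 1 + z_u. *)
Let q0 : R (tau z0) * Xk2 (tau z0) != 0.
Proof.
have nY : 0 < Y (tau z0) by rewrite Y0 ltr_pwDl.
have nX : 0 < Xk2 (tau z0) by rewrite /Xk2 tz0 divr1.
rewrite mulf_neq0 //; last exact: lt0r_neq0.
apply: lt0r_neq0; rewrite /R !tz0 A0 T0 /Gp' /Gm' !mon_z0 /off2 urj urk /= gam_u.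
rewrite be_u /= expr1n invr1 !mul1r.
have -> : (-1) ^ posp (- (-1)) * (-1) ^ (- posp 1) = 1 :> rat by [].
apply: ltr_wpDl => //; apply: mulr_ge0; first by case: s => // s'; rewrite exprn_ge0.
by apply: sumr_ge0 => l _; rewrite mulr_ge0 ?exprn_ge0 ?A'0 // ltW.
Qed.

Lemma Laur_step : LaurP (fun x => Xp r Ct (j :: k :: rest) x i).
Proof.
suff H : LaurP (fun z => Xp r Ct (j :: k :: rest) (tau z) i).
  apply: (@Laur_eq _ _ (fun x => Xp r Ct (j :: k :: rest) (tau (tau' x)) i)).
    by move=> x hx; apply: eq_Xp; apply: tauK; apply: pos_nz hx.
  apply: (Laur_comp posQ0 _ _ _ H).
  - move=> l; rewrite /tau'; case: eqP => _; [exact: (Laur_mon posQ0)|exact: Laur_var].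
  - apply: (@Laur_eq _ _ (fun x => \prod_l (if l == u then mon x (fun l => - be l) else (x l)^-1))).
      move=> x hx; rewrite -prodfV; apply: eq_bigr => l _; rewrite /tau'.
      by case: eqP => // _; rewrite monN //; apply: pos_nz.
    apply: Laur_prod => l _; case: eqP => _; [exact: (Laur_mon posQ0)|exact: (Laur_inv posQ0)].
  - by move=> x hx l; rewrite /tau'; case: eqP => // _; apply: mon_gt0.
case: h1 h3 => [P1 [e1 H1]] [P3 [e3 H3]].
have zu : z0 u = -1 by rewrite /z0 eqxx.
apply: (@Laur_divide _ u _ (fun z => R (tau z) * Xk2 (tau z)) z0 e1 e3 zu z0n).
- exact: LaurM.
- exact: q0.
(* Expansion in t3: beyond the Laurent monomials, only R and Xk2 enter the denominator. *)
- pose M z := \prod_(l | (l != r j) && (l != r k)) tau z l.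
  pose X3 z l := if l == r j then R (tau z) else if l == r k then Xk2 (tau z) else tau z l.
  apply: (@Laur_eq _ _ (fun z => P3.@[X3 z] * \prod_(l | (l != r j) && (l != r k)) ((tau z l)^-1) ^+ e3)).
    move=> z hz; have hx := tau_pos hz.
    have e : X3 z =1 x3 (tau z).
      move=> l; rewrite /X3; case: eqP => [->|/eqP lj]; first by rewrite x3R.
      rewrite /x3 Xmut_other //; case: eqP => [->|/eqP lk]; first by rewrite x2k.
      by rewrite x2o.
    have hx1 : forall l, 0 < x1 (tau z) l by apply: Xmut_gt0.
    have hx2 : forall l, 0 < x2 (tau z) l by apply: Xmut_gt0.
    have hx3 : forall l, 0 < x3 (tau z) l by apply: Xmut_gt0.
    rewrite (meval_eq _ e) -H3 // /= -/(x1 _) -/Ct1 -/(x2 _) -/Ct2.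
    have e23 : Xmut r j Ct3 (x3 (tau z)) =1 x2 (tau z).
      apply: XmutK; [exact: gam_j|exact: lt0r_neq0|].
      by apply: lt0r_neq0; rewrite addr_gt0 // mon_gt0.
    rewrite (eq_Xp r _ rest e23).
    rewrite /Ct3 mutfK; last exact: gam_j.
    rewrite (eq_bigr (X3 z)) => [|l _]; last by rewrite e.
    rewrite (bigD1 (r j)) //= (bigD1 (r k)) 1?eq_sym //= {1}/X3 eqxx {1}/X3 eq_sym (negPf rjk) eqxx.
    rewrite (eq_bigr (tau z)) => [|l /andP[lj lk]]; last by rewrite /X3 (negPf lj) (negPf lk).
    have M0 : M z != 0 by apply/prodf_neq0 => l _; apply: pos_nz.
    rewrite prodrXl prodfV -/(M z) exprVn mulrA [in LHS]exprMn mulrA mulfK //.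
    by rewrite expf_neq0.
  apply: LaurM.
    apply: Laur_meval => l; rewrite /X3; apply: LaurNP.
    by case: eqP => // _; case: eqP.
  by apply: Laur_prod => l _; apply: LaurX; apply: LaurNP.
(* Expansion in t1: the only new denominator is T, a monomial times 1 + z_u. *)
- pose M z := mon (tau z) (fun l => posp (- be l)) * (tau z (r j))^-1 * \prod_(l | l != r j) tau z l.
  pose M' z := mon (tau z) (fun l => - posp (- be l)) * tau z (r j) * \prod_(l | l != r j) (tau z l)^-1.
  apply: (@Laur_eq _ _ (fun z => P1.@[x1 (tau z)] * M' z ^+ e1)).
    move=> z hz; have hx := tau_pos hz.
    have hx1 : forall l, 0 < x1 (tau z) l by apply: Xmut_gt0.
    rewrite -H1 // /= -/(x1 _) -/Ct1 -mulrA; congr (_ * _).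
    rewrite (prod_upd (x1o (tau z))) x1j Ttau; last exact: pos_nz.
    rewrite -exprMn /M' prodfV monN; last exact: pos_nz.
    set m0 := mon _ _; set pr := \prod_(_ | _) _; congr (_ ^+ _).
    have m00 : m0 != 0 by apply: mon_neq0; apply: pos_nz.
    have pr0 : pr != 0 by apply/prodf_neq0 => l _; apply: pos_nz.
    have t0 : tau z (r j) != 0 by apply: pos_nz.
    by field; rewrite m00 pr0 t0.
  apply: LaurM.
    apply: Laur_meval => l; apply: LaurNP; case: (eqVneq l (r j)) => [->|lj].
      by apply: Laur_eq LT => z _; rewrite x1j.
    by apply: Laur_eq (Ltau l) => z _; rewrite x1o.
  apply: LaurX; apply: LaurNP; apply: LaurM; last by apply: Laur_prod => l _.
  exact: LaurM.
Qed.

End LaurentStep.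

Section FrozenRow.
Variables (n m : nat) (r : 'I_n -> 'I_m).
Let rp (l : 'I_n) : 'I_m.+1 := lift ord0 (r l).

(** A frozen variable of value 1 contributes nothing to exchange monomials, so a row may be adjoined
    and forgotten again. *)
Lemma Xp_frozen (K : fieldType) (Ct : 'M[int]_(m, n)) (Cp : 'M[int]_(m.+1, n)) ks
    (x : 'I_m -> K) (xp : 'I_m.+1 -> K) i :
  (forall i l, Cp (lift ord0 i) l = Ct i l) ->
  xp ord0 = 1 -> (forall l, xp (lift ord0 l) = x l) ->
  Xp rp Cp ks xp (lift ord0 i) = Xp r Ct ks x i.
Proof.
elim: ks Ct Cp x xp => [|k ks IH] Ct Cp x xp hC h1 hx /=; first by rewrite hx.
apply: IH => [l l'||l].
- by rewrite !mxE !hC (inj_eq lift_inj).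
- by rewrite Xmut_other // neq_lift.
have monE (a : 'I_m.+1 -> int) : mon xp a = mon x (fun l => a (lift ord0 l)).
  rewrite /mon big_ord_recl h1 exp1rz mul1r.
  by apply: eq_bigr => l' _; rewrite hx.
rewrite /Xmut (inj_eq lift_inj); case: ifP => _; last exact: hx.
rewrite hx !monE; congr ((_ + _) / _); by apply: eq_mon => // l'; rewrite hC.
Qed.

End FrozenRow.

Section LaurentPhenomenon.
Variables (n : nat) (d : 'I_n -> nat).

(* Induction through the seeds mu_j t and mu_j mu_k mu_j t. A frozen row attached
   to column j makes the denominators of these two expansions coprime. *)
Theorem Laurent_phenomenon (m : nat) (r : 'I_n -> 'I_m) (Ct : 'M[int]_(m, n)) ks i :
  injective r -> skewD d (up r Ct) -> LaurP (fun x => Xp r Ct ks x i).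
Proof.
have [N] := ubnP (size ks); elim: N => // N IH in m r Ct ks i *.
move=> sN ri sk; have diag l : Ct (r l) l = 0 by have := skewD_diag l sk; rewrite mxE.
case: ks sN => [_|j [_|k rest sN]]; first exact: Laur_var.
  rewrite /= /Xmut; case: eqP => _; last exact: Laur_var.
  apply: LaurM; last exact: (Laur_inv posQ0).
  by apply: LaurD; apply: (Laur_mon posQ0).
case: (eqVneq j k) => [jk|jk].
  apply: (@Laur_eq _ _ (fun x => Xp r Ct rest x i)).
    move=> x hx /=; rewrite -jk mutfK //; apply: eq_Xp => l.
    rewrite XmutK //; first by apply: lt0r_neq0; apply: hx.
    by apply: lt0r_neq0; rewrite addr_gt0 // mon_gt0.
  by apply: IH => //; move: sN; rewrite /= !ltnS; apply: leq_trans; rewrite leqW.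
(* Negating the matrix changes no cluster variable, so the sign of this entry may be chosen as
   [Laur_step] requires. *)
have main (C0 : 'M[int]_(m, n)) : skewD d (up r C0) -> 0 <= C0 (r k) j ->
    LaurP (fun x => Xp r C0 (j :: k :: rest) x i).
  move=> sk0 c0.
  pose rp (l : 'I_n) : 'I_m.+1 := lift ord0 (r l).
  pose Cp : 'M[int]_(m.+1, n) := \matrix_(a, l)
    if unlift ord0 a is Some a' then C0 a' l else (l == j)%:R.
  have rpi : injective rp by move=> l l' /lift_inj/ri.
  have CpE a l : Cp (lift ord0 a) l = C0 a l by rewrite mxE liftK.
  have skp : skewD d (up rp Cp).
    have -> // : up rp Cp = up r C0 by apply/matrixP=> a l; rewrite mxE CpE mxE.
  pose s (x : 'I_m -> rat) a := if unlift ord0 a is Some a' then x a' else 1.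
  apply: (@Laur_eq _ _ (fun x => Xp rp Cp (j :: k :: rest) (s x) (lift ord0 i))).
    move=> x _; apply: Xp_frozen => //; first by rewrite /s unlift_none.
    by move=> l; rewrite /s liftK.
  apply: (@Laur_comp _ _ _ _ (fun x => Xp rp Cp (j :: k :: rest) x (lift ord0 i)) posQ0).
  - by move=> a; rewrite /s; case: (unlift _ _) => [a'|]; [exact: Laur_var|exact: Laur_cst].
  - apply: (@Laur_eq _ _ (fun x => \prod_l (s x l)^-1)); first by move=> x _; rewrite prodfV.
    apply: Laur_prod => a _; rewrite /s.
    by case: (unlift _ _) => [a'|]; [exact: (Laur_inv posQ0)|exact: Laur_cst].
  - by move=> x hx a; rewrite /s; case: (unlift _ _).
  apply: (@Laur_step n m.+1 rp d Cp j k ord0 rest) => //.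
  - by rewrite mxE unlift_none eqxx.
  - by move=> l lj; rewrite mxE unlift_none (negPf lj).
  - by rewrite CpE.
  - apply: IH => //; rewrite up_mutf //; exact: mut_skewD.
  - apply: IH => //; rewrite !up_mutf //; do 3!apply: mut_skewD; exact: skp.
case: (lerP 0 (Ct (r k) j)) => c0; first exact: main.
apply: (@Laur_eq _ _ (fun x => Xp r (- Ct) (j :: k :: rest) x i)) => [x _|].
  exact: XpN.
apply: main; last by rewrite mxE oppr_ge0 ltW.
have -> : up r (- Ct) = - up r Ct by apply/matrixP=> a l; rewrite !mxE.
exact: skewDN.
Qed.

End LaurentPhenomenon.

(** * F-polynomials and sign-coherence *)

Section Principal.
Variable n : nat.
Implicit Types (B C : 'M[int]_n) (ks : seq 'I_n).

Definition xy (K : fieldType) (x y : 'I_n -> K) (i : 'I_(n + n)) : K :=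
  match split i with inl a => x a | inr b => y b end.

Lemma xyl (K : fieldType) (x y : 'I_n -> K) i : xy x y (lshift n i) = x i.
Proof. by rewrite /xy (unsplitK (inl i)). Qed.
Lemma xyr (K : fieldType) (x y : 'I_n -> K) i : xy x y (rshift n i) = y i.
Proof. by rewrite /xy (unsplitK (inr i)). Qed.

Lemma xy_gt0 (K : numFieldType) (x y : 'I_n -> K) :
  (forall i, 0 < x i) -> (forall i, 0 < y i) -> forall i, 0 < xy x y i.
Proof. by move=> hx hy i; rewrite /xy; case: (split i). Qed.

Lemma mon_split (K : fieldType) (x : 'I_(n + n) -> K) a :
  mon x a = mon (fun i => x (lshift n i)) (fun i => a (lshift n i)) *
            mon (fun i => x (rshift n i)) (fun i => a (rshift n i)).
Proof. by rewrite /mon big_split_ord. Qed.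

Lemma up_col_mx B C : up (@lshift n n) (col_mx B C) = B.
Proof. by apply/matrixP=> i j; rewrite mxE col_mxEu. Qed.

Lemma mutf_col_mx B C k :
  mutf (@lshift n n) k (col_mx B C) = col_mx (mut_sq k B) (Cmut B k C).
Proof.
apply/matrixP=> i j; rewrite mxE; case: (split_ordP i) => [a ->|a ->].
  by rewrite !col_mxEu mxE (inj_eq (@lshift_inj _ _)).
rewrite !col_mxEd !col_mxEu.
by rewrite [in RHS]mxE eq_rlshift /=; case: eqP => [->|].
Qed.

Lemma Ctp_principal B ks :
  Ctp (@lshift n n) (col_mx B 1%:M) ks = col_mx (Bp B ks) (Cp B ks).
Proof.
elim/last_ind: ks => // ks k IH.
by rewrite /Ctp foldl_rcons -/(Ctp _ _ _) IH mutf_col_mx Bp_rcons Cp_rcons.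
Qed.

Section Field.
Variable K : fieldType.
Implicit Types (x y : 'I_n -> K).

Definition XB B ks x y (j : 'I_n) : K :=
  Xp (@lshift n n) (col_mx B 1%:M) ks (xy x y) (lshift n j).

Lemma Xp_rshift B ks x y j :
  Xp (@lshift n n) (col_mx B 1%:M) ks (xy x y) (rshift n j) = y j.
Proof.
elim/last_ind: ks => [|ks k IH]; first by rewrite /= xyr.
by rewrite Xp_rcons Xmut_other // eq_rlshift.
Qed.

Lemma XB_rcons B ks k x y j : XB B (rcons ks k) x y j =
  if j == k then
    (mon (XB B ks x y) (fun i => posp (Bp B ks i k)) * mon y (fun i => posp (Cp B ks i k))
     + mon (XB B ks x y) (fun i => posp (- Bp B ks i k)) * mon y (fun i => posp (- Cp B ks i k)))
    / XB B ks x y k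
  else XB B ks x y j.
Proof.
rewrite /XB Xp_rcons Ctp_principal /Xmut (inj_eq (@lshift_inj _ _)); case: ifP => // _.
congr (_ / _); rewrite !mon_split.
by congr (_ * _ + _ * _); apply: eq_mon => i; rewrite ?Xp_rshift ?col_mxEu ?col_mxEd.
Qed.

Definition Yh B ks x y k :=
  mon y (fun i => Cp B ks i k) * mon (XB B ks x y) (fun i => Bp B ks i k).

(** Coherence leaves one of the two exchange monomials free of y; factoring it out leaves 1 + [Yh]
    or 1 + its inverse. *)
Lemma XB_rcons_coh B ks k x y s : (forall i, XB B ks x y i != 0) -> (forall i, y i != 0) ->
  (forall i, 0 <= sg s * Cp B ks i k) ->
  XB B (rcons ks k) x y k =
    mon (XB B ks x y) (fun i => posp (- (sg s * Bp B ks i k)))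
    * (1 + Yh B ks x y k ^ sg s) / XB B ks x y k.
Proof.
move=> hx hy hs; rewrite XB_rcons eqxx; congr (_ / _); rewrite /Yh.
case: s hs => hs.
  rewrite mulrDr mulr1; congr (_ + _).
    rewrite [X in _ * X](eq_mon (b := fun=> 0) (fun=> erefl)) ?mon0 ?mulr1.
      by apply: eq_mon => // i; rewrite mulN1r opprK.
    by move=> i; apply: posp_0; have := hs i; rewrite mulN1r oppr_ge0.
  rewrite exprN1 invfM -!monN // mulrCA mulrC -monD //; congr (_ * _).
    by apply: eq_mon => // i; rewrite posp_id //; have := hs i; rewrite mulN1r.
  by apply: eq_mon => // i; rewrite mulN1r opprK; have := pospB (Bp B ks i k); lia.
rewrite mulrDr mulr1 addrC; congr (_ + _).
  rewrite [X in _ * X](eq_mon (b := fun=> 0) (fun=> erefl)) ?mon0 ?mulr1.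
    by apply: eq_mon => // i; rewrite mul1r.
  by move=> i; apply: posp_0; have := hs i; rewrite mul1r oppr_le0.
rewrite expr1z mulrCA mulrC -monD //; congr (_ * _).
  by apply: eq_mon => // i; rewrite posp_id //; have := hs i; rewrite mul1r.
by apply: eq_mon => // i; rewrite mul1r; have := pospB (Bp B ks i k); lia.
Qed.

Lemma G_rcons_col d B ks k (a : 'I_n) : skewD d B ->
  Gp B (rcons ks k) a k =
  - Gp B ks a k + \sum_l Gp B ks a l * posp (- (sg (csgn (Cp B ks) k) * Bp B ks l k)).
Proof.
move=> h; rewrite Gp_rcons mulmxH eqxx; congr (_ + _).
rewrite [RHS](bigD1 k) //= (skewD_diag k (Bp_skewD ks h)) mulr0 oppr0 posp0 mulr0 add0r.
by [].
Qed.

Lemma G_rcons_other B ks k (a j : 'I_n) : j != k -> Gp B (rcons ks k) a j = Gp B ks a j.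
Proof. by move=> jk; rewrite Gp_rcons mulmxH (negPf jk). Qed.

End Field.

Definition Fp (K : fieldType) B ks (y : 'I_n -> K) j := XB B ks (fun=> 1) y j.

Section Positive.
Variable K : numFieldType.
Implicit Types (x y : 'I_n -> K).

Lemma XB_gt0 B ks x y j : (forall i, 0 < x i) -> (forall i, 0 < y i) -> 0 < XB B ks x y j.
Proof. by move=> hx hy; apply: Xp_gt0; apply: xy_gt0. Qed.

Lemma Fp_gt0 B ks y j : (forall i, 0 < y i) -> 0 < Fp B ks y j.
Proof. by move=> hy; apply: XB_gt0. Qed.

Lemma Fp_neq0 B ks y j : (forall i, 0 < y i) -> Fp B ks y j != 0.
Proof. by move=> hy; apply: lt0r_neq0; apply: Fp_gt0. Qed.

(** By [GB], [Yh] takes the same value at (x, y) and at (1, z). Both sides then obey one recursion,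
    and only monomials in x remain to be compared. *)
Lemma separation d B ks x y : skewD d B -> okpath B ks ->
  (forall i, 0 < x i) -> (forall i, 0 < y i) ->
  forall j, XB B ks x y j = mon x (fun a => Gp B ks a j)
     * Fp B ks (fun i => y i * mon x (fun a => B a i)) j.
Proof.
move=> h ok hx hy; set z := fun i => _.
have xn i : x i != 0 by rewrite lt0r_neq0.
have yn i : y i != 0 by rewrite lt0r_neq0.
have hz i : 0 < z i by rewrite /z mulr_gt0 // mon_gt0.
have zn i : z i != 0 by rewrite lt0r_neq0.
elim/okpath_ind: ok => [|{}ks k okk ok ck IH] j.
  rewrite /Fp /XB /= !xyl mulr1 /Gp /= (@mon_upd _ _ x x j) // mxE eqxx expr1z.
  rewrite -[LHS]mulr1; congr (_ * _); rewrite -(mon0 x); apply: eq_mon => // i.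
  by rewrite mxE; case: eqP.
have Xn i : XB B ks x y i != 0 by rewrite lt0r_neq0 // XB_gt0.
have Fn i : Fp B ks z i != 0 by rewrite lt0r_neq0 // Fp_gt0.
case: (eqVneq j k) => [->|jk]; last first.
  rewrite /Fp !XB_rcons (negPf jk) IH; congr (_ * _).
  by apply: eq_mon => // i; rewrite G_rcons_other.
have monX a : mon (XB B ks x y) a =
    mon x (fun i => \sum_l Gp B ks i l * a l) * mon (Fp B ks z) a.
  rewrite -(monXl _ _ xn) -big_split /=; apply: eq_bigr => l _.
  by rewrite IH expfzMl.
have hY : Yh B ks x y k = Yh B ks (fun=> 1) z k.
  rewrite /Yh monX mulrA; congr (_ * _).
  have -> : mon z (fun i => Cp B ks i k) = mon y (fun i => Cp B ks i k) *
      mon x (fun i => \sum_l B i l * Cp B ks l k).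
    rewrite -(monXl _ _ xn) -big_split /=; apply: eq_bigr => l _.
    by rewrite expfzMl.
  congr (_ * _); apply: eq_mon => // i.
  by have /matrixP/(_ i k) := GB h ok; rewrite !mxE.
rewrite (XB_rcons_coh Xn yn (cohP ck)) [in RHS]/Fp (XB_rcons_coh (x := fun=> 1) Fn zn (cohP ck)).
rewrite -hY monX IH; set s := csgn _ _; set w := 1 + _.
rewrite [X in _ = X * _](_ : _ = mon x (fun i => \sum_l Gp B ks i l *
    posp (- (sg s * Bp B ks l k))) / mon x (fun i => Gp B ks i k)); last first.
  rewrite -monN // -monD //; apply: eq_mon => // i.
  by rewrite (G_rcons_col _ _ _ h) addrC.
rewrite -/(Fp B ks z); set m1 := mon _ _; set m2 := mon (Fp _ _ _) _; set m3 := mon x _.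
rewrite -[XB B ks (fun=> 1) z k]/(Fp B ks z k).
have m30 : m3 != 0 by apply: mon_neq0.
by field; rewrite m30 Fn.
Qed.

End Positive.
End Principal.

Lemma mpoly_line q (h : 'I_q -> {poly rat}) (p : {mpoly rat[q]}) :
  exists pi : {poly rat}, forall t, pi.[t] = p.@[fun i => (h i).[t]].
Proof.
exists (\sum_(m <- msupp p) p@_m *: \prod_i h i ^+ m i) => t.
rewrite mevalE horner_sum; apply: eq_bigr => m _; rewrite hornerZ horner_prod.
by congr (_ * _); apply: eq_bigr => i _; rewrite horner_exp.
Qed.

Lemma mpoly_plane q (h : 'I_q -> {poly {poly rat}}) (p : {mpoly rat[q]}) :
  exists pi : {poly {poly rat}}, forall t u, pi.[u%:P].[t] = p.@[fun i => (h i).[u%:P].[t]].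
Proof.
exists (\sum_(m <- msupp p) (p@_m)%:P%:P * \prod_i h i ^+ m i) => t u.
rewrite mevalE !horner_sum; apply: eq_bigr => m _; rewrite !hornerM !hornerC !horner_prod.
by congr (_ * _); apply: eq_bigr => i _; rewrite !horner_exp.
Qed.

Lemma mpolyXU_neq0 n (i : 'I_n) : 'X_i != 0 :> {mpoly rat[n]}.
Proof.
by apply/eqP => /(congr1 (meval (fun=> 1))); rewrite mevalXU meval0 => /eqP; rewrite oner_eq0.
Qed.

(** A polynomial with constant term 1 is prime to every variable. *)
Lemma mpoly_div_mprod n (p P Q : {mpoly rat[n]}) e : p.@[fun=> 0] = 1 ->
  p * P = mprod n ^+ e * Q -> exists P', P = mprod n ^+ e * P'.
Proof.
move=> p0.
pose good (M : {mpoly rat[n]}) := forall P Q, p * P = M * Q -> exists P', P = M * P'.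
have goodM M1 M2 : M1 != 0 -> good M1 -> good M2 -> good (M1 * M2).
  move=> M10 g1 g2 P0 Q0 e0; have [P1 e1] := g1 P0 (M2 * Q0) (etrans e0 (esym (mulrA _ _ _))).
  have [|P2 e2] := g2 P1 Q0; last by exists P2; rewrite e1 e2 mulrA.
  by apply: (mulfI M10); rewrite mulrCA -e1 e0 mulrA.
have good1 : good 1 by move=> P0 Q0 _; exists P0; rewrite mul1r.
have goodX i : good 'X_i.
  move=> P0 Q0 e0; have [|q eq] := @subst_cst0 _ i 0 P0; last first.
    by exists q; rewrite eq mpolyC0 subr0.
  have := congr1 (subst_cst i 0) e0; rewrite !subst_cstM.
  rewrite {3}/subst_cst comp_mpolyXU -tnth_nth tnth_mktuple eqxx mpolyC0 mul0r => /eqP.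
  rewrite mulf_eq0 => /orP[/eqP h|/eqP //].
  have := congr1 (meval (fun=> 0)) h; rewrite subst_cstE meval0.
  rewrite (@meval_eq _ _ _ (fun=> 0)) => [|l]; last by case: ifP.
  by rewrite p0 => /eqP; rewrite oner_eq0.
have goodP (s : seq 'I_n) : good (\prod_(i <- s) 'X_i).
  elim: s => [|i s IH]; first by rewrite big_nil.
  by rewrite big_cons; apply: goodM => //; rewrite mpolyXU_neq0.
have mn : mprod n != 0 by apply/prodf_neq0 => i _; rewrite mpolyXU_neq0.
suff g : good (mprod n ^+ e) by exact: g.
elim: e => [|e IH]; first by rewrite expr0.
by rewrite exprS; apply: goodM => //; exact: goodP.
Qed.

(** * F-polynomials on the coordinate axes *)

Section RowCoherence.
Variables (n : nat) (d : 'I_n -> nat) (B : 'M[int]_n).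
Hypothesis sk : skewD d B.
Implicit Types (ks : seq 'I_n).

Definition axis (k : 'I_n) (t : rat) : 'I_n -> rat := fun i => if i == k then t else 0.

Definition Fpoly ks (p : 'I_n -> {mpoly rat[n]}) :=
  forall y : 'I_n -> rat, (forall i, 0 < y i) -> forall j, Fp B ks y j = (p j).@[y].

(** The sign of row k alone does not propagate. The values of the F-polynomials on axis k are
    carried along because they decide the sign of the next entry. *)
Definition row_coh ks (p : 'I_n -> {mpoly rat[n]}) k (e : bool) :=
  (forall j (t : rat), 0 < t ->
     (p j).@[axis k t] = if e then (1 + t) ^ (- Gp B ks k j) else 1) /\
  (forall j, 0 <= sg e * Gp B ks k j).

(** Entry (j, l) of G^T D C = D has a single term when column l of C lives in row k. Unimodularity
    of G and C then makes the remaining entries units. *)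
Lemma gram_col ks k l : okpath B ks ->
  (forall i, i != k -> Cp B ks i l = 0) ->
  [/\ Cp B ks k l = Gp B ks k l,
      forall j, j != l -> Gp B ks k j = 0 & `|Gp B ks k l| = 1].
Proof.
move=> ok h.
have e j : Gp B ks k j * (d k)%:Z * Cp B ks k l = if j == l then (d l)%:Z else 0.
  have /matrixP/(_ j l) := GDC sk ok; rewrite [RHS]mxE -mulmxA.
  rewrite mxE (bigD1 k) //= big1 ?addr0 => [|i ik]; last first.
    by rewrite mulDmx h // !mulr0.
  by rewrite mulDmx mxE mulrA => ->; case: eqP => [->|].
have dk := skewD_gt0 k sk; have dl := skewD_gt0 l sk.
have ckl : Cp B ks k l != 0.
  by apply: contraTneq dl => c0; have := e l; rewrite c0 mulr0 eqxx => <-.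
have g0 j : j != l -> Gp B ks k j = 0.
  move=> /negPf jl; have := e j; rewrite jl => /eqP.
  by rewrite !mulf_eq0 (negPf ckl) (gt_eqF dk) !orbF => /eqP.
have unitz (x y : int) : x * y = 1 -> `|x| = 1.
  by move/(congr1 absz)/eqP; rewrite abszM muln_eq1 => /andP[/eqP h' _]; rewrite -abszE h'.
have gl : `|Gp B ks k l| = 1.
  have /matrixP/(_ k k) := mulmxV (Gp_unit B ks); rewrite !mxE eqxx (bigD1 l) //=.
  rewrite big1 ?addr0 => [|j jl]; last by rewrite g0 // mul0r.
  exact: unitz.
have cl : `|Cp B ks k l| = 1.
  have /matrixP/(_ l l) := mulVmx (Cp_unit ok); rewrite !mxE eqxx (bigD1 k) //=.
  rewrite big1 ?addr0 => [|j jl]; last by rewrite h // mulr0.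
  by rewrite mulrC; exact: unitz.
split=> //; have := e l; rewrite eqxx.
have abs1 (x : int) : `|x| = 1 -> x = 1 \/ x = -1 by lia.
by case: (abs1 _ gl) => ->; case: (abs1 _ cl) => ->; lia.
Qed.

(* The chart of the neighbouring seed sees only nonnegative powers of 1 + y_k. *)
Lemma neighbour_chart ks (p : 'I_n -> {mpoly rat[n]}) k l :
  okpath B ks -> Fpoly ks p ->
  (forall t : rat, 0 < t -> (p l).@[axis k t] = 1) -> 0 <= Gp B ks k l.
Proof.
move=> ok hp h1; rewrite leNgt; apply/negP => gneg.
have [N gN] : exists N : nat, Gp B ks k l = - N.+1%:Z.
  by exists (absz (Gp B ks k l)).-1; lia.
pose r := @lshift n n.
have ri : injective r by exact: lshift_inj.
pose C2 := mutf r k (col_mx B 1%:M).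
have kk := skewD_diag k sk.
have skC : skewD d (up r C2) by rewrite up_mutf // up_col_mx; exact: mut_skewD.
have [P [e HP]] := Laurent_phenomenon (k :: ks) (r l) ri skC.
have C2col i : C2 (r i) k = - B i k by rewrite mxE eqxx orbT col_mxEu.
have C2col' i : C2 (rshift n i) k = - (i == k)%:R by rewrite mxE eqxx orbT col_mxEd mxE.
(* Setting the neighbouring cluster to 1 means x_k = 1 + y_k in the original one, so separation
   produces the factor (1 + y_k)^(-N-1). *)
have key (y : 'I_n -> rat) : (forall i, 0 < y i) ->
    (1 + y k) ^- N.+1 * (p l).@[fun i => y i * (1 + y k) ^ B k i] * (\prod_i y i) ^+ e
    = P.@[xy (fun=> 1) y].
  move=> hy; rewrite -HP; last by apply: xy_gt0.
  have -> : \prod_i xy (fun=> 1) y i = \prod_i y i.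
    rewrite big_split_ord /= big1 ?mul1r; last by move=> i _; rewrite xyl.
    by apply: eq_bigr => i _; rewrite xyr.
  congr (_ * _) => /=; rewrite mutfK ?col_mxEu //.
  pose x i := if i == k then 1 + y k else 1 : rat.
  have hx i : 0 < x i by rewrite /x; case: ifP => // _; rewrite addr_gt0.
  have e1 : Xmut r k C2 (xy (fun=> 1) y) =1 xy x y.
    move=> i; rewrite /Xmut; case: (split_ordP i) => a ->; last first.
      by rewrite eq_rlshift !xyr.
    rewrite (inj_eq ri) !xyl /x; case: eqP => // _; rewrite divr1.
    have m1 (b : 'I_n -> int) : mon (fun i => xy (fun=> 1 : rat) y (lshift n i)) b = 1.
      by apply: big1 => i' _; rewrite xyl exp1rz.
    rewrite !mon_split !m1 !mul1r; congr (_ + _).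
      apply: big1 => i' _; rewrite C2col'.
      have -> : posp (- (i' == k)%:R) = 0 by case: (i' == k).
      by rewrite expr0z.
    rewrite (@mon_upd _ _ (fun i => y i) _ k) => [|i' _]; last by rewrite xyr.
    rewrite xyr C2col' eqxx opprK expr1z -[RHS]mulr1; congr (_ * _).
    rewrite -(mon0 y); apply: eq_mon => // i'; case: eqP => // /eqP/negPf.
    by rewrite C2col' => ->; rewrite opprK.
  rewrite (eq_Xp r _ ks e1) -/(XB B ks x y l) (separation sk ok hx hy).
  have monx (b : 'I_n -> int) : mon x b = (1 + y k) ^ b k.
    rewrite (@mon_upd _ _ (fun=> 1) _ k) => [|i ik]; last by rewrite /x (negPf ik).
    rewrite {1}/x eqxx -[RHS]mulr1; congr (_ * _); apply: big1 => i _; exact: exp1rz.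
  rewrite hp => [|i]; last by rewrite mulr_gt0 // mon_gt0.
  rewrite monx gN -exprnN; congr (_ * _); apply: meval_eq => i; by rewrite monx.
(* Put y_k = t and every other y_i = u. The power u^D stems from the denominator, so the coefficient
   of u^D is the value at u = 0, that is on axis k, where F_l is 1. *)
pose hh (i : 'I_(n + n)) : {poly {poly rat}} :=
  match split i with inl _ => 1 | inr b => if b == k then 'X%:P else 'X end.
have [Pi HPi] := mpoly_plane hh P.
pose D := (e * #|[pred i | i != k]|)%N.
have coefD (t : rat) : 0 < t -> (Pi`_D).[t] * (1 + t) ^+ N.+1 = t ^+ e.
  move=> t0; have t1 : 0 < 1 + t by rewrite addr_gt0.
  pose h2 (i : 'I_n) : {poly rat} := if i == k then t%:P else ((1 + t) ^ B k i) *: 'X.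
  have [rho Hr] := mpoly_line h2 (p l).
  have r0 : rho.[0] = 1.
    rewrite Hr -(h1 t t0); apply: meval_eq => i; rewrite /h2 /axis.
    by case: eqP; rewrite ?hornerC ?hornerZ ?hornerX ?mulr0.
  have ep : map_poly (horner_eval t) Pi = ((1 + t) ^- N.+1 * t ^+ e) *: (rho * 'X^D).
    apply/eqP; rewrite -subr_eq0; apply/eqP/poly_pos0 => u u0.
    pose y i := if i == k then t else u.
    have hy i : 0 < y i by rewrite /y; case: ifP.
    have yk : y k = t by rewrite /y eqxx.
    have -> : (map_poly (horner_eval t) Pi - ((1 + t) ^- N.+1 * t ^+ e) *: (rho * 'X^D)).[u]
      = Pi.[u%:P].[t] - (1 + t) ^- N.+1 * t ^+ e * (rho.[u] * u ^+ D).
      rewrite hornerD hornerN hornerZ hornerM hornerXn; congr (_ - _).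
      by rewrite -[in RHS](horner_evalE t) -horner_map /= horner_evalE hornerC.
    apply/eqP; rewrite subr_eq0; apply/eqP; rewrite HPi.
    have := key y hy; rewrite yk => key'.
    transitivity (P.@[xy (fun=> 1) y]).
      apply: meval_eq => i; rewrite /hh /xy; case: (split i) => [a|a]; first by rewrite !hornerC.
      by rewrite /y; case: eqP; rewrite ?hornerC ?hornerX ?hornerC.
    rewrite -key' Hr; have -> : \prod_i y i = t * u ^+ #|[pred i | i != k]|.
      rewrite (bigD1 k) //= yk -prodr_const; congr (_ * _).
      by apply: eq_bigr => i ik; rewrite /y (negPf ik).
    rewrite exprMn -exprM mulnC -/D.
    have -> : (p l).@[fun i => (h2 i).[u]] = (p l).@[fun i => y i * (1 + t) ^ B k i].
      apply: meval_eq => i; rewrite /h2 /y; case: eqP => [->|_].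
        by rewrite hornerC kk expr0z mulr1.
      by rewrite hornerZ hornerX mulrC.
    by ring.
  have := congr1 (fun q : {poly rat} => q`_D) ep.
  rewrite coef_map /= horner_evalE coefZ coefMXn ltnn subnn -horner_coef0 r0 mulr1 => ->.
  by rewrite mulrAC mulVf ?mul1r // expf_neq0 // lt0r_neq0.
(* At t = -1 the left side vanishes while the right side is (-1)^e. *)
have /(congr1 (fun q : {poly rat} => q.[-1])) : Pi`_D * (1 + 'X) ^+ N.+1 = 'X^e.
  apply/eqP; rewrite -subr_eq0; apply/eqP/poly_pos0 => t t0.
  by rewrite hornerD hornerN hornerM horner_exp hornerD hornerX hornerXn hornerC coefD // subrr.
rewrite hornerM horner_exp hornerD hornerX hornerXn hornerC subrr exprS mul0r mulr0.
by move/eqP; rewrite eq_sym expf_eq0 oppr_eq0 oner_eq0 andbF.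
Qed.

Lemma poly_axis (p : {mpoly rat[n]}) k (g : int) :
  (forall t : rat, 0 < t -> p.@[axis k t] = (1 + t) ^ g) -> 0 <= g.
Proof.
move=> h; rewrite leNgt; apply/negP => gneg.
have [N gN] : exists N : nat, g = - N.+1%:Z by exists (absz g).-1; lia.
have [pi hpi] := mpoly_line (fun i => if i == k then 'X else 0) p.
have hpt t : pi.[t] = p.@[axis k t].
  by rewrite hpi; apply: meval_eq => i; rewrite /axis; case: eqP; rewrite ?hornerX ?hornerC.
have /(congr1 (fun q : {poly rat} => q.[-1])) : pi * (1 + 'X) ^+ N.+1 = 1.
  apply/eqP; rewrite -subr_eq0; apply/eqP/poly_pos0 => t t0.
  rewrite hornerD hornerN hornerM horner_exp hornerD hornerX !hornerC hpt h //.
  have t1 : 1 + t != 0 by rewrite lt0r_neq0 // addr_gt0.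
  by rewrite gN -exprnN mulVf ?subrr // expf_neq0.
rewrite hornerM horner_exp hornerD hornerX !hornerC subrr exprS mul0r mulr0.
by move/eqP; rewrite eq_sym oner_eq0.
Qed.

End RowCoherence.

Section RowCoherence.
Variables (n : nat) (d : 'I_n -> nat) (B : 'M[int]_n).
Hypothesis sk : skewD d B.
Implicit Types (ks : seq 'I_n).

Theorem row_coherence ks : okpath B ks ->
  exists p, [/\ Fpoly B ks p, forall j, (p j).@[fun=> 0] = 1
              & forall k, exists e, row_coh B ks p k e].
Proof.
elim/okpath_ind => [|{}ks l okl ok cl [p [hp p0 hrow]]].
  exists (fun=> 1); split=> [y hy j|j|k]; first by rewrite /Fp /XB /= xyl meval1.
    by rewrite meval1.
  exists false; split=> [j t _|j]; first by rewrite meval1.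
  by rewrite mul1r mxE; case: (k == j).
set C := Cp B ks; set s := csgn C l; set Bt := Bp B ks.
have cs := cohP cl; rewrite -/C -/s in cs.
have ll : Bt l l = 0 := skewD_diag l (Bp_skewD ks sk).
pose X (a : int) (i : 'I_n) : {mpoly rat[n]} := 'X_i ^+ absz (posp a).
pose Q : {mpoly rat[n]} :=
  (\prod_i p i ^+ absz (posp (Bt i l))) * (\prod_i X (C i l) i) +
  (\prod_i p i ^+ absz (posp (- Bt i l))) * (\prod_i X (- C i l) i).
have pspz (K : unitRingType) (x : K) a : x ^+ absz (posp a) = x ^ posp a.
  by rewrite exprnP abszE ger0_norm ?posp_ge0.
have QE (y : 'I_n -> rat) : Q.@[y] =
    mon (fun i => (p i).@[y]) (fun i => posp (Bt i l)) * mon y (fun i => posp (C i l)) +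
    mon (fun i => (p i).@[y]) (fun i => posp (- Bt i l)) * mon y (fun i => posp (- C i l)).
  rewrite mevalD !mevalM !rmorph_prod /=.
  by congr (_ * _ + _ * _); apply: eq_bigr => i _; rewrite rmorphXn /= ?mevalXU pspz.
have FQ (y : 'I_n -> rat) : (forall i, 0 < y i) -> Fp B (rcons ks l) y l * (p l).@[y] = Q.@[y].
  move=> hy; rewrite QE /Fp XB_rcons eqxx -hp //; set f := XB B ks _ y.
  rewrite divfK; last by apply: lt0r_neq0; apply: XB_gt0.
  by congr (_ * _ + _ * _); apply: eq_mon => // i; rewrite -hp.
(* The Laurent phenomenon leaves at most a monomial denominator, and [p l], having constant term 1,
   is prime to it. *)
have [p' p'Q p'F] : exists2 p', p l * p' = Q &
    forall y : 'I_n -> rat, (forall i, 0 < y i) -> Fp B (rcons ks l) y l = p'.@[y].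
  have ri : injective (@lshift n n) by exact: lshift_inj.
  have skC : skewD d (up (@lshift n n) (col_mx B 1%:M)) by rewrite up_col_mx.
  have [P [e HP]] := Laurent_phenomenon (rcons ks l) (lshift n l) ri skC.
  have [P1 HP1] : exists P1 : {mpoly rat[n]}, forall y, P1.@[y] = P.@[xy (fun=> 1) y].
    exists (P \mPo [tuple if split i is inr b then 'X_b else 1 | i < n + n]) => y.
    rewrite comp_mpoly_meval; apply: meval_eq => i; rewrite tnth_mktuple /xy.
    by case: (split i) => a; rewrite ?meval1 ?mevalXU.
  have HP2 (y : 'I_n -> rat) : (forall i, 0 < y i) ->
      Fp B (rcons ks l) y l * (\prod_i y i) ^+ e = P1.@[y].
    move=> hy; rewrite HP1 -HP; last by apply: xy_gt0.
    congr (_ * _ ^+ _); symmetry; rewrite big_split_ord /= big1 ?mul1r; last by move=> i _; rewrite xyl.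
    by apply: eq_bigr => i _; rewrite xyr.
  have eP : p l * P1 = mprod n ^+ e * Q.
    apply: mpoly_eq_pos => y hy; rewrite !mevalM -HP2 // -FQ // rmorphXn /= mprodE.
    by ring.
  have [p' ep'] := mpoly_div_mprod (p0 l) eP.
  have mn : mprod n != 0 by apply/prodf_neq0 => i _; rewrite mpolyXU_neq0.
  exists p'; first by apply: (mulfI (expf_neq0 e mn)); rewrite -eP ep'; ring.
  move=> y hy; have yn : (\prod_i y i) ^+ e != 0.
    by rewrite expf_neq0 //; apply/prodf_neq0 => i _; rewrite lt0r_neq0.
  apply: (mulIf yn); rewrite HP2 // ep' mevalM rmorphXn /= mprodE; ring.
have p'y y : (p l).@[y] * p'.@[y] = Q.@[y] by rewrite -mevalM p'Q.
(* Only one of the two monomials of the exchange relation survives where the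
   variables of the support of the column vanish. *)
have Qs (y : 'I_n -> rat) i : y i = 0 -> C i l != 0 ->
    Q.@[y] = mon (fun i => (p i).@[y]) (fun i => posp (- (sg s * Bt i l))).
  move=> yi ci; rewrite QE.
  have m0 (a : 'I_n -> int) : 0 < a i -> mon y a = 0.
    move=> ai; rewrite /mon (bigD1 i) //= yi; have [k ->] : exists k : nat, a i = k.+1%:Z.
      by exists (absz (a i)).-1; lia.
    by rewrite -exprnP exprS !mul0r.
  have m1 (a : 'I_n -> int) : (forall i, a i = 0) -> mon y a = 1.
    by move=> h; apply: big1 => i' _; rewrite h expr0z.
  case: s cs => cs.
    rewrite (m1 (fun i => posp (C i l))) ?mulr1; last first.
      by move=> i'; apply: posp_0; have := cs i'; rewrite mulN1r oppr_ge0.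
    rewrite (m0 (fun i => posp (- C i l))) ?mulr0 ?addr0; last first.
      have := cs i; rewrite mulN1r => h; rewrite posp_id // lt_def h andbT.
      by rewrite oppr_eq0.
    by apply: eq_mon => // i'; rewrite mulN1r opprK.
  rewrite (m1 (fun i => posp (- C i l))) ?mulr1; last first.
    by move=> i'; apply: posp_0; have := cs i'; rewrite mul1r oppr_le0.
  rewrite (m0 (fun i => posp (C i l))) ?mulr0 ?add0r; last first.
    by have := cs i; rewrite mul1r => h; rewrite posp_id // lt_def h andbT.
  by apply: eq_mon => // i'; rewrite mul1r.
have [i0 ci0] : exists i, C i l != 0.
  apply/existsP; apply: contraT; rewrite negb_exists => /forallP h.
  have /matrixP/(_ l l) := mulVmx (Cp_unit ok); rewrite !mxE eqxx big1 // => i _.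
  by have := h i; rewrite negbK -/C => /eqP ->; rewrite mulr0.
have Fp' : Fpoly B (rcons ks l) (fun j => if j == l then p' else p j).
  move=> y hy j; case: eqP => [->|/eqP jl]; first exact: p'F.
  by rewrite /Fp XB_rcons (negPf jl) -hp.
have G'l k : Gp B (rcons ks l) k l = - Gp B ks k l +
    \sum_i Gp B ks k i * posp (- (sg s * Bt i l)) by exact: (G_rcons_col _ _ _ sk).
exists (fun j => if j == l then p' else p j); split=> //.
  move=> j; case: eqP => // _; have := p'y (fun=> 0).
  rewrite p0 mul1r (Qs _ i0) // => ->; apply: big1 => i _; by rewrite p0 exp1rz.
move=> k; have [e [he1 he2]] := hrow k.
(* An entry of column l off row k makes one exchange monomial vanish on axis k, and the sign of row
   k persists. Otherwise the column is a signed unit vector and the sign of row k flips. *)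
case: (pickP [pred i | (i != k) && (C i l != 0)]) => [i /andP[ik ci]|allk].
  have f' t : 0 < t -> p'.@[axis k t] = if e then (1 + t) ^ (- Gp B (rcons ks l) k l) else 1.
    move=> t0; have t1 : 1 + t != 0 by rewrite lt0r_neq0 // addr_gt0.
    have := p'y (axis k t); rewrite (Qs _ i) ?/axis ?(negPf ik) // -/(axis k t) he1 //.
    rewrite (eq_mon (y := fun j => if e then (1 + t) ^ (- Gp B ks k j) else 1) (b := fun i => posp (- (sg s * Bt i l)))) //; last by move=> j; rewrite he1.
    case: (e) => /=; last by rewrite mul1r => ->; apply: big1 => i' _; rewrite exp1rz.
    have z0 a : (1 + t) ^ a != 0 by rewrite expfz_neq0.
    move=> h; apply: (mulfI (z0 (- Gp B ks k l))); rewrite h -expfzDr //.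
    have -> : - Gp B ks k l + - Gp B (rcons ks l) k l =
        \sum_i (- Gp B ks k i) * posp (- (sg s * Bt i l)).
      rewrite G'l opprD opprK addrA addNr add0r -sumrN.
      by apply: eq_bigr => i' _; rewrite mulNr.
    rewrite /mon; elim/big_rec2: _ => [|i' a b _ ->]; first by rewrite expr0z.
    by rewrite expfzDr // exprz_exp.
  exists e; split=> j => [t t0|].
    case: (eqVneq j l) => [->|jl]; first exact: f'.
    by rewrite G_rcons_other // he1.
  case: (eqVneq j l) => [->|jl]; last by rewrite G_rcons_other.
  (* For the positive sign the restriction is 1 and [neighbour_chart] excludes a negative entry; for
     the negative sign it is a power of 1 + t, whose exponent [poly_axis] shows to be
     nonnegative. *)
  case: (e) f' => f'; last first.
    rewrite mul1r; apply: (neighbour_chart sk okl Fp') => t t0; rewrite eqxx; exact: f'.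
  by rewrite mulN1r; apply: (@poly_axis n p' k).
have hk i : i != k -> C i l = 0.
  by move=> ik; have := allk i; rewrite /= ik /= => /negbFE/eqP.
have [ckl g0 gl] := gram_col sk ok hk.
have es : s = e.
  have := cs k; have := he2 l; rewrite /C ckl.
  by case: (s); case: (e); rewrite ?mul1r ?mulN1r; lia.
have gle : Gp B ks k l = sg e.
  have := he2 l; case: (e); rewrite ?mul1r ?mulN1r /sg; lia.
have G'kl : Gp B (rcons ks l) k l = - sg e.
  rewrite G'l gle big1 ?addr0 // => i _; case: (eqVneq i l) => [->|il].
    by rewrite ll mulr0 oppr0 posp0 mulr0.
  by rewrite g0 // mul0r.
have fj j t : 0 < t -> j != l -> (p j).@[axis k t] = 1.
  by move=> t0 jl; rewrite he1 // g0 // oppr0 expr0z; case: (e).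
exists (~~ e); split=> j => [t t0|]; last first.
  case: (eqVneq j l) => [->|jl]; first by rewrite G'kl sgN; case: (e).
  by rewrite G_rcons_other // g0 // mulr0.
case: (eqVneq j l) => [->|jl]; last first.
  by rewrite fj // G_rcons_other // g0 // oppr0 expr0z; case: (e).
have t1 : 1 + t != 0 by rewrite lt0r_neq0 // addr_gt0.
have := p'y (axis k t); rewrite QE he1 // gle G'kl.
have mp a : a l = 0 -> mon (fun i => (p i).@[axis k t]) a = 1.
  move=> al; apply: big1 => i _; case: (eqVneq i l) => [->|il]; first by rewrite al expr0z.
  by rewrite fj // exp1rz.
rewrite !mp ?ll ?oppr0 ?posp0 // !mul1r.
have my a : (forall i, i != k -> a i = 0) -> mon (axis k t) a = t ^ a k.
  move=> h; rewrite /mon (bigD1 k) //= /axis eqxx big1 ?mulr1 // => i ik.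
  by rewrite h // expr0z.
rewrite !my; try by move=> i ik; rewrite hk // ?oppr0 posp0.
rewrite /C ckl gle; case: (e) => /=.
  rewrite [- -1]opprK (posp_0 (a := -1)) // expr0z posp_id // !expr1z => h.
  by apply: (mulfI t1); rewrite h mulr1.
by rewrite (posp_0 (a := - 1)) // posp_id // expr0z expr1z mul1r opprK expr1z addrC.
Qed.

End RowCoherence.

(** * Change of the initial seed and column coherence *)

Section SignCoherence.
Variable n : nat.
Implicit Types (d : 'I_n -> nat) (B : 'M[int]_n) (ks : seq 'I_n).

Definition rowc B ks k e := forall j, 0 <= sg e * Gp B ks k j.

Lemma rowc_ex d B ks k : skewD d B -> okpath B ks -> exists e, rowc B ks k e.
Proof.
move=> sk ok; have [p [_ _ h]] := row_coherence sk ok.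
by have [e [_ he]] := h k; exists e.
Qed.

Lemma sg_inj e e' (x : int) : x != 0 -> 0 <= sg e * x -> 0 <= sg e' * x -> e = e'.
Proof. by case: e; case: e'; rewrite ?mul1r ?mulN1r; lia. Qed.

Lemma Gp_row_neq0 B ks k : exists j, Gp B ks k j != 0.
Proof.
apply/existsP; apply: contraT; rewrite negb_exists => /forallP h.
have /matrixP/(_ k k) := mulmxV (Gp_unit B ks); rewrite !mxE eqxx big1 // => i _.
by have := h i; rewrite negbK => /eqP ->; rewrite mul0r.
Qed.

Lemma rowc_uniq B ks k e e' : rowc B ks k e -> rowc B ks k e' -> e = e'.
Proof. by have [j gj] := Gp_row_neq0 B ks k => h h'; apply: sg_inj gj (h j) (h' j). Qed.

Lemma gram_row d B ks k l : skewD d B -> okpath B ks ->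
  (forall j, j != l -> Gp B ks k j = 0) -> forall i, i != k -> Cp B ks i l = 0.
Proof.
move=> sk ok h i ik.
have gu : (Gp B ks)^T \in unitmx by rewrite unitmx_tr Gp_unit.
have gdc := GDC sk ok.
have eM : Dmx d *m Cp B ks = invmx (Gp B ks)^T *m Dmx d.
  by rewrite -[X in _ = _ *m X]gdc -mulmxA mulKmx.
have w a : invmx (Gp B ks)^T a l * Gp B ks k l = (a == k)%:R.
  have /matrixP/(_ a k) := mulVmx gu; rewrite mxE (bigD1 l) //= big1 ?addr0 => [|j jl].
    by rewrite !mxE.
  by rewrite [(_^T) _ _]mxE h // mulr0.
have gkl : Gp B ks k l != 0.
  by apply/eqP => g0; have := w k; rewrite g0 mulr0 eqxx.
have w0 : invmx (Gp B ks)^T i l = 0.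
  by have := w i; rewrite (negPf ik) => /eqP; rewrite mulf_eq0 (negPf gkl) orbF => /eqP.
have /matrixP/(_ i l) := eM; rewrite mulDmx mulmxD w0 mul0r => /eqP.
by rewrite mulf_eq0 gt_eqF ?(skewD_gt0 i sk) //= => /eqP.
Qed.

(** Mutation at l seen from two initial seeds adjacent at k. Off row k the matrices C agree, so a
    nonzero entry there forces equal signs. Without one, duality reduces row k of G and column l of
    C to a signed unit; then the sign of the row flips and the two columns have opposite signs. *)
Lemma row_step d B ks k l e e' (C0 : 'M[int]_n) : skewD d B -> okpath B ks ->
  rowc B ks k e -> rowc B (rcons ks l) k e' -> coh (Cp B ks) l -> coh C0 l ->
  C0 = Emat B k (~~ e) *m Cp B ks ->
  (csgn C0 l = csgn (Cp B ks) l /\ e' = e) \/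
  [/\ e' = ~~ e, csgn (Cp B ks) l = e, csgn C0 l = ~~ e &
    [/\ Gp B ks k l = sg e, Cp B ks k l = sg e, forall j, j != l -> Gp B ks k j = 0
      & forall i, i != k -> Cp B ks i l = 0]].
Proof.
move=> sk ok he he' cl cl0 eC; set C1 := Cp B ks in cl eC *.
have C0o i m : i != k -> C0 i m = C1 i m by move=> ik; rewrite eC mulEmx (negPf ik).
case: (pickP [pred i | (i != k) && (C1 i l != 0)]) => [i /andP[ik ci]|allk]; [left|right].
  split; first by apply: (@sg_inj _ _ (C1 i l)) => //; [rewrite -C0o //; apply: cohP|exact: cohP].
  have [j /andP[jl gj]] : exists j, (j != l) && (Gp B ks k j != 0).
    apply/existsP; apply: contraNT ci; rewrite negb_exists => /forallP h.
    apply/eqP; apply: (gram_row sk ok) ik => j jl.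
    by have := h j; rewrite jl /= negbK => /eqP.
  by apply: (sg_inj gj) (he j); have := he' j; rewrite G_rcons_other.
have hk i : i != k -> C1 i l = 0.
  by move=> ik; have := allk i; rewrite /= ik /= => /negbFE/eqP.
have [ckl g0 gl] := gram_col sk ok hk; rewrite -/C1 in ckl.
have gle : Gp B ks k l = sg e by have := he l; case: (e); rewrite ?mul1r ?mulN1r /sg; lia.
have c1e : C1 k l = sg e by rewrite ckl.
have c0e : C0 k l = - sg e.
  by rewrite eC mulEmx eqxx big1 ?addr0 ?c1e // => i ik; rewrite hk // mulr0.
have sgsg b : sg b * sg b = 1 by case: b.
split=> //.
- apply: (@sg_inj _ _ (- sg e)); [by case: (e)| |by rewrite sgN mulrNN sgsg].
  have := he' l; rewrite (G_rcons_col _ _ _ sk) gle big1 ?addr0 // => i _.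
  case: (eqVneq i l) => [->|il]; last by rewrite g0 // mul0r.
  by rewrite (skewD_diag _ (Bp_skewD ks sk)) mulr0 oppr0 posp0 mulr0.
- have h := cohP cl k; apply: (@sg_inj _ _ (C1 k l)) => //; rewrite c1e ?sgsg //.
  by case: (e).
have h := cohP cl0 k; apply: (@sg_inj _ _ (C0 k l)) => //; rewrite c0e ?sgN ?mulrNN ?sgsg //.
by case: (e).
Qed.

(** The initial mutation acts on C by E, with a sign read off row k of G. If that sign flips along
    the path, the opposite signs of the two columns l compensate for the change of E. *)
Lemma init_mut d B ks k : skewD d B -> okpath B ks -> okpath (mut_sq k B) (k :: ks) ->
  exists2 e, rowc B ks k e & Cp (mut_sq k B) (k :: ks) = Emat B k (~~ e) *m Cp B ks.
Proof.
move=> sk ok; set B0 := mut_sq k B; elim/okpath_ind: ok => [|{}ks l okl ok cl IH].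
  move=> ok0; exists false; first by move=> j; rewrite mul1r mxE; case: (k == j).
  have c0 : coh (Cp B0 [::]) k by apply: (ok0 [::] k [::]).
  rewrite -[[:: k]]/(rcons [::] k) Cp_rcons (@Cmut_E _ _ _ _ false) /=.
    by rewrite mul1mx mulmx1 Emat_mut.
  by move=> i; rewrite mul1r mxE; case: (i == k).
rewrite -rcons_cons => /okpath_rcons[ok0 cl0].
have {IH} [e he eC] := IH ok0.
have eB : Bp B0 (k :: ks) = Bp B ks by rewrite /= (mut_sqK _ sk).
set C1 := Cp B ks in cl eC *; set C0 := Cp B0 (k :: ks) in cl0 eC *.
have step1 : Cp B (rcons ks l) = C1 *m Emat (Bp B ks) l (csgn C1 l) by rewrite Cp_rconsE.
have step0 : Cp B0 (rcons (k :: ks) l) = C0 *m Emat (Bp B ks) l (csgn C0 l).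
  by rewrite Cp_rconsE // eB.
have [e' he'] := rowc_ex k sk okl.
case: (row_step sk ok he he' cl cl0 eC) => [[es ee]|[ee e1 e0 [gle c1e g0 hk]]].
  by exists e; [rewrite -ee|rewrite step0 step1 es eC mulmxA].
rewrite -/C1 in c1e hk e1; have sgsg b : sg b * sg b = 1 by case: b.
have sum0 (F : 'I_n -> int) : \sum_(i | i != k) F i * C1 i l = 0.
  by apply: big1 => i ik; rewrite hk // mulr0.
exists (~~ e); first by rewrite -ee.
rewrite step0 step1 e0 e1 eC negbK mulmxA; apply/matrixP=> i j.
have kk := skewD_diag k sk.
rewrite !mulmxE; case: (eqVneq j l) => [_|jl].
  by rewrite !mulEmx; case: eqP => // _; rewrite !sum0.
rewrite !mulEmx; case: (eqVneq i k) => [_|ik]; last by rewrite hk // !mul0r.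
rewrite !sum0 !addr0 c1e.
(* Row k of G is a signed unit at l, so row k of B C = G B_t is row l of B_t up to sign. *)
have gb : \sum_(m | m != k) B k m * C1 m j = sg e * Bp B ks l j.
  have /matrixP/(_ k j) := GB sk ok; rewrite !mxE (bigD1 l) //= gle big1 ?addr0 => [->|m ml].
    by rewrite [RHS](bigD1 k) //= kk mul0r add0r.
  by rewrite g0 // mul0r.
have sm : \sum_(m | m != k) posp (sg e * B k m) * C1 m j =
   \sum_(m | m != k) posp (sg (~~ e) * B k m) * C1 m j + Bp B ks l j.
  apply/eqP; rewrite addrC -subr_eq -sumrB; apply/eqP.
  transitivity (sg e * \sum_(m | m != k) B k m * C1 m j); last by rewrite gb mulrA sgsg mul1r.
  rewrite mulr_sumr; apply: eq_bigr => m _; rewrite -mulrBl mulrA; congr (_ * _).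
  by rewrite sgN mulNr pospB.
rewrite sm (_ : sg (~~ e) * Bp B ks l j = - (sg e * Bp B ks l j)); last by rewrite sgN mulNr.
have := pospB (sg e * Bp B ks l j).
move: (posp (sg e * _)) (posp (- (sg e * _))) => x y xy.
have -> : Bp B ks l j = sg e * (x - y) by rewrite xy mulrA sgsg mul1r.
move: (\sum_(_ | _) _) => S0; case: (e); rewrite /sg; ring.
Qed.

Lemma init_mutG d B ks k e : skewD d B -> okpath B ks -> okpath (mut_sq k B) (k :: ks) ->
  Cp (mut_sq k B) (k :: ks) = Emat B k (~~ e) *m Cp B ks ->
  Gp (mut_sq k B) (k :: ks) = Hmat B k (~~ e) *m Gp B ks.
Proof.
move=> sk ok ok0 eC; have gdc0 := GDC (mut_skewD k sk) ok0.
have gdc := GDC sk ok.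
have HD : (Hmat B k (~~ e))^T *m Dmx d = Dmx d *m Emat B k (~~ e).
  by rewrite -{1}(trDmx d) -trmx_mul (DHE _ _ sk) trmx_mul trmxK trDmx.
apply: trmx_inj; set X := (Gp _ _)^T in gdc0 *; set Y := (_ *m _)^T.
have eY : Y *m Dmx d *m Cp (mut_sq k B) (k :: ks) = Dmx d.
  have -> : Y *m Dmx d *m Cp (mut_sq k B) (k :: ks) = (Gp B ks)^T *m
     ((Hmat B k (~~ e))^T *m Dmx d) *m (Emat B k (~~ e) *m Cp B ks).
    by rewrite eC /Y trmx_mul !mulmxA.
  rewrite HD -[RHS]gdc -!mulmxA; congr (_ *m (_ *m _)).
  by rewrite mulmxA EmatK mul1mx.
have cu := Cp_unit ok0.
have : X *m Dmx d = Y *m Dmx d by rewrite -[LHS](mulmxK cu) -[RHS](mulmxK cu) gdc0 eY.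
move/matrixP=> h; apply/matrixP=> i j; have := h i j; rewrite !mulmxD.
by move/(mulIf (lt0r_neq0 (skewD_gt0 j sk))).
Qed.

Definition Coh N := forall d B ks, skewD d B -> (size ks <= N)%N -> forall j, coh (Cp B ks) j.

(** Only proper prefixes are tested, hence the gain of one in length. *)
Lemma Coh_ok N d B ks : Coh N -> skewD d B -> (size ks <= N.+1)%N -> okpath B ks.
Proof.
move=> h sk sz ks1 l ks2 e; apply: (h d) => //.
by move: sz; rewrite e size_cat size_rcons; lia.
Qed.

Lemma invC_col d B ks k e : skewD d B -> okpath B ks -> rowc B ks k e ->
  forall j, 0 <= sg e * invmx (Cp B ks) j k.
Proof.
move=> sk ok he j; have e1 : (Gp B ks)^T *m Dmx d = Dmx d *m invmx (Cp B ks).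
  by rewrite -[in RHS](GDC sk ok) mulmxK // Cp_unit.
have /matrixP/(_ j k) := e1; rewrite mulDmx mulmxD mxE => e2.
rewrite -(pmulr_rge0 _ (skewD_gt0 j sk)) mulrCA -e2 mulrA mulr_ge0 //.
Qed.

(** The last step of the reversed path multiplies by E with the sign of row k of G, since that is
    the sign of column k of the inverse of C. By [init_mut] this undoes the first step. *)
Lemma Cp_rev N d B ks : Coh N -> skewD d B -> (size ks <= N.+1)%N ->
  Cp (- Bp B ks) (rev ks) = invmx (Cp B ks).
Proof.
move=> hN; elim: ks B => [|k ks IH] B sk sz.
  by rewrite /Cp /= invmx1.
have sk1 := mut_skewD k sk; set B1 := mut_sq k B in sk1 *.
have sz' : (size ks <= N.+1)%N by move: sz => /=; lia.
have eB : mut_sq k B1 = B by rewrite /B1 (mut_sqK _ sk).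
have ok1 := Coh_ok hN sk1 sz'; have ok0 := Coh_ok hN sk sz.
have [|e he eC] := init_mut (ks := ks) (k := k) sk1 ok1; first by rewrite eB.
rewrite rev_cons Cp_rcons (_ : Bp B (k :: ks) = Bp B1 ks) // IH //.
have -> : Bp (- Bp B1 ks) (rev ks) = - B1.
  by rewrite (BpN _ (Bp_skewD ks sk1)) (Bp_rev _ sk1).
rewrite (Cmut_E _ (invC_col sk1 ok1 he)) EmatN.
rewrite eB in eC; rewrite eC.
have cu := Cp_unit ok1; have eu := Emat_unit B1 k (~~ e).
have ecu : Emat B1 k (~~ e) *m Cp B1 ks \in unitmx by rewrite unitmx_mul eu cu.
rewrite -[LHS](mulmxK ecu) mulmxA -[_ *m Emat _ _ _ *m Emat _ _ _]mulmxA EmatK mulmx1.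
by rewrite mulVmx // mul1mx.
Qed.

Theorem sign_coherence N : Coh N.
Proof.
elim: N => [|N IH] d B ks sk sz j.
  case: ks sz => // _; apply: (@coh_intro _ _ _ false) => i.
  by rewrite mul1r mxE; case: (i == j).
pose B2 := - Bp B ks.
have sk2 : skewD d B2 by apply: skewDN; apply: Bp_skewD.
have sz2 : (size (rev ks) <= N.+1)%N by rewrite size_rev.
(* Taken for the path already reversed, this exhibits C as an inverse C-matrix, whose columns
   inherit the signs of rows of a G-matrix. *)
have := Cp_rev IH sk2 sz2.
have -> : - Bp B2 (rev ks) = B.
  by rewrite /B2 (BpN _ (Bp_skewD ks sk)) (Bp_rev _ sk) opprK.
rewrite revK => ->.
have ok2 := Coh_ok IH sk2 sz2; have [e he] := rowc_ex j sk2 ok2.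
exact: coh_intro (invC_col sk2 ok2 he).
Qed.

Lemma okpathT d B ks : skewD d B -> okpath B ks.
Proof. by move=> sk; apply: (Coh_ok (@sign_coherence (size ks)) sk). Qed.

Lemma cohT d B ks j : skewD d B -> coh (Cp B ks) j.
Proof. by move=> sk; apply: (@sign_coherence (size ks) d). Qed.

Lemma G_cons d B ks k e : skewD d B -> rowc B ks k e ->
  Gp (mut_sq k B) (k :: ks) = Hmat B k (~~ e) *m Gp B ks.
Proof.
move=> sk he; have ok := okpathT (ks := ks) sk.
have ok0 := okpathT (ks := k :: ks) (mut_skewD k sk).
have [e' he' eC] := init_mut sk ok ok0.
by rewrite (init_mutG sk ok ok0 eC) (rowc_uniq he he').
Qed.

End SignCoherence.

(** * The g-vector fan *)

Section Degrees.
Variable n : nat.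
Variable B : 'M[int]_n.
Implicit Types (f : FF n) (g : 'I_n -> int) (p q : {mpoly rat[n + n]}).

Definition nnegp p := forall m, 0 <= p@_m.

(* Nonnegative coefficients prevent cancellation in sums, so that homogeneity
   passes through the exchange relations. *)
Definition hpos f g := exists p q a b,
  [/\ p != 0, q != 0, nnegp p, nnegp q & [/\ homog_of B p a, homog_of B q b,
      f = tofracP p / tofracP q & forall i, g i = a i - b i]].

Lemma mdegD m1 m2 i : Defs.mdeg B (m1 + m2)%MM i = Defs.mdeg B m1 i + Defs.mdeg B m2 i.
Proof.
rewrite /Defs.mdeg mnmDE PoszD -[RHS]addrACA -opprD -big_split /=; congr (_ - _).
by apply: eq_bigr => j _; rewrite mnmDE PoszD mulrDl.
Qed.

Lemma homogM p q a b : homog_of B p a -> homog_of B q b ->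
  homog_of B (p * q) (fun i => a i + b i).
Proof.
move=> hp hq m /msuppM_le/allpairsP[[m1 m2] /= [h1 h2 ->]] i.
by rewrite mdegD hp // hq.
Qed.

Lemma homogD p q a : homog_of B p a -> homog_of B q a -> homog_of B (p + q) a.
Proof.
by move=> hp hq m /msuppD_le; rewrite mem_cat => /orP[/hp|/hq].
Qed.

Lemma eq_homog p a b : a =1 b -> homog_of B p a -> homog_of B p b.
Proof. by move=> e h m hm i; rewrite h. Qed.

Lemma nnegpM p q : nnegp p -> nnegp q -> nnegp (p * q).
Proof.
move=> hp hq m; rewrite mcoeffM; apply: sumr_ge0 => -[m1 m2] _; exact: mulr_ge0.
Qed.

Lemma nnegpD p q : nnegp p -> nnegp q -> nnegp (p + q).
Proof. by move=> hp hq m; rewrite mcoeffD addr_ge0. Qed.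

Lemma nnegpD_neq0 p q : nnegp p -> nnegp q -> p != 0 -> p + q != 0.
Proof.
move=> hp hq /mlead_supp; rewrite mcoeff_msupp => h; apply/eqP => e.
have := congr1 (mcoeff (mlead p)) e; rewrite mcoeffD mcoeff0 => /eqP.
by rewrite paddr_eq0 // (negPf h).
Qed.

Lemma tofracP_neq0 p : p != 0 -> tofracP p != 0.
Proof. by rewrite /tofracP tofrac_eq0. Qed.

Lemma tofracPM p q : tofracP (p * q) = tofracP p * tofracP q.
Proof. exact: rmorphM. Qed.

Lemma tofracPD p q : tofracP (p + q) = tofracP p + tofracP q.
Proof. exact: rmorphD. Qed.

Lemma hpos_neq0 f g : hpos f g -> f != 0.
Proof.
move=> [p [q [a [b [p0 q0 _ _ [_ _ -> _]]]]]].
by rewrite mulf_neq0 ?invr_eq0 ?tofracP_neq0.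
Qed.

Lemma eq_hpos f g g' : g =1 g' -> hpos f g -> hpos f g'.
Proof.
move=> e [p [q [a [b [p0 q0 np nq [hp hq ef eg]]]]]].
by exists p, q, a, b; split=> //; split=> // i; rewrite -e.
Qed.

Lemma hposM f f' g g' : hpos f g -> hpos f' g' -> hpos (f * f') (fun i => g i + g' i).
Proof.
move=> [p [q [a [b [p0 q0 np nq [hp hq -> eg]]]]]].
move=> [p' [q' [a' [b' [p0' q0' np' nq' [hp' hq' -> eg']]]]]].
exists (p * p'), (q * q'), (fun i => a i + a' i), (fun i => b i + b' i).
split; rewrite ?mulf_neq0 //; try exact: nnegpM; split; try exact: homogM.
  by rewrite !tofracPM invfM mulrACA.
by move=> i; rewrite eg eg'; ring.
Qed.

Lemma hposV f g : hpos f g -> hpos f^-1 (fun i => - g i).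
Proof.
move=> [p [q [a [b [p0 q0 np nq [hp hq -> eg]]]]]].
by exists q, p, b, a; split=> //; split=> // [|i]; rewrite ?invf_div // eg opprB.
Qed.

Lemma hposD f f' g : hpos f g -> hpos f' g -> hpos (f + f') g.
Proof.
move=> [p [q [a [b [p0 q0 np nq [hp hq -> eg]]]]]].
move=> [p' [q' [a' [b' [p0' q0' np' nq' [hp' hq' -> eg']]]]]].
exists (p * q' + p' * q), (q * q'), (fun i => a i + b' i), (fun i => b i + b' i).
split; rewrite ?mulf_neq0 //; try exact: nnegpM.
- by apply: nnegpD_neq0; rewrite ?mulf_neq0 //; exact: nnegpM.
- by apply: nnegpD; exact: nnegpM.
split; try exact: homogM.
- apply: homogD; first exact: homogM.
  apply: (eq_homog _ (homogM hp' hq)) => i; have := eg i; rewrite eg'; lia.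
- by rewrite tofracPD !tofracPM addf_div // tofracP_neq0.
by move=> i; rewrite eg; ring.
Qed.

Lemma hpos1 : hpos 1 (fun=> 0).
Proof.
exists 1, 1, (fun=> 0), (fun=> 0).
have n1 : nnegp 1 by move=> m; rewrite mcoeff1; case: (m == _).
have h1 : homog_of B 1 (fun=> 0).
  move=> m; rewrite mcoeff_msupp mcoeff1; case: (m =P 0%MM) => [-> _ i|_]; last by rewrite eqxx.
  by rewrite /Defs.mdeg mnm0E big1 ?subr0 // => j _; rewrite mnm0E mul0r.
by split; rewrite ?oner_eq0 //; split=> //; rewrite divff // tofracP_neq0 // oner_eq0.
Qed.

Lemma hpos_exprz f g (a : int) : hpos f g -> hpos (f ^ a) (fun i => g i * a).
Proof.
move=> h; have hn (e : nat) : hpos (f ^+ e) (fun i => g i * e%:Z).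
  elim: e => [|e IH]; first by apply: eq_hpos hpos1 => i; rewrite mulr0.
  by rewrite exprS; apply: eq_hpos (hposM h IH) => i; rewrite -addn1 PoszD; ring.
case: a => e; first exact: hn.
rewrite NegzE -exprnN; apply: eq_hpos (hposV (hn e.+1)) => i; by rewrite mulrN.
Qed.

Lemma hpos_mon (m : nat) (x : 'I_m -> FF n) (G : 'I_n -> 'I_m -> int) (a : 'I_m -> int) :
  (forall i, hpos (x i) (G^~ i)) -> hpos (mon x a) (fun r => \sum_i G r i * a i).
Proof.
move=> h; rewrite /mon.
suff H (s : seq 'I_m) : hpos (\prod_(i <- s) x i ^ a i) (fun r => \sum_(i <- s) G r i * a i).
  exact: H.
elim: s => [|i s IH]; first by apply: eq_hpos; last rewrite big_nil; [move=> r; rewrite big_nil|exact: hpos1].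
rewrite big_cons; apply: eq_hpos (hposM (hpos_exprz (a i) (h i)) IH) => r.
by rewrite big_cons.
Qed.

Lemma hposX (i : 'I_(n + n)) : hpos (tofracP 'X_i) (Defs.mdeg B U_(i)%MM).
Proof.
exists 'X_i, 1, (Defs.mdeg B U_(i)%MM), (fun=> 0).
have [p [q [a [b [p0 q0 np nq [hp hq ef eg]]]]]] := hpos1.
split; rewrite ?oner_eq0 ?mpolyXU_neq0 //.
- by move=> m; rewrite mcoeffX; case: (_ == _).
- by move=> m; rewrite mcoeff1; case: (_ == _).
split=> //.
- by move=> m; rewrite msuppX inE => /eqP->.
- move=> m; rewrite mcoeff_msupp mcoeff1; case: (m =P 0%MM) => [-> _ r|_]; last by rewrite eqxx.
  by rewrite /Defs.mdeg mnm0E big1 ?subr0 // => j _; rewrite mnm0E mul0r.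
- by rewrite [tofracP 1]rmorph1 divr1.
by move=> r; rewrite subr0.
Qed.

Lemma hpos_xvar j : hpos (xvar j) (fun i => (i == j)%:R).
Proof.
apply: eq_hpos (hposX _) => i; rewrite /Defs.mdeg mnm1E big1 ?subr0.
  by rewrite (inj_eq (@lshift_inj _ _)) eq_sym; case: eqP.
by move=> l _; rewrite mnm1E eq_lrshift mul0r.
Qed.

Lemma hpos_yvar j : hpos (yvar j) (fun i => - B i j).
Proof.
apply: eq_hpos (hposX _) => i; rewrite /Defs.mdeg mnm1E eq_rlshift sub0r (bigD1 j) //=.
rewrite mnm1E eqxx mul1r big1 ?addr0 // => l lj.
by rewrite mnm1E (inj_eq (@rshift_inj _ _)) eq_sym (negPf lj) mul0r.
Qed.

Lemma degree_uniq f g g' : degree_of B f g -> degree_of B f g' -> g =1 g'.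
Proof.
move=> [p [q [a [b [p0 q0 hp hq [ef eg]]]]]] [p' [q' [a' [b' [p0' q0' hp' hq' [ef' eg']]]]]].
have e : p * q' = p' * q.
  apply/eqP; rewrite -tofrac_eq -/(tofracP (p * q')) -/(tofracP (p' * q)) !tofracPM.
  by rewrite -eqr_div ?tofracP_neq0 // -ef ef'.
move=> i; rewrite eg eg'.
have nz : p * q' != 0 by rewrite mulf_neq0.
have := homogM hp hq' (mlead_supp nz) i; rewrite e in nz *.
by rewrite (homogM hp' hq (mlead_supp nz) i); lia.
Qed.

Lemma hpos_degree f g : hpos f g -> degree_of B f g.
Proof.
move=> [p [q [a [b [p0 q0 _ _ [hp hq ef eg]]]]]].
by exists p, q, a, b; split.
Qed.

Variable d : 'I_n -> nat.
Hypothesis sk : skewD d B.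

Definition clvar ks := XB B ks (@xvar n) (@yvar n).

Lemma clvar_hpos ks j : hpos (clvar ks j) (fun i => Gp B ks i j).
Proof.
elim/last_ind: ks j => [|ks k IH] j.
  rewrite /clvar /XB /= xyl; apply: eq_hpos (hpos_xvar j) => i.
  by rewrite /Gp /= mxE.
case: (eqVneq j k) => [->|jk]; last first.
  rewrite /clvar XB_rcons (negPf jk); apply: eq_hpos (IH j) => i.
  by rewrite G_rcons_other.
have ck := cohT ks k sk; set s := csgn (Cp B ks) k.
have Xn i : XB B ks (@xvar n) (@yvar n) i != 0 := hpos_neq0 (IH i).
have yn i : yvar i != 0 :> FF n := hpos_neq0 (hpos_yvar i).
rewrite /clvar (XB_rcons_coh Xn yn (cohP ck)) -/s.
(* The y-part has degree - B C and the x-part G B_t; they cancel by [GB]. *)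
have hY : hpos (Yh B ks (@xvar n) (@yvar n) k) (fun=> 0).
  have := hposM (hpos_mon (G := fun i l => - B i l) (fun i => Cp B ks i k) hpos_yvar)
                (hpos_mon (G := fun i l => Gp B ks i l) (fun i => Bp B ks i k) IH).
  apply: eq_hpos => i; have /matrixP/(_ i k) := GB sk (okpathT (ks := ks) sk).
  rewrite !mxE => ->; rewrite -big_split /= big1 // => l _; ring.
have h1 : hpos (1 + Yh B ks (@xvar n) (@yvar n) k ^ sg s) (fun=> 0).
  apply: hposD; first exact: hpos1.
  by apply: eq_hpos (hpos_exprz (sg s) hY) => i; rewrite mul0r.
have := hposM (hposM (hpos_mon (G := fun i l => Gp B ks i l)
   (fun i => posp (- (sg s * Bp B ks i k))) IH) h1) (hposV (IH k)).
by apply: eq_hpos => i; rewrite (G_rcons_col _ _ _ sk) addr0 addrC.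
Qed.

Lemma seed_mut_clvar ks k (s : seed n) :
  sC s = col_mx (Bp B ks) (Cp B ks) -> sx s =1 clvar ks ->
  sC (seed_mut k s) = col_mx (Bp B (rcons ks k)) (Cp B (rcons ks k)) /\
  sx (seed_mut k s) =1 clvar (rcons ks k).
Proof.
move=> eC ex; split; first by rewrite /= eC mutf_col_mx Bp_rcons Cp_rcons.
move=> j; rewrite /= /clvar XB_rcons; case: ifP => _; last exact: ex.
have pw (x : FF n) (a : int) : x ^+ absz (posp a) = x ^ posp a.
  by rewrite exprnP abszE ger0_norm ?posp_ge0.
rewrite ex; congr ((_ + _) / _); rewrite big_split_ord /=; congr (_ * _);
  apply: eq_bigr => i _; rewrite /extvar pw eC ?col_mxEu ?col_mxEd.
- by rewrite (unsplitK (inl i)) ex.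
- by rewrite (unsplitK (inr i)).
- by rewrite (unsplitK (inl i)) ex.
- by rewrite (unsplitK (inr i)).
Qed.

Lemma reachable_path s : reachable B s ->
  exists ks, sC s = col_mx (Bp B ks) (Cp B ks) /\ sx s =1 clvar ks.
Proof.
elim=> [|{}s k _ [ks [eC ex]]]; last by exists (rcons ks k); apply: seed_mut_clvar.
exists [::]; split=> // j; by rewrite /clvar /XB /= xyl.
Qed.

Lemma path_reachable ks : exists s, [/\ reachable B s,
  sC s = col_mx (Bp B ks) (Cp B ks) & sx s =1 clvar ks].
Proof.
elim/last_ind: ks => [|ks k [s [rs eC ex]]].
  exists (Seed (@xvar n) (col_mx B 1%:M)); split=> //; first exact: reachable0.
  by move=> j; rewrite /clvar /XB /= xyl.
have [e1 e2] := seed_mut_clvar k eC ex.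
by exists (seed_mut k s); split=> //; exact: reachableS.
Qed.

Definition gcone (R : realType) ks (v : 'I_n -> R) := exists lam : 'I_n -> R,
  (forall j, 0 <= lam j) /\ forall i, v i = \sum_(j < n) lam j * (Gp B ks i j)%:~R.

Lemma in_gfanE (R : realType) (v : 'I_n -> R) : in_gfan B v <-> exists ks, gcone ks v.
Proof.
split=> [[s [rs [g [hg [lam [l0 hv]]]]]]|[ks [lam [l0 hv]]]].
  have [ks [_ ex]] := reachable_path rs; exists ks, lam; split=> // i.
  rewrite hv; apply: eq_bigr => j _; congr (_ * _%:~R).
  have := hg j; rewrite ex => h.
  exact: (degree_uniq h (hpos_degree (clvar_hpos ks j))).
have [s [rs _ ex]] := path_reachable ks; exists s; split=> //.
exists (fun j i => Gp B ks i j); split; last by exists lam.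
by move=> j; rewrite ex; apply: hpos_degree; apply: clvar_hpos.
Qed.

End Degrees.

(** * The closure of the fan under change of the initial seed *)

Section Cover.
Variables (R : realType) (n : nat).
Implicit Types (B : 'M[int]_n) (v w : 'I_n -> R).

(** Membership in the closure of the fan, for the sup norm. *)
Definition cov B v := forall eps : R, 0 < eps ->
  exists ks w, gcone B ks w /\ forall i, `|v i - w i| < eps.

Lemma gfan_denseE d B : skewD d B -> (gfan_dense R B <-> forall v, cov B v).
Proof.
move=> sk; split=> h v eps e0.
  by have [w [/(in_gfanE sk)[ks hw] hv]] := h v eps e0; exists ks, w.
by have [ks [w [hw hv]]] := h v eps e0; exists w; split=> //; apply/(in_gfanE sk); exists ks.
Qed.

Lemma cov_closed B v : (forall eps : R, 0 < eps -> exists2 w, cov B w & forall i, `|v i - w i| < eps) ->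
  cov B v.
Proof.
move=> h eps e0; have e2 : 0 < eps / 2 by lra.
have [w cw hw] := h _ e2; have [ks [u [hu hwu]]] := cw _ e2; exists ks, u; split=> // i.
have := ler_normD (v i - w i) (w i - u i); rewrite subrKA.
have := hw i; have := hwu i; lra.
Qed.

(** The action of an initial mutation on g-vectors. Row coherence puts each cone on one side of v_k
    = 0, and [eta] is linear on each side. *)
Definition eta B k v : 'I_n -> R := fun i =>
  if i == k then - v k
  else v i + (posp (B i k))%:~R * Num.max (v k) 0 + (posp (- B i k))%:~R * Num.min (v k) 0.

Lemma gcone_eta d B k ks v : skewD d B -> gcone B ks v ->
  gcone (mut_sq k B) (k :: ks) (eta B k v).
Proof.
move=> sk [lam [l0 hv]]; exists lam; split=> // i.
have [e he] := rowc_ex k sk (okpathT (ks := ks) sk).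
rewrite (G_cons sk he) /eta.
have vk : 0 <= (sg e)%:~R * v k.
  rewrite hv mulr_sumr; apply: sumr_ge0 => j _; rewrite mulrCA -intrM mulr_ge0 //.
  by rewrite ler0z.
under eq_bigr do rewrite mulHmx.
case: eqP => [_|ik].
  by rewrite hv -sumrN; apply: eq_bigr => j _; rewrite intrN mulrN.
rewrite (eq_bigr (fun j => lam j * (Gp B ks i j)%:~R +
    (posp (- (sg (~~ e) * B i k)))%:~R * (lam j * (Gp B ks k j)%:~R))); last first.
  by move=> j _; rewrite intrD intrM; ring.
rewrite big_split /= -mulr_sumr -!hv -addrA; congr (_ + _).
move: vk; case: (e); rewrite /sg /= ?mulN1r ?mul1r ?opprK => vk.
  have h : v k <= 0 by move: vk; rewrite ?mulN1r ?oppr_ge0.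
  by rewrite (max_idPr h) (min_idPl h) mulr0 add0r.
have h : 0 <= v k by move: vk; rewrite ?mul1r.
by rewrite (max_idPl h) (min_idPr h) mulr0 addr0.
Qed.

Lemma etaK d B k v : skewD d B -> eta (mut_sq k B) k (eta B k v) =1 v.
Proof.
move=> sk i; rewrite /eta eqxx; case: eqP => [->|/eqP ik]; first by rewrite opprK.
rewrite mxE eqxx orbT opprK.
have -> : Num.max (- v k) 0 = - Num.min (v k) 0 by rewrite -{1}oppr0 oppr_min.
have -> : Num.min (- v k) 0 = - Num.max (v k) 0 by rewrite -{1}oppr0 oppr_max.
by ring.
Qed.

Lemma eta_lip B k v w (eps : R) : (forall i, `|v i - w i| < eps) ->
  forall i, `|eta B k v i - eta B k w i| <= eps * (1 + \sum_l `|B l k|%:~R).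
Proof.
move=> h i; have hk := h k.
have eps0 : 0 < eps by apply: le_lt_trans hk.
have s0 : 0 <= \sum_l `|B l k|%:~R :> R by apply: sumr_ge0 => l _; rewrite ler0z.
rewrite /eta; case: eqP => [_|_].
  rewrite -opprD normrN mulrDr mulr1 ler_wpDr ?mulr_ge0 // ltW //.
have /andP[h1 h2] : - eps < v k - w k < eps by rewrite -ltr_norml.
have hm : `|Num.max (v k) 0 - Num.max (w k) 0| <= eps.
  rewrite /Num.max; case: (ltrP (v k)) => ?; case: (ltrP (w k)) => ?; rewrite ler_norml; apply/andP; split; lra.
have hn : `|Num.min (v k) 0 - Num.min (w k) 0| <= eps.
  rewrite /Num.min; case: (ltrP (v k)) => ?; case: (ltrP (w k)) => ?; rewrite ler_norml; apply/andP; split; lra.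
set mx := Num.max (v k) 0; set mx' := Num.max (w k) 0.
set mn := Num.min (v k) 0; set mn' := Num.min (w k) 0.
rewrite (_ : _ - _ = (v i - w i) + ((posp (B i k))%:~R * (mx - mx') +
   (posp (- B i k))%:~R * (mn - mn'))); last by ring.
apply: le_trans (ler_normD _ _) _; rewrite [eps * _]mulrDr mulr1; apply: lerD; first exact: ltW.
apply: le_trans (ler_normD _ _) _; rewrite !normrM.
have p1 : 0 <= (posp (B i k))%:~R :> R by rewrite ler0z posp_ge0.
have p2 : 0 <= (posp (- B i k))%:~R :> R by rewrite ler0z posp_ge0.
rewrite (ger0_norm p1) (ger0_norm p2).
have bi : (posp (B i k))%:~R + (posp (- B i k))%:~R = `|B i k|%:~R :> R.
  by rewrite -intrD; congr (_%:~R); rewrite /posp; lia.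
apply: (@le_trans _ _ (eps * `|B i k|%:~R)).
  by rewrite -bi mulrDr !(mulrC eps) lerD // ler_wpM2l.
apply: ler_wpM2l; first exact: ltW.
rewrite (bigD1 i) //= lerDl; apply: sumr_ge0 => l _; by rewrite ler0z.
Qed.

Lemma cov_eta d B k v : skewD d B -> cov B v -> cov (mut_sq k B) (eta B k v).
Proof.
(* The additional 1 turns the weak bound of [eta_lip] into a strict one. *)
move=> sk h eps e0; set M : R := 1 + \sum_l `|B l k|%:~R + 1.
have M0 : 0 < M.
  have : 0 <= \sum_l `|B l k|%:~R :> R by apply: sumr_ge0 => l _; rewrite ler0z.
  rewrite /M; lra.
have eM : 0 < eps / M by apply: divr_gt0.
have [ks [w [hw hv]]] := h _ eM; exists (k :: ks), (eta B k w).
split=> [|i]; first exact: (gcone_eta k sk hw).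
apply: le_lt_trans (eta_lip B k hv i) _.
rewrite -mulrA gtr_pMr // mulrC ltr_pdivrMr // mul1r /M; lra.
Qed.

Lemma eq_cov B v w : v =1 w -> cov B v -> cov B w.
Proof.
move=> e h eps e0; have [ks [u [hu h']]] := h eps e0; exists ks, u; split=> // i.
by rewrite -e.
Qed.

Lemma cov_mut d B k v : skewD d B -> (cov (mut_sq k B) (eta B k v) <-> cov B v).
Proof.
move=> sk; split=> h; last exact: (cov_eta k sk h).
have := cov_eta k (mut_skewD k sk) h; rewrite (mut_sqK k sk).
exact: (eq_cov (etaK k v sk)).
Qed.

Lemma cov_all_mut d B k : skewD d B -> (forall v, cov B v) -> forall v, cov (mut_sq k B) v.
Proof.
move=> sk h v; have sk' := mut_skewD k sk.
have e := etaK k v sk'; rewrite (mut_sqK k sk) in e.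
by apply: (eq_cov e); apply: (cov_eta k sk).
Qed.

Lemma cov_equiv d B B' : skewD d B -> mut_equiv B B' ->
  skewD d B' /\ ((forall v, cov B v) <-> (forall v, cov B' v)).
Proof.
move=> sk; elim=> [|C k _ [skC IH]]; first by split.
split; first exact: mut_skewD; apply: (iff_trans IH); split=> h; first exact: (cov_all_mut k skC h).
by have := @cov_all_mut d _ k (mut_skewD k skC) h; rewrite (mut_sqK k skC).
Qed.

End Cover.

(** * Positive semidefinite forms *)

Section Growth.
Variables (R : realType) (n : nat) (A : 'M[R]_n).
Implicit Types (x y z w : 'cV[R]_n).

Definition bf (M : 'M[R]_n) x y : R := (x^T *m M *m y) 0 0.
Definition dot x y : R := (x^T *m y) 0 0.

Let S := A + A^T.

Lemma bfDl M x x' y : bf M (x + x') y = bf M x y + bf M x' y.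
Proof. by rewrite /bf raddfD /= !mulmxDl mxE. Qed.
Lemma bfDr M x y y' : bf M x (y + y') = bf M x y + bf M x y'.
Proof. by rewrite /bf mulmxDr mxE. Qed.
Lemma bfZl M a x y : bf M (a *: x) y = a * bf M x y.
Proof. by rewrite /bf linearZ /= -!scalemxAl mxE. Qed.
Lemma bfZr M a x y : bf M x (a *: y) = a * bf M x y.
Proof. by rewrite /bf -scalemxAr mxE. Qed.
Lemma bf_tr M x y : bf M^T x y = bf M y x.
Proof.
rewrite /bf -[in RHS]mulmxA -[in LHS](trmxK (x^T *m M^T *m y)) mxE.
by rewrite !trmx_mul !trmxK mulmxA -mulmxA.
Qed.
Lemma bfE M x y : bf M x y = dot x (M *m y).
Proof. by rewrite /bf /dot mulmxA. Qed.
Lemma bf_S x y : bf S x y = bf A x y + bf A y x.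
Proof. by rewrite -[bf A y x]bf_tr /bf /S mulmxDr mulmxDl mxE. Qed.
Lemma dotC x y : dot x y = dot y x.
Proof. by rewrite /dot -[in LHS](trmxK (x^T *m y)) mxE trmx_mul trmxK. Qed.
Lemma dotN x y : dot x (- y) = - dot x y.
Proof. by rewrite /dot mulmxN mxE. Qed.
Lemma dotDl x x' y : dot (x + x') y = dot x y + dot x' y.
Proof. by rewrite /dot raddfD /= mulmxDl mxE. Qed.
Lemma dotE x y : dot x y = \sum_i x i 0 * y i 0.
Proof. by rewrite /dot mxE; apply: eq_bigr => i _; rewrite mxE. Qed.

Hypothesis psd : forall x, 0 <= bf S x x.

Lemma bf_SC x y : bf S x y = bf S y x.
Proof. by rewrite !bf_S addrC. Qed.

Lemma bf_bound x y : bf S x y <= bf S x x + bf S y y.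
Proof.
have := psd (x + -1 *: y); have := psd (x + y).
rewrite !(bfDl, bfDr, bfZl, bfZr) (bf_SC y x); lra.
Qed.

Lemma psd_ker x : bf S x x = 0 -> S *m x = 0.
Proof.
move=> x0; have h y : bf S y x = 0.
  apply/eqP; apply/negPn/negP => nz; set b := bf S y x in nz *; set c := bf S y y.
  have := psd (y + (- (c + 1) / (2 * b)) *: x).
  rewrite !(bfDl, bfDr, bfZl, bfZr) (bf_SC x y) x0 -/b -/c.
  set t := _ / _; have -> : t * b = - (c + 1) / 2.
    by rewrite /t; field; rewrite nz.
  by rewrite mulr0; lra.
apply/matrixP=> i j; rewrite ord1 [RHS]mxE; have := h (delta_mx i 0).
rewrite bfE dotE (bigD1 i) //= mxE !eqxx mul1r big1 ?addr0 // => l li.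
by rewrite mxE (negPf li) mul0r.
Qed.

(** For invertible A this is an orbit of the Coxeter transformation - A^(-T) A, an isometry of S,
    assumed positive throughout. *)
Variable u : nat -> 'cV[R]_n.
Hypothesis u_gt0 : forall m i, 0 < u m i 0.
Hypothesis rec : forall m, A^T *m u m.+1 = - (A *m u m).

Lemma bf_step x m : bf A x (u m.+1) = dot (A^T *m x) (u m.+1).
Proof. by rewrite /bf /dot trmx_mul trmxK. Qed.

Lemma norm_const m : bf S (u m) (u m) = bf S (u 0%N) (u 0%N).
Proof.
elim: m => // m <-; rewrite !bf_S; suff -> : bf A (u m.+1) (u m.+1) = bf A (u m) (u m) by [].
rewrite bf_step rec dotC dotN -bfE; have := bf_tr A (u m) (u m.+1).
by rewrite bfE rec dotN -bfE => <-; rewrite opprK.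
Qed.

(** As S = A + A^T, the hypothesis turns A^T w into - A (a + w). The functional A(w, -) thus grows
    along the orbit by increments prescribed through a. *)
Lemma lin_step w a m : S *m w = - (A *m a) ->
  bf A w (u m.+1) = bf A w (u m) + bf A a (u m).
Proof.
move=> e; have e2 : A^T *m w = - (A *m (a + w)).
  by apply/eqP; rewrite mulmxDr opprD -e /S mulmxDl addrAC subrr add0r.
have e3 : bf A (u m.+1) (a + w) = - bf A (a + w) (u m).
  by rewrite -bf_tr [LHS]bfE rec dotN -bfE.
by rewrite bf_step e2 dotC dotN -bfE e3 opprK bfDl addrC.
Qed.

Lemma bound_lin z m : dot (S *m z) (u m) <= bf S z z + bf S (u 0%N) (u 0%N).
Proof. by rewrite dotC -bfE bf_SC -(norm_const m) bf_bound. Qed.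

Lemma growth_pd : (0 < n)%N -> (forall x, x != 0 -> 0 < bf S x x) -> False.
Proof.
move=> n0 pd.
have Su : S \in unitmx.
  rewrite -row_free_unit -kermx_eq0; apply/rowV0P => x /sub_kermxP xS.
  apply/eqP; apply/negPn/negP => x0; have : x^T != 0 by rewrite -(inj_eq trmx_inj) trmxK trmx0.
  by move/pd; rewrite /bf trmxK xS mul0mx mxE ltxx.
have Au : A \in unitmx.
  rewrite -row_free_unit -kermx_eq0; apply/rowV0P => x /sub_kermxP xS.
  apply/eqP; apply/negPn/negP => x0; have : x^T != 0 by rewrite -(inj_eq trmx_inj) trmxK trmx0.
  by move/pd; rewrite bf_S /bf trmxK xS mul0mx mxE addr0 ltxx.
(* A^T a = 1 makes the increments of A(w, u_m) the coordinate sums t_m > 0, while S z = A^T w keeps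
   A(w, u_m) bounded. *)
pose one : 'cV[R]_n := const_mx 1.
pose a := invmx A^T *m one; pose w := - (invmx S *m (A *m a)); pose z := invmx S *m (A^T *m w).
have hw : S *m w = - (A *m a) by rewrite /w mulmxN mulKVmx.
pose t m := bf A a (u m).
have tE m : t m = \sum_i u m i 0.
  have -> : t m = dot one (u m).
    by rewrite /t /bf /dot -[A]trmxK -trmx_mul /a mulKVmx ?unitmx_tr.
  by rewrite dotE; apply: eq_bigr => i _; rewrite mxE mul1r.
have i0 : 'I_n := Ordinal n0.
have t_gt m i : u m i 0 <= t m.
  by rewrite tE (bigD1 i) //= lerDl; apply: sumr_ge0 => j _; rewrite ltW.
have t0 m : 0 < t m by apply: lt_le_trans (u_gt0 m i0) (t_gt m i0).
have lamE m : bf A w (u m) = bf A w (u 0%N) + \sum_(i < m) t i.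
  elim: m => [|m IH]; first by rewrite big_ord0 addr0.
  by rewrite (lin_step _ hw) IH big_ord_recr addrA.
have lamB m : bf A w (u m) <= bf S z z + bf S (u 0%N) (u 0%N).
  have := bound_lin z m; rewrite /z mulKVmx // /dot trmx_mul trmxK; exact.
set Cst := bf S z z + bf S (u 0%N) (u 0%N) - bf A w (u 0%N).
have sumB m : \sum_(i < m) t i <= Cst.
  by have := lamB m; rewrite lamE /Cst; lra.
have tC m : t m <= Cst.
  apply: le_trans (sumB m.+1); rewrite big_ord_recr /= lerDr; apply: sumr_ge0 => i _.
  exact: ltW.
pose K := \sum_i \sum_j `|A i j|.
have qK m : bf A (u m) (u m) <= K * t m ^+ 2.
  rewrite bfE dotE /K mulr_suml; apply: ler_sum => i _.
  rewrite mxE mulr_sumr mulr_suml; apply: ler_sum => j _.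
  rewrite mulrCA; apply: (@le_trans _ _ (`|A i j| * (u m i 0 * u m j 0))).
    by rewrite ler_wpM2r ?ler_norm // mulr_ge0 // ltW.
  by rewrite ler_wpM2l // expr2 ler_pM // ltW.
have un m : u m != 0.
  by apply/eqP => um; have := u_gt0 m i0; rewrite um mxE ltxx.
pose q0 := bf S (u 0%N) (u 0%N).
have q00 : 0 < q0 := pd _ (un 0%N).
(* The constant norm q0 <= 2 K t^2 <= 2 K Cst t bounds t away from 0, so its partial sums grow
   linearly, against [sumB]. *)
have qt m : q0 <= 2 * K * Cst * t m.
  have := qK m; have := norm_const m; rewrite bf_S -/q0 => e h.
  have : q0 <= 2 * (K * t m ^+ 2) by rewrite -e; lra.
  move=> h2; apply: (le_trans h2); rewrite -!mulrA expr2; do 2 rewrite ler_wpM2l //.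
    by apply: sumr_ge0 => i _; apply: sumr_ge0.
  by rewrite ler_wpM2r ?tC // ltW.
have KC : 0 < 2 * K * Cst.
  by have := lt_le_trans q00 (qt 0%N); rewrite pmulr_lgt0.
set e := q0 / (2 * K * Cst); have e0 : 0 < e by rewrite divr_gt0.
have te m : e <= t m by rewrite /e ler_pdivrMr // mulrC.
have sumE m : e * m%:R <= \sum_(i < m) t i.
  by rewrite mulr_natr -[m in _ *+ m]card_ord -sumr_const; apply: ler_sum.
have C0 : 0 <= Cst by apply: ltW; apply: lt_le_trans (t0 0%N) (tC _).
have := archi_boundP (divr_ge0 C0 (ltW e0)); set N := Num.bound _.
rewrite ltr_pdivrMr // mulrC => h.
by have := lt_le_trans h (le_trans (sumE N) (sumB N)); rewrite ltxx.
Qed.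

(** The image of a symmetric matrix is the orthogonal complement of its kernel, here the line
    through de. *)
Lemma sym_solve (de y : 'cV[R]_n) : S *m de = 0 -> de != 0 -> (\rank S).+1 = n ->
  dot de y = 0 -> exists z, S *m z = y.
Proof.
move=> Sd d0 rk dy.
have St : S^T = S by rewrite /S raddfD /= trmxK addrC.
have sub : (S <= kermx de)%MS by apply/sub_kermxP.
have rd : \rank de = 1%N by apply/eqP; rewrite eqn_leq rank_leq_col lt0n mxrank_eq0.
have eqr : (S == kermx de)%MS.
  by rewrite -(geq_leqif (mxrank_leqif_eq sub)) mxrank_ker rd leq_subLR add1n rk.
have yk : (y^T <= kermx de)%MS.
  apply/sub_kermxP/matrixP=> i j; rewrite !ord1 [RHS]mxE -dy dotC /dot.
  by [].
have /submxP[z hz] : (y^T <= S)%MS by apply: submx_trans yk _; case/andP: eqr.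
exists z^T; apply: trmx_inj; rewrite trmx_mul trmxK St; exact: esym.
Qed.

Lemma growth_psd (de : 'cV[R]_n) : (forall i, 0 < de i 0) -> S *m de = 0 ->
  (\rank S).+1 = n -> A \in unitmx -> bf A de (u 0%N) <= 0.
Proof.
move=> dpos Sd rk Au; have n0 : (0 < n)%N by rewrite -rk.
have j : 'I_n := Ordinal n0.
have d0 : de != 0 by apply/eqP => e; have := dpos j; rewrite e mxE ltxx.
have dAd : bf A de de = 0.
  have : bf S de de = 0 by rewrite bfE Sd /dot mulmx0 mxE.
  by rewrite bf_S; lra.
have [w hw] : exists w, S *m w = - (A *m de).
  by apply: (sym_solve Sd d0 rk); rewrite dotN -bfE dAd oppr0.
set om := bf S w w.
have omE : bf A w de = - om by rewrite bfE /om bfE hw dotN opprK.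
have om0 : 0 < om.
  rewrite lt_def psd andbT; apply/eqP => /psd_ker e.
  move: hw; rewrite e => /esym/eqP; rewrite oppr_eq0 => /eqP Ad.
  by have := mulKmx Au de; rewrite Ad mulmx0 => e2; rewrite -e2 eqxx in d0.
(* The coefficient om makes y orthogonal to de, so y = S z and (y, u_m) is bounded. Since om times
   coordinate j of u_m is positive, A(w, u_m) is bounded above, yet it would grow by b > 0 at each
   step. *)
pose y : 'cV[R]_n := de j 0 *: (A^T *m w) + om *: delta_mx j 0.
have yE x : dot y x = de j 0 * bf A w x + om * x j 0.
  rewrite /y dotDl; congr (_ + _).
    rewrite /dot linearZ /= -scalemxAl mxE; congr (_ * _).
    by rewrite /bf trmx_mul trmxK.
  rewrite dotE (bigD1 j) //= !mxE !eqxx mulr1 big1 ?addr0 // => l lj.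
  by rewrite !mxE (negPf lj) mulr0 mul0r.
have [z hz] : exists z, S *m z = y.
  by apply: (sym_solve Sd d0 rk); rewrite dotC yE omE; ring.
set b := bf A de (u 0%N); rewrite leNgt; apply/negP => b0.
have bm m : bf A de (u m) = b.
  have sd : S *m de = - (A *m 0) by rewrite Sd mulmx0 oppr0.
  elim: m => // m <-; rewrite (lin_step _ sd) [X in _ + X](_ : _ = 0) ?addr0 //.
  by rewrite /bf trmx0 !mul0mx mxE.
have lamE m : bf A w (u m) = bf A w (u 0%N) + b * m%:R.
  elim: m => [|m IH]; first by rewrite mulr0 addr0.
  by rewrite (lin_step _ hw) IH bm -natr1; ring.
set M := bf S z z + bf S (u 0%N) (u 0%N).
have key m : de j 0 * (bf A w (u 0%N) + b * m%:R) <= M.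
  have := bound_lin z m; rewrite hz yE -lamE -/M.
  have : 0 < om * u m j 0 by rewrite mulr_gt0.
  lra.
pose c := de j 0 * b; have c0 : 0 < c by rewrite mulr_gt0.
pose T := `|M| + `|de j 0 * bf A w (u 0%N)|.
have := archi_boundP (divr_ge0 (addr_ge0 (normr_ge0 M) (normr_ge0 (de j 0 * bf A w (u 0%N)))) (ltW c0)).
rewrite -/T; set N := Num.bound _; rewrite ltr_pdivrMr // => h.
have := key N; rewrite mulrDr mulrA -/c.
have := ler_norm M; have := ler_norm (- (de j 0 * bf A w (u 0%N))); rewrite normrN.
move: h; rewrite /T mulrC; lra.
Qed.

End Growth.

(** * Reduction of rank and rounds of mutations for an acyclic matrix *)

Definition hgt n (f : 'I_n -> nat) (B : 'M[int]_n) := forall i j, 0 < B i j -> (f i < f j)%N.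

Lemma acyclic_hgt n (B : 'M[int]_n) : acyclic B -> exists f, hgt f B.
Proof.
move=> ac; exists (fun i => #|[pred x | connect (arrow B) i x]|) => i j bij.
apply: proper_card; apply/properP; split.
  apply/subsetP => x; rewrite !inE => h; apply: connect_trans h; exact: connect1.
exists j; rewrite !inE ?connect0 //; exact: ac.
Qed.

Section Link.
Variables (n : nat) (d : 'I_n.+1 -> nat) (B : 'M[int]_n.+1) (k : 'I_n.+1).
Hypotheses (sk : skewD d B) (src : forall i, 0 <= B k i).

Definition restr (M : 'M[int]_n.+1) : 'M[int]_n := \matrix_(i, j) M (lift k i) (lift k j).
Let B' := restr B.
Let d' i := d (lift k i).

Lemma restr_skewD : skewD d' B'.
Proof. by split=> [i|i j]; rewrite ?mxE; apply (proj1 sk) || apply (proj2 sk). Qed.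

(** Paths avoiding k compute the link of the ray e_k. By [GB], row k of B_t is row k of B times C,
    so its entry has the sign of the c-vector being mutated, and e_k never enters a new g-vector. *)
Lemma link_inv ks (kl := map (lift k) ks) :
  [/\ restr (Bp B kl) = Bp B' ks, restr (Cp B kl) = Cp B' ks,
      restr (Gp B kl) = Gp B' ks,
      (forall j, Cp B kl k (lift k j) = 0) & (forall j, Gp B kl k (lift k j) = 0) /\
      (forall i, Gp B kl i k = (i == k)%:R)].
Proof.
rewrite /kl {kl}; elim/last_ind: ks => [|ks l IH].
  split=> [|||j|]; rewrite /Bp /Cp /Gp /= ?mxE ?(negPf (neq_lift _ _)) //.
  - by apply/matrixP=> i j; rewrite !mxE (inj_eq lift_inj).
  - by apply/matrixP=> i j; rewrite !mxE (inj_eq lift_inj).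
  - by split=> j; rewrite mxE // (negPf (neq_lift _ _)).
rewrite map_rcons; set kl := map _ ks in IH *; set l1 := lift k l.
case: IH => eB eC eG Ck [Gk Gkk].
have eBij i j : Bp B kl (lift k i) (lift k j) = Bp B' ks i j by rewrite -eB mxE.
have eCij i j : Cp B kl (lift k i) (lift k j) = Cp B' ks i j by rewrite -eC mxE.
have eGij i j : Gp B kl (lift k i) (lift k j) = Gp B' ks i j by rewrite -eG mxE.
have es : csgn (Cp B kl) l1 = csgn (Cp B' ks) l.
  rewrite /csgn; congr (~~ _); apply/forallP/forallP => h i.
    by rewrite -eCij.
  by case: (unliftP k i) => [i' ->|->]; rewrite ?eCij // Ck.
set s := csgn (Cp B' ks) l in es.
have cs := cohP (cohT kl l1 sk); rewrite es in cs.
have bkl : 0 <= sg s * Bp B kl k l1.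
  have /matrixP/(_ k l1) := GB sk (okpathT (ks := kl) sk); rewrite !mxE (bigD1_ord k) //=.
  rewrite Gkk eqxx mul1r big1 ?addr0 => [->|i _]; last by rewrite Gk mul0r.
  by rewrite mulr_sumr; apply: sumr_ge0 => i _; rewrite mulrCA mulr_ge0.
have kl1 : (k == l1) = false by rewrite (negPf (neq_lift _ _)).
have l1k : (l1 == k) = false by rewrite eq_sym.
split.
- apply/matrixP=> i j; rewrite !Bp_rcons !mxE !(inj_eq lift_inj) !eBij.
  by [].
- apply/matrixP=> i j; rewrite !Cp_rcons !mxE !(inj_eq lift_inj) !eBij !eCij.
  by [].
- apply/matrixP=> i j; rewrite mxE !Gp_rcons !mulmxH (inj_eq lift_inj) !es.
  case: eqP => _; last by rewrite eGij.
  rewrite eGij; congr (_ + _); rewrite (bigD1_ord k) /=; last by rewrite kl1.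
  rewrite Gkk eq_sym (negPf (neq_lift _ _)) mul0r add0r.
  apply: eq_big => i'; first by rewrite (inj_eq lift_inj).
  by rewrite eGij eBij.
- move=> j; rewrite Cp_rcons mxE; case: eqP => _; first by rewrite Ck oppr0.
  by rewrite !Ck oppr0 posp0 !mul0r !addr0.
split=> [j|i]; rewrite Gp_rcons mulmxH; last by rewrite kl1 Gkk.
case: eqP => [_|_]; last by rewrite Gk.
rewrite Gk oppr0 add0r (bigD1_ord k) /=; last by rewrite kl1.
rewrite Gkk eqxx mul1r es posp_0 ?oppr_le0 // add0r big1 // => i' _.
by rewrite Gk mul0r.
Qed.

Lemma link_cov (R : realType) : (forall v : 'I_n -> R, cov B' v) ->
  forall p : 'I_n.+1 -> R, 0 <= p k -> cov B p.
Proof.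
move=> hcov p pk eps e0; have [ks [w [[lam [l0 hw]] hv]]] := hcov (fun i => p (lift k i)) eps e0.
have [_ _ eG _ [Gk Gkk]] := link_inv ks.
exists (map (lift k) ks), (fun i => if unlift k i is Some i' then w i' else p k); split; last first.
  by move=> i; case: unliftP => [i' ->|->]; [exact: hv|rewrite subrr normr0].
exists (fun j => if unlift k j is Some j' then lam j' else p k); split.
  by move=> j; case: unliftP.
move=> i; rewrite (bigD1_ord k) //= unlift_none Gkk.
case: unliftP => [i' ->|->].
  rewrite eq_sym (negPf (neq_lift _ _)) mulr0 add0r hw; apply: eq_bigr => j _.
  by rewrite liftK -eG mxE.
by rewrite eqxx mulr1 big1 ?addr0 // => j _; rewrite Gk mulr0.
Qed.

End Link.

Section Round.
Variables (R : realType) (n : nat) (d : 'I_n -> nat).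
Implicit Types (B : 'M[int]_n) (v p : 'I_n -> R).

Lemma skew_sign B s i j : skewD d B -> 0 <= sg s * B i j -> sg s * B j i <= 0.
Proof.
move=> sk h; have di := skewD_gt0 i sk; have dj := skewD_gt0 j sk.
have e := (proj2 sk) i j.
rewrite -(pmulr_rle0 _ dj) mulrCA; have -> : (d j)%:Z * B j i = - ((d i)%:Z * B i j) by lia.
by rewrite mulrN oppr_le0 mulrCA mulr_ge0 // ltW.
Qed.

Lemma flip B s k : skewD d B -> (forall j, 0 <= sg s * B k j) ->
  forall i j, mut_sq k B i j = if (i == k) == (j == k) then B i j else - B i j.
Proof.
move=> sk h i j; rewrite mxE; have kk := skewD_diag k sk.
case: (eqVneq i k) => [->|ik]; case: (eqVneq j k) => [->|jk] //=; first by rewrite kk oppr0.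
have h1 := h j; have h2 := skew_sign sk (h i).
case: s h h1 h2 => _; rewrite ?mul1r ?mulN1r => h1 h2.
  by rewrite (posp_0 (a := B k j)) ?(posp_0 h2) ?mulr0 ?mul0r ?addr0 //; lia.
by rewrite (posp_id h1) (posp_id (a := - _)) ?mulNr ?addrK //; lia.
Qed.

Fixpoint srcs s B ks := if ks is k :: ks' then
  (forall j, 0 <= sg s * B k j) /\ srcs s (mut_sq k B) ks' else True.

Definition half B k := forall p, 0 <= p k -> cov B p.
(** For [s] true, row k is nonnegative only after the mutation, where [eta] has negated coordinate
    k; hence the passage to [mut_sq k B]. *)
Fixpoint halves s B ks := if ks is k :: ks' then
  half (if s then mut_sq k B else B) k /\ halves s (mut_sq k B) ks' else True.

Definition uncov B p := ~ cov B p.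

Lemma uncov_eta B k p : skewD d B -> uncov B p -> uncov (mut_sq k B) (eta B k p).
Proof. by move=> sk h /(cov_mut k p sk). Qed.

Lemma eq_uncov B p q : p =1 q -> uncov B p -> uncov B q.
Proof. by move=> e h h'; apply: h; apply: eq_cov h' => i; rewrite e. Qed.

Let rs s : R := (sg s)%:~R.
Let N s B i j : R := (posp (- (sg s * B i j)))%:~R.

Let rs2 s : rs s * rs s = 1.
Proof. by rewrite /rs; case: s => /=; rewrite -intrM. Qed.

Let rsT : rs true = -1. Proof. by rewrite /rs mulrN1z. Qed.
Let rsF : rs false = 1. Proof. by []. Qed.

Lemma step_uncov s B k p : skewD d B -> (forall j, 0 <= sg s * B k j) ->
  half (if s then mut_sq k B else B) k -> uncov B p ->
  0 < - (rs s * p k) /\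
  forall i, eta B k p i = if i == k then - p k else p i + N s B i k * p k.
Proof.
move=> sk src hf up.
have pk : 0 < - (rs s * p k).
  rewrite oppr_gt0 ltNge; apply/negP => pk; case: s src hf pk => src hf pk; last first.
    by apply: up; apply: hf; move: pk; rewrite /rs mul1r.
  have := uncov_eta (k := k) sk up; rewrite /uncov; apply; apply: hf; rewrite /eta eqxx.
  by move: pk; rewrite /rs /sg mulrN1z mulNr mul1r.
split=> // i; rewrite /eta; case: eqP => // _; rewrite /N.
move: pk; case: (s); rewrite /= ?mulN1r ?mul1r ?opprK ?rsT ?rsF => pk.
  have h : 0 <= p k by lra.
  by rewrite (max_idPl h) (min_idPr h) mulr0 addr0.
have h : p k <= 0 by lra.
by rewrite (max_idPr h) (min_idPl h) mulr0 addr0.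
Qed.

(** Here v_k records - s p_k at the moment when k is mutated, positive because the point is
    uncovered. Every [eta] is then linear, and their composite carries - s (1 - N_s) v to s (1 -
    N_(~~ s)) v on ks. Coordinates outside ks are tracked for the induction. *)
Lemma round s ks B p : skewD d B -> uniq ks -> srcs s B ks -> halves s B ks -> uncov B p ->
  exists v, [/\ forall i, i \in ks -> 0 < v i, forall i, i \notin ks -> v i = 0,
    forall i, i \in ks -> p i = - (rs s * (v i - \sum_j N s B i j * v j)),
    forall i j, Bp B ks i j = if (i \in ks) == (j \in ks) then B i j else - B i j
  & uncov (Bp B ks) (fun i => if i \in ks then rs s * (v i - \sum_j N (~~ s) B i j * v j)
                              else p i - rs s * \sum_j N s B i j * v j)].
Proof.
elim: ks B p => [|k ks IH] B p sk.
  move=> _ _ _ up; exists (fun=> 0); split=> //.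
  by apply: eq_uncov up => i; rewrite in_nil big1 ?mulr0 ?subr0 // => j _; rewrite mulr0.
move=> /= /andP[kks uks] [src hsrc] [hk hks] up.
have [pk ep] := step_uncov sk src hk up.
have sk1 := mut_skewD k sk; have fl := flip sk src.
have [v [v1 v2 v3 v4 v5]] := IH _ _ sk1 uks hsrc hks (uncov_eta (k := k) sk up).
set B1 := mut_sq k B in sk1 fl v3 v4 v5 *.
have kk := skewD_diag k sk.
pose v' i := if i == k then - (rs s * p k) else v i.
have vk : v k = 0 by exact: v2.
have sumv M (i : 'I_n) : \sum_j M i j * v' j = - (rs s * p k) * M i k + \sum_j M i j * v j.
  rewrite (bigD1 k) //= [in RHS](bigD1 k) //= vk mulr0 add0r /v' eqxx mulrC; congr (_ + _).
  by apply: eq_bigr => j /negPf ->.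
have nk i : i \in ks -> (i == k) = false by move=> h; apply: contraNF kks => /eqP <-.
have NB1 t i j : i != k -> N t B1 i j * v j = N t B i j * v j.
  move=> ik; case: (eqVneq j k) => [->|jk]; first by rewrite vk !mulr0.
  by rewrite /N fl (negPf ik) (negPf jk).
have pkE : rs s * - (rs s * p k) = - p k by rewrite mulrN mulrA rs2 mul1r.
exists v'; split.
- by move=> i; rewrite inE /v'; case: eqP => //= _; exact: v1.
- by move=> i; rewrite inE /v' negb_or => /andP[/negPf-> h]; exact: v2.
- move=> i; rewrite inE => /orP[/eqP->|iks].
    have -> : \sum_j N s B k j * v' j = 0.
      by apply: big1 => j _; rewrite /N posp_0 ?mul0r // oppr_le0.
    by rewrite /v' eqxx subr0 pkE opprK.
  have ik := nk i iks; have := v3 i iks; rewrite ep ik sumv /v' ik.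
  under eq_bigr => j _ do rewrite NB1 ?ik //.
  move=> e; have -> : p i = p i + N s B i k * p k - N s B i k * p k by rewrite addrK.
  rewrite e; have : rs s * (rs s * p k) = p k by rewrite mulrA rs2 mul1r.
  set S := \sum_(_ < _) _; set a := N _ _ _ _; set r := rs s; move=> h.
  by rewrite -{1}h; ring.
- move=> i j; rewrite v4 !fl !inE.
  case: (eqVneq i k) => [->|ik]; case: (eqVneq j k) => [->|jk]; rewrite /= ?(negPf kks) //.
  - by case: (j \in ks); rewrite ?opprK.
  - by case: (i \in ks); rewrite ?opprK.
apply: eq_uncov v5 => i; rewrite inE.
case: (eqVneq i k) => [->|ik] /=.
  rewrite (negPf kks) ep eqxx sumv /v' eqxx.
  have -> : N (~~ s) B k k = 0 by rewrite /N kk mulr0 oppr0 posp0.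
  rewrite mulr0 add0r mulrBr pkE; congr (_ - _ * _); apply: eq_bigr => j _.
  case: (eqVneq j k) => [->|jk]; first by rewrite vk !mulr0.
  by rewrite /N fl eqxx (negPf jk) /= sgN mulNr mulrN.
under eq_bigr => j _ do rewrite NB1 //.
under [X in _ - rs s * X]eq_bigr => j _ do rewrite NB1 //.
case: ifP => iks.
  rewrite /v' (negPf ik) sumv; congr (_ * (_ - _)).
  have -> : N (~~ s) B i k = 0.
    rewrite /N sgN mulNr opprK posp_0 //; exact: skew_sign.
  by rewrite mulr0 add0r.
rewrite ep (negPf ik) sumv mulrDr opprD addrA; congr (_ - _).
rewrite mulrA pkE; ring.
Qed.

End Round.

Section Order.
Variables (n : nat) (d : 'I_n -> nat).
Implicit Types (B : 'M[int]_n).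

Lemma srcs_pairwise B s ks : skewD d B -> uniq ks ->
  pairwise (fun k i => 0 <= sg s * B k i) ks ->
  (forall k i, k \in ks -> i \notin ks -> 0 <= sg s * B k i) -> srcs s B ks.
Proof.
elim: ks B => //= k ks IH B sk /andP[kks uks] /andP[/allP hk hp] ho.
have src j : 0 <= sg s * B k j.
  case: (eqVneq j k) => [->|jk]; first by rewrite (skewD_diag k sk) mulr0.
  case: (boolP (j \in ks)) => jks; first exact: hk.
  by apply: ho; rewrite inE ?eqxx // negb_or jk.
have nk i : i \in ks -> (i == k) = false by move=> h; apply: contraNF kks => /eqP <-.
have fl := flip sk src; split=> //; apply: IH => //; first exact: mut_skewD.
  apply: (sub_in_pairwise (P := mem ks)) hp; last exact/allP.
  by move=> i j hi hj /=; rewrite fl !nk.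
move=> i j iks jks; rewrite fl nk //; case: (eqVneq j k) => [->|jk] /=.
  by rewrite mulrN oppr_ge0; apply: (skew_sign sk).
by apply: ho; rewrite inE ?iks ?orbT // negb_or jk.
Qed.

Lemma hgt_srcs B s f : skewD d B -> hgt f B ->
  exists ks, [/\ uniq ks, forall i, i \in ks & srcs s B ks].
Proof.
move=> sk hf; pose r := [rel i j : 'I_n | if s then (f j <= f i)%N else (f i <= f j)%N].
have rT : total r by move=> i j; rewrite /= ; case: (s); apply: leq_total.
have rt : transitive r.
  by move=> j i l /=; case: (s) => h1 h2; [exact: leq_trans h2 h1|exact: leq_trans h1 h2].
have all_in i : i \in sort r (enum 'I_n) by rewrite mem_sort mem_enum.
exists (sort r (enum 'I_n)); split=> //; first by rewrite sort_uniq enum_uniq.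
apply: srcs_pairwise => //; first by rewrite sort_uniq enum_uniq.
  have := sort_sorted rT (enum 'I_n); rewrite sorted_pairwise //; apply: sub_pairwise.
  move=> i j /=; case: (s); rewrite ?mulN1r ?mul1r => h.
    by rewrite oppr_ge0 leNgt; apply/negP => /hf; rewrite ltnNge h.
  rewrite leNgt; apply/negP => bij; have bji : 0 < B j i.
    have := skew_sign (s := true) (i := i) (j := j) sk.
    have di := skewD_gt0 i sk; have dj := skewD_gt0 j sk; have e := (proj2 sk) i j.
    by move=> _; rewrite -(pmulr_rgt0 _ dj) -[_ * _]opprK -e oppr_gt0 pmulr_rlt0.
  by have := hf _ _ bji; rewrite ltnNge h.
by move=> k i _; rewrite all_in.
Qed.

Lemma hgt_flip B s k f : skewD d B -> (forall j, 0 <= sg s * B k j) -> hgt f B ->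
  exists f', hgt f' (mut_sq k B).
Proof.
move=> sk src hf; have fl := flip sk src; have kk := skewD_diag k sk.
case: s src => src.
  exists (fun i => if i == k then 0%N else (f i).+1) => i j; rewrite fl.
  case: (eqVneq i k) => [->|ik]; case: (eqVneq j k) => [->|jk] //=; first by rewrite kk.
    by have := skew_sign sk (src i); rewrite mulN1r; lia.
  by rewrite ltnS; exact: hf.
exists (fun i => if i == k then (\sum_i (f i)).+1 else f i) => i j; rewrite fl.
case: (eqVneq i k) => [->|ik]; case: (eqVneq j k) => [->|jk] //=; first by rewrite kk.
- by have := src j; rewrite mul1r; lia.
- by move=> _; rewrite ltnS (bigD1 i) //= leq_addr.
exact: hf.
Qed.

Lemma halves_of (R : realType) (P : 'M[int]_n -> Prop) s B ks :
  (forall M, P M -> skewD d M) ->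
  (forall M k, P M -> (forall j, 0 <= M k j) -> half R M k) ->
  (forall M s k, P M -> (forall j, 0 <= sg s * M k j) -> P (mut_sq k M)) ->
  srcs s B ks -> P B -> halves R s B ks.
Proof.
move=> sk hh hP; elim: ks B => //= k ks IH B [src hsrc] PB; split.
  case: s src {hsrc IH} => src; last by apply: hh => // j; have := src j; rewrite mul1r.
  apply: hh => [|j]; first exact: (hP _ true).
  rewrite (flip (sk _ PB) src) eqxx; case: (eqVneq j k) => [->|_] /=; first by rewrite (skewD_diag k (sk _ PB)).
  by have := src j; rewrite mulN1r.
by apply: IH => //; exact: (hP _ s).
Qed.

End Order.

(** * The symmetrized Cartan form and covering when it is semidefinite *)

Section Forms.
Variable R : realType.

(** The Euler form D (1 - [B]_+); its transpose belongs to - B and its symmetrization is D times the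
    Cartan companion. *)
Definition Em n (d : 'I_n -> nat) (B : 'M[int]_n) : 'M[R]_n :=
  \matrix_(i, j) ((d i)%:R * ((i == j)%:R - (posp (B i j))%:~R)).
Definition Sm n (d : 'I_n -> nat) (B : 'M[int]_n) : 'M[R]_n := Em d B + (Em d B)^T.
Definition PD n (d : 'I_n -> nat) (B : 'M[int]_n) := forall x : 'cV[R]_n, x != 0 -> 0 < bf (Sm d B) x x.

Lemma Em_tr n (d : 'I_n -> nat) B : skewD d B -> (Em d B)^T = Em d (- B).
Proof.
move=> sk; apply/matrixP => i j; rewrite !mxE !mulrBr eq_sym; congr (_ - _).
  by case: eqP => [->|_] //; rewrite !mulr0.
have := skewD_posp j i sk => h.
by rewrite !pmulrn -!intrM h.
Qed.

Lemma SmE n (d : 'I_n -> nat) B i j : skewD d B ->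
  Sm d B i j = (d i)%:R * (cartan_companion B i j)%:~R.
Proof.
move=> sk; rewrite /Sm Em_tr // !mxE -mulrDr; congr (_ * _).
case: (eqVneq i j) => [->|ij]; first by rewrite (skewD_diag j sk) !posp_0 ?oppr0 // !addr0 -natrD.
rewrite !sub0r -opprD -rmorphD -rmorphN /=; congr (_%:~R); rewrite /posp; lia.
Qed.

Lemma bf_sum n (M : 'M[R]_n) x y : bf M x y = \sum_i \sum_j x i 0 * M i j * y j 0.
Proof.
rewrite bfE dotE; apply: eq_bigr => i _; rewrite mxE mulr_sumr.
by apply: eq_bigr => j _; rewrite mulrA.
Qed.

Definition ext0 n (k : 'I_n.+1) (x : 'cV[R]_n) : 'cV[R]_n.+1 :=
  \col_i if unlift k i is Some i' then x i' 0 else 0.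

(** The form depends only on absolute values of entries, which the mutations of a round preserve. *)
Lemma bf_restr n (d : 'I_n.+1 -> nat) (B M : 'M[int]_n.+1) k x :
  skewD d B -> skewD d M -> (forall i j, `|M i j| = `|B i j|) ->
  bf (Sm (fun i => d (lift k i)) (restr k M)) x x = bf (Sm d B) (ext0 k x) (ext0 k x).
Proof.
move=> sk skM e; rewrite !bf_sum [RHS](bigD1_ord k) //= [X in X + _]big1 ?add0r; last first.
  by move=> j _; rewrite mxE unlift_none !mul0r.
apply: eq_bigr => i _; rewrite [RHS](bigD1_ord k) //= [ext0 k x k 0]mxE unlift_none mulr0 add0r.
apply: eq_bigr => j _; rewrite !SmE //; last exact: restr_skewD.
by rewrite !mxE !liftK e (inj_eq lift_inj).
Qed.

Lemma ext0_eq0 n k (x : 'cV[R]_n) : (ext0 k x == 0) = (x == 0).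
Proof.
apply/eqP/eqP => [/matrixP h|->]; apply/matrixP => i j; rewrite ord1 !mxE.
  by have := h (lift k i) 0; rewrite !mxE liftK.
by case: unlift => // a; rewrite mxE.
Qed.

(** [B]_+ strictly raises heights, so a kernel vector vanishes by induction from the greatest height
    down. *)
Lemma Em_unit n (d : 'I_n -> nat) B f : skewD d B -> hgt f B -> Em d B \in unitmx.
Proof.
move=> sk hf; rewrite -unitmx_tr unitmxE unitfE; apply/negP => /det0P[v v0 hv].
have e i : v 0 i = \sum_j (posp (B i j))%:~R * v 0 j.
  have /matrixP/(_ 0 i) := hv; rewrite !mxE => h; apply/eqP.
  have di : (d i)%:R != 0 :> R by rewrite pnatr_eq0 -lt0n (proj1 sk).
  rewrite -subr_eq0 -(mulrI_eq0 _ (mulfI di)) -[X in _ == X]h.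
  have -> : v 0 i = \sum_j (i == j)%:R * v 0 j.
    by rewrite (bigD1 i) //= eqxx mul1r big1 ?addr0 // => j; rewrite eq_sym => /negPf->; rewrite mul0r.
  rewrite -sumrB mulr_sumr; apply/eqP; apply: eq_bigr => j _.
  by rewrite !mxE; ring.
move/negP: v0; apply; apply/eqP/matrixP => a i; rewrite ord1 mxE {a}.
pose M := \sum_j (f j); have fM j : (f j <= M)%N by rewrite /M (bigD1 j) //= leq_addr.
have [m] := ubnP (M - f i)%N; elim: m i => // m IH i hm; rewrite e big1 // => j _.
case: (ltrP 0 (B i j)) => bij; last by rewrite posp_0 ?mul0r.
rewrite (IH j) ?mulr0 //; have := hf _ _ bij; have := fM i; have := fM j; lia.
Qed.

End Forms.

Section Density.
Variable R : realType.

Lemma EmE n (d : 'I_n -> nat) (B : 'M[int]_n) (x : 'cV[R]_n) i :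
  (Em R d B *m x) i 0 = (d i)%:R * (x i 0 - \sum_j (posp (B i j))%:~R * x j 0).
Proof.
rewrite mxE mulrBr mulr_sumr [X in X - _](_ : _ = \sum_j (d i)%:R * (i == j)%:R * x j 0).
  by rewrite -sumrB; apply: eq_bigr => j _; rewrite mxE; ring.
rewrite (bigD1 i) //= eqxx mulr1 big1 ?addr0 // => j.
by rewrite eq_sym => /negPf->; rewrite mulr0 mul0r.
Qed.

Definition sgm n s (B : 'M[int]_n) := if s then - B else B.

Lemma sgmE n s (B : 'M[int]_n) i j : sgm s B i j = sg s * B i j.
Proof. by case: s; rewrite /= ?mxE ?mulN1r ?mul1r. Qed.

Lemma sgmK n s (B : 'M[int]_n) : sgm (~~ s) B = - sgm s B.
Proof. by case: s; rewrite /= ?opprK. Qed.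

Lemma skewD_sgm n d s (B : 'M[int]_n) : skewD d B -> skewD d (sgm s B).
Proof. by case: s => //; exact: skewDN. Qed.

(** The shape in which a round leaves an uncovered point. The next round starts from it, so the
    vectors u chain into the recurrence for the Euler form. *)
Definition chamber n (d : 'I_n -> nat) s (B : 'M[int]_n) (u : 'cV[R]_n) :=
  (forall i, 0 < u i 0) /\
  uncov B (fun i => (d i)%:R^-1 * ((sg s)%:~R * (Em R d (sgm s B) *m u) i 0)).

Variables (n : nat) (d : 'I_n -> nat) (B : 'M[int]_n).
Hypotheses (sk : skewD d B) (hB : exists f, hgt f B).
Hypothesis hs : forall s ks, srcs s B ks -> halves R s B ks.

Let dn0 i : (d i)%:R != 0 :> R.
Proof. by rewrite pnatr_eq0 -lt0n (proj1 sk). Qed.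

Lemma chamber_ex s p : uncov B p -> exists u, chamber d s B u /\
  forall i, (d i)%:R * p i = - ((sg s)%:~R * ((Em R d (sgm s B))^T *m u) i 0).
Proof.
move=> up; have [f hf] := hB; have [ks [uks ak hk]] := hgt_srcs s sk hf.
have [v [v1 _ v3 v4 v5]] := round sk uks hk (hs hk) up.
have eB : Bp B ks = B by apply/matrixP => i j; rewrite v4 !ak.
exists (\col_i v i); split; [split|].
- by move=> i; rewrite mxE; exact: v1.
- rewrite eB in v5; apply: eq_uncov v5 => i; rewrite ak EmE.
  rewrite [RHS]mulrCA mulKf // mxE; congr (_ * (_ - _)); apply: eq_bigr => j _; rewrite mxE sgmE; congr (_ *~ posp _ * _).
  by rewrite sgN mulNr opprK.
move=> i; rewrite v3 // (Em_tr R (skewD_sgm s sk)) EmE mulrN mulrCA mxE.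
congr (- (_ * (_ * (_ - _)))); apply: eq_bigr => j _; rewrite !mxE sgmE.
by [].
Qed.

Lemma chamber_seq s u : chamber d s B u -> exists U : nat -> 'cV[R]_n,
  [/\ U 0%N = u, forall m i, 0 < U m i 0 &
   forall m, (Em R d (sgm s B))^T *m U m.+1 = - (Em R d (sgm s B) *m U m)].
Proof.
move=> hu; pose T := {v | chamber d s B v}; pose A := Em R d (sgm s B).
have next (v : T) : {w : T | A^T *m sval w = - (A *m sval v)}.
  apply: boolp.cid; case: v => v [v0 hv] /=; have [w [hw e]] := chamber_ex s hv.
  exists (exist _ w hw) => /=; apply/matrixP => i j; rewrite ord1 [RHS]mxE.
  have := e i; rewrite mulrA mulfV // mul1r => /(congr1 ( *%R (sg s)%:~R)).
  rewrite mulrN !mulrA; have -> : (sg s)%:~R * (sg s)%:~R = 1 :> R by rewrite -intrM; case: (s).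
  by rewrite !mul1r => ->; rewrite opprK.
have [U [U0 hU]] := Specif.dependent_choice next (exist _ u hu).
exists (fun m => sval (U m)); split=> //; first by rewrite U0.
by move=> m; case: (svalP (U m)).
Qed.

Lemma PD_uncov (p : 'I_n -> R) : PD R d B -> uncov B p -> n = 0%N.
Proof.
move=> pd up; case: (posnP n) => // n0; exfalso.
have [u [hu _]] := chamber_ex false up; have [U [_ U0 hU]] := chamber_seq hu.
have pd' (x : 'cV[R]_n) : x != 0 -> 0 < bf (Em R d B + (Em R d B)^T) x x by exact: pd.
apply: (@growth_pd R n (Em R d B) _ U) => // x.
by case: (eqVneq x 0) => [->|/pd'/ltW //]; rewrite bfE mulmx0 /dot mulmx0 mxE.
Qed.

Lemma PSD_uncov (de : 'cV[R]_n) (p : 'I_n -> R) : (forall x : 'cV[R]_n, 0 <= bf (Sm R d B) x x) ->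
  (forall i, 0 < de i 0) -> Sm R d B *m de = 0 -> (\rank (Sm R d B)).+1 = n ->
  uncov B p -> \sum_i de i 0 * ((d i)%:R * p i) = 0.
Proof.
move=> psd de0 hde hr up; have [f hf] := hB.
have eS s : Em R d (sgm s B) + (Em R d (sgm s B))^T = Sm R d B.
  case: s => //=; rewrite /Sm [in RHS](Em_tr R sk) (Em_tr R (skewDN sk)) opprK; exact: addrC.
(* A round with sign [~~ s] writes p itself as a chamber point of sign [s], to which [growth_psd]
   applies. The two signs give opposite inequalities. *)
have key s : (sg s)%:~R * \sum_i de i 0 * ((d i)%:R * p i) <= 0.
  have [u [hu e]] := chamber_ex (~~ s) up.
  have e1 i : (d i)%:R * p i = (sg s)%:~R * (Em R d (sgm s B) *m u) i 0.
    rewrite e sgmK -(Em_tr R (skewD_sgm s sk)) trmxK sgN.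
    by rewrite rmorphN /= mulNr opprK.
  have hu' : chamber d s B u.
    split; first by case: hu.
    by apply: eq_uncov up => i; rewrite -e1 mulrA mulVf // mul1r.
  have [U [U1 U0 hU]] := chamber_seq hu'.
  have uA : Em R d (sgm s B) \in unitmx.
    case: (s) => /=; last exact: Em_unit hf.
    by rewrite -(Em_tr R sk) unitmx_tr; exact: Em_unit hf.
  have := growth_psd (A := Em R d (sgm s B)) _ U0 hU de0 _ _ uA.
  rewrite eS U1 bfE dotE => h; have {}h := h psd hde hr.
  rewrite mulr_sumr (eq_bigr (fun i => de i 0 * (Em R d (sgm s B) *m u) i 0)) // => i _.
  rewrite e1 mulrCA; congr (_ * _); rewrite mulrA -intrM.
  by have -> : sg s * sg s = 1 by [case: (s)]; rewrite mul1r.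
apply/eqP; rewrite eq_le; have := key false; have := key true.
by rewrite /= mulrN1z mulN1r mul1r oppr_le0 => -> ->.
Qed.

Lemma PSD_cov_gen (de : 'cV[R]_n) (p : 'I_n -> R) : (forall x : 'cV[R]_n, 0 <= bf (Sm R d B) x x) ->
  (forall i, 0 < de i 0) -> Sm R d B *m de = 0 -> (\rank (Sm R d B)).+1 = n -> cov B p.
Proof.
move=> psd de0 hde hr; apply: boolp.contrapT => up.
have z := PSD_uncov psd de0 hde hr.
have n0 : (0 < n)%N by rewrite -hr.
pose i0 := Ordinal n0; apply: (up); apply: cov_closed => eps e0.
pose w i := p i + (i == i0)%:R * (eps / 2).
exists w; last first.
  move=> i; rewrite /w opprD addrA subrr add0r normrN; case: eqP => _.
    by rewrite mul1r ger0_norm; lra.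
  by rewrite mul0r normr0.
apply: boolp.contrapT => uw; have := z _ uw.
rewrite (eq_bigr (fun i => de i 0 * ((d i)%:R * p i) + (i == i0)%:R * (de i 0 * ((d i)%:R * (eps / 2))))); last first.
  by move=> i _; rewrite /w; ring.
rewrite big_split /= z // add0r (bigD1 i0) //= ?eqxx mul1r big1 ?addr0; last first.
  by move=> i /negPf->; rewrite mul0r.
move=> e; have : 0 < de i0 0 * ((d i0)%:R * (eps / 2)).
  by rewrite !mulr_gt0 ?invr_gt0 // ltr0n (proj1 sk).
by rewrite e ltxx.
Qed.
End Density.

Section DensityInduction.
Variable R : realType.

Lemma halves_restr n (d : 'I_n.+1 -> nat) B :
  (forall d' (B' : 'M[int]_n), skewD d' B' -> (exists f, hgt f B') -> PD R d' B' ->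
    forall p : 'I_n -> R, cov B' p) ->
  skewD d B -> (exists f, hgt f B) ->
  (forall k x, x != 0 -> 0 < bf (Sm R d B) (ext0 k x) (ext0 k x)) ->
  forall s ks, srcs s B ks -> halves R s B ks.
Proof.
move=> IH sk hB pd s ks hks.
apply: (halves_of (d := d) (P := fun M => [/\ skewD d M, exists f, hgt f M & forall i j, `|M i j| = `|B i j|])) hks _.
- by move=> M [].
- move=> M k [skM [f hf] e] src p pk; apply: (link_cov skM src) pk.
  apply: (IH (fun i => d (lift k i))); first exact: restr_skewD.
    by exists (fun i => f (lift k i)) => i j; rewrite mxE; exact: hf.
  by move=> x x0; rewrite (bf_restr k x sk skM e); exact: pd.
- move=> M t k [skM [f hf] e] src; split; first exact: mut_skewD.
    exact: (hgt_flip skM src hf).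
  by move=> i j; rewrite (flip skM src) -e; case: ifP => // _; rewrite normrN.
by split.
Qed.

Lemma PD_cov n d (B : 'M[int]_n) : skewD d B -> (exists f, hgt f B) -> PD R d B ->
  forall p : 'I_n -> R, cov B p.
Proof.
elim: n d B => [|n IH] d B sk hB pd p.
  move=> eps e0; exists [::], p; split; last by case.
  by exists (fun=> 0); split=> // -[].
apply: boolp.contrapT => up.
suff : n.+1 = 0%N by [].
apply: (PD_uncov sk hB _ pd up); apply: (halves_restr (d := d)) => // k x x0.
by apply: pd; rewrite ext0_eq0.
Qed.

Lemma PSD_cov n d (B : 'M[int]_n) (de : 'cV[R]_n) : skewD d B -> (exists f, hgt f B) ->
  (forall x, 0 <= bf (Sm R d B) x x) -> (forall i, 0 < de i 0) -> Sm R d B *m de = 0 ->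
  (\rank (Sm R d B)).+1 = n -> forall p : 'I_n -> R, cov B p.
Proof.
case: n d B de => // n d B de sk hB psd de0 hde hr p.
apply: (PSD_cov_gen sk hB _ p psd de0 hde hr); apply: (halves_restr (d := d)) => //.
  exact: PD_cov.
(* A null vector of the restricted form, extended by 0, lies in the kernel of S. Minus its
   projection to de it is both in the kernel and in the image, hence 0; so it is a multiple of de,
   and its zero coordinate kills it. *)
move=> k x x0; rewrite lt_neqAle psd andbT eq_sym; apply: contraNneq x0 => /(psd_ker psd) ker.
rewrite -(ext0_eq0 k); set y := ext0 k x in ker *.
have den0 : de != 0 by apply: contraTneq (de0 k) => ->; rewrite mxE ltxx.
have dd : dot de de != 0.
  by apply: lt0r_neq0; rewrite dotE (bigD1 k) //= ltr_wpDr ?mulr_gt0 ?sumr_ge0 // => i _; rewrite mulr_ge0 ?ltW.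
pose c := dot de y / dot de de.
have [|z hz] := sym_solve (y := y - c *: de) hde den0 hr.
  have dotZ a : dot de (a *: de) = a * dot de de by rewrite /dot -scalemxAr mxE.
  by rewrite dotC dotDl -scaleNr [dot y _]dotC [dot (_ *: _) _]dotC dotZ /c; field.
have y0 : y - c *: de = 0.
  have : dot (y - c *: de) (y - c *: de) = 0.
    have ST : (Sm R d B)^T = Sm R d B by rewrite {1}/Sm linearD /= trmxK addrC.
    rewrite -{1}hz -/(Sm R d B) /dot trmx_mul ST -mulmxA.
    by rewrite mulmxBr ker -scalemxAr hde scaler0 subr0 mulmx0 mxE.
  rewrite dotE => /eqP; rewrite psumr_eq0 => [/allP h|i _]; last by rewrite -expr2 sqr_ge0.
  apply/matrixP => i j; rewrite ord1 [RHS]mxE; have := h i (mem_index_enum _).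
  by rewrite -expr2 /= sqrf_eq0 => /eqP.
move/eqP: y0; rewrite subr_eq0 => /eqP ye; have /matrixP/(_ k 0) := ye.
rewrite !mxE unlift_none => /esym/eqP; rewrite mulf_eq0 (gt_eqF (de0 k)) orbF => /eqP c0.
by rewrite ye c0 scale0r.
Qed.

End DensityInduction.

(** * Indefinite forms *)

Section InitialMutation.
Variables (n : nat) (d : 'I_n -> nat) (K : numFieldType).
Implicit Types (B : 'M[int]_n) (ks : seq 'I_n) (y z : 'I_n -> K).

(* Mutation of coefficients in the universal semifield. *)
Definition Ym B k y (i : 'I_n) : K :=
  if i == k then (y k)^-1 else y i * y k ^ posp (B k i) * (1 + y k) ^ (- B k i).

Lemma Ym_gt0 B k y : (forall i, 0 < y i) -> forall i, 0 < Ym B k y i.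
Proof.
move=> hy i; rewrite /Ym; case: ifP => _; first by rewrite invr_gt0.
by rewrite !mulr_gt0 ?exprz_gt0 // addr_gt0.
Qed.

Lemma YmK B k y : skewD d B -> (forall i, 0 < y i) -> Ym (mut_sq k B) k (Ym B k y) =1 y.
Proof.
move=> sk hy i; rewrite /Ym; case: (eqVneq i k) => [->|ik]; first by rewrite eqxx invrK.
rewrite eqxx mxE eqxx /= opprK; have yk := hy k; have y0 : y k != 0 by exact: lt0r_neq0.
have u0 : 1 + y k != 0 by rewrite lt0r_neq0 // addr_gt0.
have -> : 1 + (y k)^-1 = (1 + y k) / y k by field.
rewrite expfzMl !exprz_inv; set c := B k i; have := pospB c.
move: (posp c) (posp (- c)) => a b e; have -> : - b = c - a by lia.
have ha := expfz_neq0 a y0; have hc := expfz_neq0 c y0; have hw := expfz_neq0 c u0.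
rewrite expfzDr // -!invr_expz; move: (y k ^ a) (y k ^ c) (_ ^ c) ha hc hw => p q r ha hc hw.
by field; rewrite ha hc hw.
Qed.

Lemma prod_exprz (I : finType) (P : pred I) (x : K) (a : I -> int) : x != 0 ->
  \prod_(i | P i) x ^ a i = x ^ \sum_(i | P i) a i.
Proof.
by move=> x0; elim/big_rec2: _ => [|i c b _ ->]; rewrite ?expr0z // expfzDr.
Qed.

Lemma C_cons B ks k e : skewD d B -> rowc B ks k e ->
  Cp (mut_sq k B) (k :: ks) = Emat B k (~~ e) *m Cp B ks.
Proof.
move=> sk he; have ok := okpathT (ks := ks) sk.
have ok0 := okpathT (ks := k :: ks) (mut_skewD k sk).
by have [e' he' ->] := init_mut sk ok ok0; rewrite (rowc_uniq he he').
Qed.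

(** By [GB] the powers of 1 + z_k^(sg e) contributed by the F-polynomials match those in [Ym]. *)
Lemma Yh_cons B ks k e z l : skewD d B -> rowc B ks k e -> (forall i, 0 < z i) ->
  let y := Ym (mut_sq k B) k z in
  (forall j, Fp (mut_sq k B) (k :: ks) z j =
     (1 + z k ^ sg e) ^ Gp B ks k j * Fp B ks y j) ->
  Yh (mut_sq k B) (k :: ks) (fun=> 1) z l = Yh B ks (fun=> 1) y l.
Proof.
move=> sk he hz y hF; have zk := hz k; have zk0 : z k != 0 by exact: lt0r_neq0.
set u := 1 + z k ^ sg e in hF.
have u0 : u != 0 by rewrite lt0r_neq0 // addr_gt0 // exprz_gt0.
rewrite /Yh (C_cons sk he) /= (mut_sqK _ sk).
rewrite (@eq_mon _ _ (XB (mut_sq k B) (k :: ks) (fun=> 1) z) (fun j => u ^ Gp B ks k j * Fp B ks y j) _ (fun i => Bp B ks i l)) //.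
rewrite -/(Fp B ks y) {1 2}/mon; under [X in _ * X = _]eq_bigr => j _ do rewrite expfzMl exprz_exp.
rewrite big_split /= prod_exprz // mulrA; congr (_ * _).
have -> : \sum_i Gp B ks k i * Bp B ks i l = \sum_(i | i != k) B k i * Cp B ks i l.
  have /matrixP/(_ k l) := GB sk (okpathT (ks := ks) sk); rewrite !mxE => ->.
  by rewrite [LHS](bigD1 k) //= (skewD_diag k sk) mul0r add0r.
rewrite (bigD1 k) //= [in RHS]/mon [RHS](bigD1 k) //= mulEmx eqxx {1}/y /Ym eqxx.
under eq_bigr => i ik do rewrite mulEmx (negPf ik).
rewrite [X in _ = _ * X](eq_bigr (fun i => z i ^ Cp B ks i l * (z k ^ (posp (- B k i) * Cp B ks i l)
   * (1 + z k) ^ (B k i * Cp B ks i l)))); last first.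
  move=> i ik; rewrite /y /Ym (negPf ik) mxE eqxx /= opprK !expfzMl !exprz_exp.
  by rewrite -mulrA.
have w0 : 1 + z k != 0 by rewrite lt0r_neq0 // addr_gt0.
rewrite !big_split /= !prod_exprz // expfzDr // exprz_inv.
set S := \prod_(i | _) _; set zc := z k ^ (- _).
rewrite -!mulrA; congr (_ * _); rewrite [LHS]mulrCA; congr (_ * _).
rewrite /u; case: (e); rewrite /= ?expr1z.
  have -> : 1 + z k ^ (- 1) = (1 + z k) / z k by rewrite exprN1; field.
  rewrite expfzMl exprz_inv mulrCA mulrC; congr (_ * _).
  rewrite -expfzDr //; congr (_ ^ _); rewrite -sumrN -big_split /=; apply: eq_bigr => i _.
  rewrite mul1r -mulNr -mulrDl; congr (_ * _); have := pospB (B k i); lia.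
congr (_ ^ _ * _); apply: eq_bigr => i _; by rewrite mulN1r.
Qed.

(** While the sign of row k persists, [Yh_cons] gives both sides the same exchange relation. When it
    flips, row k of G is a signed unit at l and the factors 1 + z_k and 1 + 1/z_k are compared
    directly. *)
Lemma F_cons B ks k e z j : skewD d B -> rowc B ks k e -> (forall i, 0 < z i) ->
  Fp (mut_sq k B) (k :: ks) z j =
  (1 + z k ^ sg e) ^ Gp B ks k j * Fp B ks (Ym (mut_sq k B) k z) j.
Proof.
move=> sk; have ok := okpathT (ks := ks) sk.
elim/okpath_ind: ok e j => [|{}ks l okl ok cl IH] e j he hz.
  have -> : e = false.
    by apply: (rowc_uniq he) => i; rewrite /Gp /= mul1r mxE; case: (k == i).
  have -> : Gp B [::] k j = (k == j)%:R by rewrite mxE.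
  rewrite /Fp {2}/XB /= xyl mulr1 -[[:: k]]/(rcons [::] k) expr1z.
  have x1 i : XB (mut_sq k B) [::] (fun=> 1) z i = 1 by rewrite /XB /= xyl.
  case: (eqVneq j k) => [->|jk]; last by rewrite XB_rcons (negPf jk) x1 expr0z.
  rewrite expr1z XB_rcons eqxx !x1 divr1.
  have m1 a : mon (XB (mut_sq k B) [::] (fun=> 1) z) a = 1.
    by apply: big1 => i _; rewrite x1 exp1rz.
  rewrite !m1 !mul1r addrC; congr (_ + _).
    by apply: big1 => i _; rewrite /Cp /= mxE; case: (i == k).
  rewrite /mon (bigD1 k) //= /Cp /= mxE eqxx expr1z big1 ?mulr1 // => i ik.
  by rewrite mxE (negPf ik).
have [e1 he1] := rowc_ex k sk ok; have hF i := IH e1 i he1 hz.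
have hY := Yh_cons l sk he1 hz hF.
set B0 := mut_sq k B in hF hY *; set y := Ym B0 k z in hF hY *.
have hy i : 0 < y i by exact: Ym_gt0.
have eC := C_cons sk he1; have sk0 := mut_skewD k sk; rewrite -/B0 in eC sk0.
have eB : Bp B0 (k :: ks) = Bp B ks by rewrite /= (mut_sqK _ sk).
set C1 := Cp B ks in cl eC *; set C0 := Cp B0 (k :: ks) in eC *.
have cl0 : coh C0 l by exact: (cohT _ _ sk0).
have zk := hz k; have zk0 : z k != 0 by exact: lt0r_neq0.
have X0 i : XB B0 (k :: ks) (fun=> 1) z i != 0 by exact: Fp_neq0.
have X1 i : XB B ks (fun=> 1) y i != 0 by exact: Fp_neq0.
have z0 i : z i != 0 by exact: lt0r_neq0.
have y0 i : y i != 0 by exact: lt0r_neq0.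
pose u e := 1 + z k ^ sg e; have u_gt0 b : 0 < u b by rewrite addr_gt0 // exprz_gt0.
have u0 b : u b != 0 by exact: lt0r_neq0.
rewrite -rcons_cons /Fp.
case: (row_step sk ok he1 he cl cl0 eC) => [[es ee]|[ee es1 es0 [gle c1e g0 hk]]].
  rewrite ee; case: (eqVneq j l) => [->|jl]; last first.
    by rewrite !XB_rcons (negPf jl) G_rcons_other //; exact: hF.
  rewrite (XB_rcons_coh X0 z0 (cohP cl0)) (XB_rcons_coh X1 y0 (cohP cl)) es hY eB.
  set s := csgn C1 l; set w := 1 + _; rewrite (G_rcons_col _ _ _ sk) -/C1 -/s.
  rewrite (@eq_mon _ _ (XB B0 (k :: ks) (fun=> 1) z) (fun i => u e1 ^ Gp B ks k i * Fp B ks y i)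
     _ (fun i => posp (- (sg s * Bp B ks i l)))) //.
  rewrite -[XB B0 _ _ _ l]/(Fp B0 (k :: ks) z l) hF -/(u e1) {1}/mon.
  under eq_bigr => i' _ do rewrite expfzMl exprz_exp.
  rewrite big_split /= prod_exprz // expfzDr // -invr_expz.
  rewrite -/(mon (Fp B ks y) _) -/(Fp B ks y) -[XB B ks _ _ l]/(Fp B ks y l).
  have h1 := expfz_neq0 (Gp B ks k l) (u0 e1); have h2 := Fp_neq0 B ks l hy.
  move: (u e1 ^ Gp B ks k l) h1 (Fp B ks y l) h2 => g h1 f h2.
  move: (u e1 ^ _) (mon _ _) w => a b c.
  by field; rewrite h1 h2.
rewrite -/C1 in c1e hk es1.
have ll := skewD_diag l (Bp_skewD ks sk).
have G'l : Gp B (rcons ks l) k l = - sg e1.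
  rewrite (G_rcons_col _ _ _ sk) gle big1 ?addr0 // => i _; case: (eqVneq i l) => [->|il].
    by rewrite ll mulr0 oppr0 posp0 mulr0.
  by rewrite g0 // mul0r.
case: (eqVneq j l) => [->|jl]; last first.
  rewrite !XB_rcons (negPf jl) G_rcons_other // g0 // expr0z mul1r.
  by have := hF j; rewrite g0 // expr0z mul1r.
rewrite (XB_rcons_coh X0 z0 (cohP cl0)) (XB_rcons_coh X1 y0 (cohP cl)) es0 es1 hY eB G'l ee.
set Y := Yh _ _ _ _ _; have FE i : i != l -> Fp B0 (k :: ks) z i = Fp B ks y i.
  by move=> il; rewrite hF g0 // expr0z mul1r.
have monF a : a l = 0 -> mon (XB B0 (k :: ks) (fun=> 1) z) a = mon (Fp B ks y) a.
  move=> al; apply: eq_bigr => i _; case: (eqVneq i l) => [->|il]; first by rewrite al !expr0z.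
  by rewrite -[XB _ _ _ _ i]/(Fp B0 (k :: ks) z i) FE.
rewrite monF; last by rewrite ll mulr0 oppr0 posp0.
rewrite -[XB B0 _ _ _ l]/(Fp B0 (k :: ks) z l) hF gle -/(u e1) -/(u (~~ e1)).
rewrite -/(Fp B ks y) -[XB B ks _ _ l]/(Fp B ks y l).
have F0 := Fp_neq0 B ks l hy; set Fl := Fp B ks y l in F0 *.
have YE : Y = z k ^ (- sg e1) * mon (Fp B ks y) (fun i => Bp B ks i l).
  rewrite /Y /Yh -/(Fp B ks y); congr (_ * _); rewrite /mon (bigD1 k) //= -/C1 c1e big1 ?mulr1.
    by rewrite /y /Ym eqxx exprz_inv.
  by move=> i ik; rewrite hk // expr0z.
pose M b := mon (Fp B ks y) (fun i => posp (- (sg b * Bp B ks i l))).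
have M0 b : M b != 0 by apply: mon_neq0 => i; exact: Fp_neq0.
have YM : Y = z k ^ (- sg e1) * (M true / M false).
  rewrite YE; congr (_ * _); rewrite /M -monN; last by move=> i; exact: Fp_neq0.
  rewrite -monD; last by move=> i; exact: Fp_neq0.
  by apply: eq_mon => // i; rewrite /= mulN1r mul1r opprK; have := pospB (Bp B ks i l); lia.
rewrite -!/(M _) YM /u; have := M0 true; have := M0 false.
have w0 : 1 + z k != 0 by have := u0 false; rewrite /u /= expr1z.
case: (e1) => /=; move: (M true) (M false) Fl F0 (z k) zk0 w0 => a b f f0 t t0 w0 b0 a0.
  have n1 : - (-1) = 1 :> int by [].
  by rewrite n1 !exprN1 !expr1z; field; rewrite f0 a0 b0 t0 addrC w0.
by rewrite !exprN1 !expr1z; field; rewrite f0 a0 b0 t0 addrC w0.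
Qed.

End InitialMutation.

(** * Asymptotics of F-polynomials along rays *)

Section Asymptotics.
Implicit Types (f g : rat -> rat) (c : rat) (e : int).

Definition lim1 f := forall eps, 0 < eps -> exists2 S, 0 < S & forall s, S <= s -> `|f s - 1| <= eps.

Lemma lim1_ext f g : (forall s, 0 < s -> f s = g s) -> lim1 f -> lim1 g.
Proof.
move=> fg h eps e0; have [S S0 hS] := h _ e0; exists S => // s Ss.
by rewrite -fg ?hS // (lt_le_trans S0).
Qed.

Lemma lim1_cst : lim1 (fun=> 1).
Proof. by move=> eps e0; exists 1 => // s _; rewrite subrr normr0 ltW. Qed.

Lemma lim1M f g : lim1 f -> lim1 g -> lim1 (fun s => f s * g s).
Proof.
move=> hf hg eps e0; pose a := Num.min 1 (eps / 4).
have a0 : 0 < a by rewrite lt_min ltr01 divr_gt0.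
have a1 : a <= 1 by rewrite ge_min lexx.
have a2 : a <= eps / 4 by rewrite ge_min lexx orbT.
have [S S0 hS] := hf _ a0; have [T T0 hT] := hg _ a0.
exists (S + T); first exact: addr_gt0.
move=> s hs; have {}hS := hS s (le_trans _ hs); have {}hT := hT s (le_trans _ hs).
have {}hS := hS (ltW (ltr_pwDr T0 (lexx _))); have {}hT := hT (ltW (ltr_pwDl S0 (lexx _))).
have -> : f s * g s - 1 = (f s - 1) * (g s - 1) + (f s - 1) + (g s - 1) by ring.
have h3 : `|(f s - 1) * (g s - 1)| <= a.
  by rewrite normrM -[leRHS]mulr1 ler_pM // (le_trans hT).
apply: le_trans (ler_normD _ _) _; have := ler_normD ((f s - 1) * (g s - 1)) (f s - 1).
lra.
Qed.

Lemma lim1V f : lim1 f -> lim1 (fun s => (f s)^-1).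
Proof.
move=> hf eps e0; pose a := Num.min (1 / 2) (eps / 2).
have a0 : 0 < a by rewrite lt_min !divr_gt0.
have a1 : a <= 1 / 2 by rewrite ge_min lexx.
have a2 : a <= eps / 2 by rewrite ge_min lexx orbT.
have [S S0 hS] := hf _ a0; exists S => // s /hS h.
have fs : 1 / 2 <= f s by move: h; rewrite ler_norml => /andP[]; lra.
have f0 : 0 < f s by lra.
have -> : (f s)^-1 - 1 = - (f s - 1) / f s by field; rewrite lt0r_neq0.
rewrite normrM normrN normfV (gtr0_norm f0) ler_pdivrMr //.
apply: le_trans h _; apply: le_trans a2 _; rewrite ler_pM2l //; lra.
Qed.

Lemma lim1X f (m : nat) : lim1 f -> lim1 (fun s => f s ^+ m).
Proof.
move=> hf; elim: m => [|m IH]; first exact: lim1_ext lim1_cst.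
by apply: lim1_ext (lim1M hf IH) => s _; rewrite exprS.
Qed.

Lemma lim1Xz f e : lim1 f -> lim1 (fun s => f s ^ e).
Proof.
case: e => m hf; first exact: lim1X.
by apply: lim1_ext (lim1V (lim1X m.+1 hf)) => s _; rewrite NegzE -exprnN.
Qed.

(** Asymptotic equivalence of f(s) and c s^e as the rational s tends to infinity. *)
Definition asy f c e := lim1 (fun s => f s / (c * s ^ e)).

Lemma asy_ext f g c e : (forall s, 0 < s -> f s = g s) -> asy f c e -> asy g c e.
Proof. by move=> fg; apply: lim1_ext => s s0; rewrite fg. Qed.

Lemma asyM f g c c' e e' : asy f c e -> asy g c' e' ->
  asy (fun s => f s * g s) (c * c') (e + e').
Proof.
move=> hf hg; apply: lim1_ext (lim1M hf hg) => s s0.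
by rewrite expfzDr ?lt0r_neq0 // mulf_div mulrACA.
Qed.

Lemma asyXz f c e (a : int) : asy f c e -> asy (fun s => f s ^ a) (c ^ a) (e * a).
Proof.
move=> hf; apply: lim1_ext (lim1Xz a hf) => s s0.
by rewrite expfzMl exprz_inv -invr_expz expfzMl exprz_exp.
Qed.

Lemma pow_neg_small e eps : e < 0 -> 0 < eps -> exists2 S : rat, 0 < S & forall s, S <= s -> s ^ e <= eps.
Proof.
move=> e0 eps0; have [m ->] : exists m : nat, e = - m.+1%:Z by exists (absz e).-1; lia.
exists (1 + eps^-1) => [|s hs]; first by rewrite addr_gt0 // invr_gt0.
have s1 : 1 <= s by apply: le_trans hs; rewrite lerDl invr_ge0 ltW.
have s0 : 0 < s by exact: lt_le_trans s1.
rewrite -exprnN -[leRHS]invrK lef_pV2 ?posrE ?invr_gt0 ?exprn_gt0 //.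
apply: le_trans (_ : s <= _); first by apply: le_trans hs; rewrite lerDr.
by rewrite exprS ler_peMr ?exprn_ege1 // ltW.
Qed.

Lemma asy_small f c e : 0 < c -> e < 0 -> asy f c e ->
  forall eps, 0 < eps -> exists2 S, 0 < S & forall s, S <= s -> `|f s| <= eps.
Proof.
move=> c0 e0 hf eps eps0; have [S S0 hS] := hf 1 ltr01.
have [|T T0 hT] := pow_neg_small e0 (_ : 0 < eps / (2 * c)).
  by rewrite divr_gt0 // mulr_gt0.
exists (S + T) => [|s hs]; first exact: addr_gt0.
have Ss : S <= s by apply: le_trans hs; rewrite lerDl ltW.
have Ts : T <= s by apply: le_trans hs; rewrite lerDr ltW.
have s0 : 0 < s by exact: lt_le_trans Ss.
have d0 : 0 < c * s ^ e by rewrite mulr_gt0 // exprz_gt0.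
have h1 : `|f s / (c * s ^ e)| <= 2.
  have := hS s Ss; have := ler_normD (f s / (c * s ^ e) - 1) 1; rewrite subrK normr1; lra.
have -> : f s = f s / (c * s ^ e) * (c * s ^ e) by rewrite divfK // lt0r_neq0.
rewrite normrM (gtr0_norm d0); apply: le_trans (ler_pM _ _ h1 (lexx _)) _ => //; first exact: ltW.
have := hT s Ts; rewrite ler_pdivlMr ?mulr_gt0 // => h; rewrite mulrA mulrC; exact: h.
Qed.

Lemma asy1D_small f c e : 0 < c -> e < 0 -> asy f c e -> asy (fun s => 1 + f s) 1 0.
Proof.
move=> c0 e0 hf eps eps0; have [S S0 hS] := asy_small c0 e0 hf eps0.
by exists S => // s /hS; rewrite expr0z mulr1 addrAC subrr add0r.
Qed.

Lemma asy1D_big f c e : 0 < c -> 0 < e -> (forall s, 0 < s -> 0 < f s) -> asy f c e ->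
  asy (fun s => 1 + f s) c e.
Proof.
move=> c0 e0 f0 hf; have hV : asy (fun s => (f s)^-1) c^-1 (- e).
  by have := asyXz (-1) hf; rewrite mulrN1.
have h1 : asy (fun s => 1 + (f s)^-1) 1 0 by apply: asy1D_small hV; rewrite ?invr_gt0 // oppr_lt0.
have := asyM h1 hf; rewrite mul1r add0r; apply: asy_ext => s s0.
by rewrite mulrDl mul1r mulVf ?lt0r_neq0 ?f0 // addrC.
Qed.

Lemma poly_lim1 (P : {poly rat}) c (N : nat) : 0 < c ->
  lim1 (fun s => P.[s] / (c * s ^+ N)) -> P`_N = c /\ forall m, (N < m)%N -> P`_m = 0.
Proof.
move=> c0 h; pose Q := P - c *: 'X^N.
suff sQ : (size Q <= N)%N.
  have cP m : P`_m = Q`_m + c * (m == N)%:R by rewrite coefB coefZ coefXn subrK.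
  split=> [|m Nm]; first by rewrite cP nth_default // eqxx add0r mulr1.
  by rewrite cP nth_default ?(leq_trans sQ (ltnW Nm)) // gtn_eqF // mulr0 addr0.
rewrite leqNgt; apply/negP => hs; pose m := (size Q).-1.
have sm : size Q = m.+1 by rewrite /m prednK // (leq_ltn_trans _ hs).
have lc : Q`_m != 0 by rewrite -[Q`_m]/(lead_coef Q) lead_coef_eq0 -size_poly_eq0 sm.
have Nm : (N <= m)%N by rewrite -ltnS -sm.
pose M : rat := \sum_(i < m) `|Q`_i|; pose a : rat := `|Q`_m|; have a0 : 0 < a by rewrite normr_gt0.
have M0 : 0 <= M by apply: sumr_ge0.
have [S S0 hS] := h (a / (2 * c)) (divr_gt0 a0 (mulr_gt0 (ltr0Sn _ 1) c0)).
(* At this s the terms below the leading one of Q total less than a quarter of it, whereas the limit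
   allows Q at most half of it. *)
pose s := S + 1 + 4 * M / a.
have M4 : 0 <= 4 * M / a by rewrite !mulr_ge0 // invr_ge0 ltW.
have s1 : 1 <= s by rewrite /s; lra.
have s0 : 0 < s by exact: lt_le_trans s1.
have Ss : S <= s by rewrite /s; lra.
have sN : 0 < s ^+ N by exact: exprn_gt0.
have h1 : `|Q.[s]| <= a / 2 * s ^+ m.
  have := hS s Ss; have -> : P.[s] / (c * s ^+ N) - 1 = Q.[s] / (c * s ^+ N).
    rewrite hornerD hornerN hornerZ hornerXn mulrBl divff // mulf_neq0 ?lt0r_neq0 //.
  rewrite normrM normfV (gtr0_norm (mulr_gt0 c0 sN)) ler_pdivrMr ?mulr_gt0 // => h2.
  apply: le_trans h2 _; have -> : a / (2 * c) * (c * s ^+ N) = a / 2 * s ^+ N.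
    by field; rewrite lt0r_neq0.
  by rewrite ler_pM2l ?divr_gt0 // ler_weXn2l.
have h2 : a * s ^+ m <= `|Q.[s]| + M * s ^+ m / s.
  have -> : a * s ^+ m = `|Q`_m * s ^+ m| by rewrite normrM (ger0_norm (exprn_ge0 _ (ltW s0))).
  have -> : Q`_m * s ^+ m = Q.[s] - \sum_(i < m) Q`_i * s ^+ i.
    by rewrite horner_coef sm big_ord_recr /= addrAC subrr add0r.
  apply: le_trans (ler_normB _ _) _; rewrite lerD2l; apply: le_trans (ler_norm_sum _ _ _) _.
  rewrite -mulrA /M mulr_suml; apply: ler_sum => i _; rewrite normrM ler_wpM2l //.
  rewrite (ger0_norm (exprn_ge0 _ (ltW s0))) ler_pdivlMr // -exprSr ler_weXn2l //.
have sm0 : 0 < s ^+ m by exact: exprn_gt0.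
have es : a * s = a * S + a + 4 * M by rewrite /s; field; rewrite lt0r_neq0.
have aS := mulr_gt0 a0 S0; clear -h1 h2 es sm0 s0 aS a0 M0.
clearbody a M s; move: (s ^+ m) sm0 `|Q.[s]| h1 h2 => t t0 q h1 h2.
have h : a / 2 * t <= M * t / s by lra.
rewrite ler_pdivlMr // mulrAC ler_pM2r // in h; lra.
Qed.

End Asymptotics.

Section Leading.
Variables (n : nat).
Implicit Types (p : {mpoly rat[n]}) (w : 'I_n -> int) (D : int).

(** Large s isolates the part of highest weight; varying th over all positive points excludes
    cancellation between monomials of equal weight. *)
Lemma mpoly_lead p w D (L : ('I_n -> rat) -> rat) :
  (forall th, (forall i, 0 < th i) ->
     0 < L th /\ asy (fun s => p.@[fun i => th i * s ^ w i]) (L th) D) ->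
  (forall m, m \in msupp p -> \sum_i w i * (m i)%:Z <= D) /\
  (forall th, (forall i, 0 < th i) ->
     \sum_(m <- msupp p | \sum_i w i * (m i)%:Z == D) p@_m * \prod_i th i ^+ m i = L th).
Proof.
move=> h; pose wt (m : 'X_{1..n}) : int := \sum_i w i * (m i)%:Z.
pose M : int := \sum_(m <- msupp p) `|wt m| + `|D|.
have absD (x : int) : 0 <= x + `|x| by lia.
have wtM m : m \in msupp p -> 0 <= wt m + M.
  move=> ms; rewrite /M (big_rem m) //= !addrA -addrA; apply: addr_ge0; first exact: absD.
  by apply: addr_ge0 => //; apply: sumr_ge0.
have DM : 0 <= D + M.
  by rewrite /M addrCA; apply: addr_ge0; [apply: sumr_ge0|exact: absD].
clearbody M.
pose P th : {poly rat} := \sum_(m <- msupp p) (p@_m * \prod_i th i ^+ m i) *: 'X^(absz (wt m + M)).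
have coefP th k : (P th)`_k = \sum_(m <- msupp p | absz (wt m + M) == k) p@_m * \prod_i th i ^+ m i.
  rewrite coef_sum [RHS]big_mkcond /=; apply: eq_bigr => m _; rewrite coefZ coefXn eq_sym.
  by case: eqP; rewrite ?mulr1 ?mulr0.
have key th : (forall i, 0 < th i) ->
    (P th)`_(absz (D + M)) = L th /\ forall k, (absz (D + M)%R < k)%N -> (P th)`_k = 0.
  move=> th0; have [L0 hL] := h th th0; apply: poly_lim1 => //.
  apply: lim1_ext hL => s s0; have sn0 : s != 0 by exact: lt0r_neq0.
  have -> : (P th).[s] = p.@[fun i => th i * s ^ w i] * s ^ M.
    rewrite mevalE horner_sum mulr_suml; apply: eq_big_seq => m ms.
    rewrite hornerZ hornerXn -mulrA -mulrA; congr (_ * _).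
    have -> : s ^+ absz (wt m + M) = s ^ (wt m + M).
      by rewrite -[in RHS](gez0_abs (wtM _ ms)).
    rewrite expfzDr // mulrA; congr (_ * _); rewrite -prod_exprz // -big_split /=.
    by apply: eq_bigr => i _; rewrite exprMn -exprz_exp.
  have -> : s ^+ absz (D + M) = s ^ (D + M) by rewrite -[in RHS](gez0_abs DM).
  have d1 := expfz_neq0 D sn0; have d2 := expfz_neq0 M sn0; have l0 := lt0r_neq0 L0.
  rewrite expfzDr //; move: (s ^ D) (s ^ M) (L th) d1 d2 l0 (p.@[_]) => a b c d1 d2 l0 q.
  by field; rewrite d1 d2 l0.
split=> [m0 m0s|th th0].
  rewrite -/(wt m0) leNgt; apply/negP => lt.
  pose Q : {mpoly rat[n]} := \sum_(m <- msupp p | wt m == wt m0) p@_m *: 'X_[m].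
  have Q0 : Q = 0.
    apply: mpoly_pos0 => th th0; have [_ /(_ (absz (wt m0 + M)))] := key th th0.
    rewrite coefP => <-; last by have := wtM _ m0s; lia.
    rewrite /Q raddf_sum /= big_seq_cond [RHS]big_seq_cond; apply: eq_big => [m|m _].
      by case: (boolP (m \in _)) => //= ms; have := wtM _ ms; have := wtM _ m0s; lia.
    by rewrite mevalZ mevalX.
  have := congr1 (mcoeff m0) Q0; rewrite mcoeff0 /Q raddf_sum /= (big_rem m0) //= eqxx.
  rewrite mcoeffZ mcoeffX eqxx mulr1 big_seq_cond big1 ?addr0 => [/eqP|m /andP[ms _]].
    by rewrite mcoeff_eq0 m0s.
  rewrite mcoeffZ mcoeffX; case: eqP ms => [->|_ _]; last by rewrite mulr0.
  by rewrite mem_rem_uniq ?msupp_uniq // inE eqxx.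
have [<- _] := key th th0; rewrite coefP big_seq_cond [RHS]big_seq_cond; apply: eq_bigl => m.
by rewrite -/(wt m); case: (boolP (m \in _)) => //= ms; have := wtM _ ms; lia.
Qed.

Lemma mpoly_lead_mono p w D (V : 'X_{1..n}) :
  (forall th, (forall i, 0 < th i) ->
     asy (fun s => p.@[fun i => th i * s ^ w i]) (\prod_i th i ^+ V i) D) -> V \in msupp p.
Proof.
move=> h; have [|_ e] := @mpoly_lead p w D (fun th => \prod_i th i ^+ V i).
  by move=> th th0; split; [apply: prodr_gt0 => i _; exact: exprn_gt0|exact: h].
pose P m := \sum_i w i * (m i)%:Z == D.
have E : \sum_(m <- msupp p | P m) p@_m *: 'X_[m] = 'X_[V] :> {mpoly rat[n]}.
  apply: mpoly_eq_pos => th th0; rewrite mevalX -(e _ th0) raddf_sum /=.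
  by apply: eq_bigr => m _; rewrite mevalZ mevalX.
apply: contraT => Vs; have := congr1 (mcoeff V) E.
rewrite mcoeffX eqxx raddf_sum /= big_seq_cond big1 => [/eqP|m /andP[ms _]].
  by rewrite eq_sym oner_eq0.
by rewrite mcoeffZ mcoeffX; case: eqP ms Vs => [->->|_ _ _]; rewrite ?mulr0.
Qed.

Lemma mpoly_near0 p : exists2 K, 0 <= K & forall eps y, 0 <= eps <= 1 ->
  (forall i, `|y i| <= eps) -> `|p.@[y] - p.@[fun=> 0]| <= K * eps.
Proof.
exists (\sum_(m <- msupp p) `|p@_m|); first by apply: sumr_ge0.
move=> eps y /andP[e0 e1] hy; rewrite !mevalE -sumrB mulr_suml.
apply: le_trans (ler_norm_sum _ _ _) _; apply: ler_sum => m _.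
rewrite -mulrBr normrM ler_wpM2l //.
have y1 i : `|y i| <= 1 by exact: le_trans (hy i) e1.
have e1' (a : 'I_n -> rat) k : (forall i, `|a i| <= 1) -> `|a k ^+ m k| <= 1.
  by move=> ha; rewrite normrX exprn_ile1.
case: (pickP (fun i => m i != 0)) => [k mk|m0].
  have -> : \prod_i (0 : rat) ^+ m i = 0 by rewrite (bigD1 k) //= expr0n (negPf mk) mul0r.
  rewrite subr0 (bigD1 k) //= normrM -[eps]mulr1; apply: ler_pM => //.
    case: (m k) mk => // a _; rewrite exprS normrM -[eps]mulr1; apply: ler_pM => //.
    by rewrite normrX exprn_ile1.
  rewrite normr_prod; apply: prodr_ile1 => i _; by rewrite normr_ge0 e1'.
rewrite !big1 ?subrr ?normr0 // => i _; have /negbFE/eqP -> := m0 i; exact: expr0.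
Qed.

End Leading.

Section Asymptotic.
Variables (n : nat) (d : 'I_n -> nat).
Implicit Types (B : 'M[int]_n) (ks : seq 'I_n).

Lemma eq_Fp (K : fieldType) B ks (y z : 'I_n -> K) j : y =1 z -> Fp B ks y j = Fp B ks z j.
Proof. by move=> e; apply: eq_Xp => i; rewrite /xy; case: (split i). Qed.

(* The exponents d_i (G lam)_i encode an interior point of the cone of the seed. *)
Lemma F_interior B ks (lam : 'I_n -> int) (z : 'I_n -> rat -> rat) : skewD d B ->
  (forall j, 0 < lam j) -> (forall i s, 0 < s -> 0 < z i s) ->
  (forall i, exists2 c, 0 < c & asy (z i) c ((d i)%:Z * \sum_j Gp B ks i j * lam j)) ->
  forall j, lim1 (fun s => Fp B ks (fun i => z i s) j).
Proof.
elim: ks B z => [|k ks IH] B z sk l0 z0 hz j.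
  by apply: lim1_ext lim1_cst => s _; rewrite /Fp /XB /= xyl.
have sk1 := mut_skewD k sk; set B1 := mut_sq k B in sk1.
have eB : mut_sq k B1 = B by exact: mut_sqK sk.
have [e he] := rowc_ex k sk1 (okpathT (ks := ks) sk1).
have eG : Gp B (k :: ks) = Hmat B1 k (~~ e) *m Gp B1 ks by rewrite -(G_cons sk1 he) eB.
pose P i := \sum_j Gp B1 ks i j * lam j.
(* Positive weights make the sign of (G lam)_k strict, so z_k^(sg e) tends to 0 and the factor from
   [F_cons] tends to 1. *)
have Pk : 0 < sg e * P k.
  have [m gm] := Gp_row_neq0 B1 ks k.
  rewrite /P mulr_sumr (bigD1 m) //=; apply: ltr_wpDr.
    by apply: sumr_ge0 => i _; rewrite mulrA mulr_ge0 // ltW.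
  rewrite mulrA mulr_gt0 // lt_neqAle he andbT eq_sym mulf_neq0 //; by case: (e).
have dk := skewD_gt0 k sk.
have hzk : exists2 c, 0 < c & asy (z k) c (- ((d k)%:Z * P k)).
  have [c c0 hc] := hz k; exists c => //; move: hc; rewrite eG.
  under eq_bigr => m _ do rewrite mulHmx eqxx mulNr.
  by rewrite sumrN mulrN.
have hzi i : i != k -> exists2 c, 0 < c & asy (z i) c ((d i)%:Z * P i + (d k)%:Z * posp (- (sg e * B1 k i)) * P k).
  move=> ik; have [c c0 hc] := hz i; exists c => //; move: hc; rewrite eG.
  under eq_bigr => m _ do rewrite mulHmx (negPf ik) mulrDl -mulrA.
  rewrite big_split /= -mulr_sumr -/(P i) -/(P k) mulrDr mulrA -(skewD_pospg i k e sk1).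
  by rewrite sgN mulNr opprK.
have zk0 s : 0 < s -> 0 < z k s by exact: z0.
have [c c0 hc] := hzk.
have hsg : asy (fun s => z k s ^ sg e) (c ^ sg e) (- ((d k)%:Z * P k) * sg e) by exact: asyXz.
have neg : - ((d k)%:Z * P k) * sg e < 0.
  by rewrite mulNr oppr_lt0 -mulrA [P k * _]mulrC mulr_gt0.
have hu : lim1 (fun s => 1 + z k s ^ sg e).
  apply: lim1_ext (asy1D_small _ neg hsg) => [s s0|]; last by rewrite exprz_gt0.
  by rewrite expr0z mulr1.
pose y i s := Ym B k (fun i => z i s) i.
have y0 i s : 0 < s -> 0 < y i s by move=> s0; apply: Ym_gt0 => i'; exact: z0.
have hF := IH B1 y sk1 l0 y0 _ j.
apply: lim1_ext (lim1M (lim1Xz (Gp B1 ks k j) hu) (hF _)) => [s s0|i].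
  rewrite -[in RHS]eB (F_cons j sk1 he) ?eB // => i; exact: z0.
rewrite -/(P i); case: (eqVneq i k) => [->|ik].
  exists (c ^ (-1)); first by rewrite exprz_gt0.
  have := asyXz (-1) hc; rewrite mulrN1 opprK; apply: asy_ext => s s0.
  by rewrite /y /Ym eqxx exprN1.
have [ci ci0 hci] := hzi i ik.
have hB : B1 k i = - B k i by rewrite mxE eqxx.
have hw : exists2 c', 0 < c' & asy (fun s => 1 + z k s) c' (if e then - ((d k)%:Z * P k) else 0).
  case: (e) neg hsg => neg hsg.
    exists c => //; apply: asy1D_big hc => //; move: neg; rewrite mulrN1; lia.
  exists 1 => //; apply: asy1D_small hc => //; by move: neg; rewrite mulr1.
have [cw cw0 hcw] := hw.
exists (ci * c ^ posp (B k i) * cw ^ (- B k i)); first by rewrite !mulr_gt0 ?exprz_gt0.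
have := asyM (asyM hci (asyXz (posp (B k i)) hc)) (asyXz (- B k i) hcw).
have -> : (d i)%:Z * P i + (d k)%:Z * posp (- (sg e * B1 k i)) * P k +
    - ((d k)%:Z * P k) * posp (B k i) +
    (if e then - ((d k)%:Z * P k) else 0) * - B k i = (d i)%:Z * P i.
  rewrite hB; have := pospB (B k i); case: (e) => /=; rewrite ?mulN1r ?mul1r ?opprK.
    by move=> h; have -> : posp (- B k i) = posp (B k i) - B k i by [lia]; ring.
  by move=> _; ring.
by apply: asy_ext => s s0; rewrite /y /Ym (negPf ik).
Qed.

End Asymptotic.

Section Top.
Variables (n : nat) (d : 'I_n -> nat).
Implicit Types (B : 'M[int]_n) (ks : seq 'I_n).

Lemma asy_neg_lim p (y : 'I_n -> rat -> rat) th : p.@[fun=> 0] = 1 :> rat ->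
  (forall i, 0 < th i) -> (forall i, asy (y i) (th i) (-1)) ->
  lim1 (fun s => p.@[fun i => y i s]).
Proof.
move=> p0 th0 hy eps e0; have [K K0 hK] := mpoly_near0 p.
pose a := Num.min 1 (eps / (K + 1)).
have K1 : 0 < K + 1 by rewrite ltr_wpDl.
have a0 : 0 < a by rewrite lt_min ltr01 divr_gt0.
have a1 : a <= 1 by rewrite ge_min lexx.
have a2 : a <= eps / (K + 1) by rewrite ge_min lexx orbT.
have [S S0 hS] : exists2 S, 0 < S & forall s i, S <= s -> `|y i s| <= a.
  have /boolp.choice[S hS] : forall i, exists S, 0 < S /\ forall s, S <= s -> `|y i s| <= a.
    move=> i; have [|S S0 hS] := asy_small (th0 i) _ (hy i) a0; first by [].
    by exists S.
  exists (1 + \sum_i S i) => [|s i hs].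
    by apply: ltr_wpDr; rewrite ?sumr_ge0 // => i _; apply: ltW; case: (hS i).
  apply: (proj2 (hS i)); apply: le_trans hs; rewrite (bigD1 i) //= addrCA lerDl.
  by rewrite addr_ge0 // sumr_ge0 // => j _; apply: ltW; case: (hS j).
exists S => // s Ss; rewrite -p0; apply: le_trans (hK a _ _ _) _.
- by rewrite ltW.
- by move=> i; exact: hS.
move: a2; rewrite ler_pdivlMr // => h; apply: le_trans h; rewrite mulrC ler_pM2l //; lra.
Qed.

(* Mutating along sources multiplies F_j by (1 + y_k)^{V_kj}, and the chart
   reached at the end sees only small coefficients. *)
Lemma F_top B ks l (V : 'I_n -> 'I_n -> int) (y : 'I_n -> rat -> rat) th :
  skewD d B -> uniq l -> srcs false B l ->
  (forall i, i \notin l -> forall j, V i j = 0) ->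
  (forall i, i \in l -> forall j,
     Gp B ks i j = - (V i j - \sum_m posp (- B i m) * V m j)) ->
  (forall i, i \in l -> exists j, 0 < V i j) ->
  (forall i s, 0 < s -> 0 < y i s) -> (forall i, 0 < th i) ->
  (forall i, asy (y i) (th i) (if i \in l then 1 else -1)) ->
  (forall i j, 0 <= V i j) /\
  forall j, asy (fun s => Fp B ks (fun i => y i s) j)
                (\prod_i th i ^ V i j) (\sum_i V i j).
Proof.
elim: l B ks V y th => [|k l IH] B ks V y th sk.
  move=> _ _ V0 _ _ y0 th0 hy; split=> [i j|j]; first by rewrite V0.
  have [p [hp p0 _]] := row_coherence sk (okpathT (ks := ks) sk).
  apply: lim1_ext (asy_neg_lim (p0 j) th0 hy) => s s0.
  rewrite -hp => [|i]; last exact: y0.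
  rewrite big1 => [|i _]; last by rewrite V0.
  by rewrite big1 ?expr0z ?mulr1 // => i _; rewrite V0.
move=> /= /andP[kl ul] [src hs] V0 hG hV y0 th0 hy.
have Gk j : Gp B ks k j = - V k j.
  rewrite hG ?inE ?eqxx // big1 ?subr0 // => m _.
  by rewrite posp_0 ?mul0r // oppr_le0; have := src m; rewrite mul1r.
have [e he] := rowc_ex k sk (okpathT (ks := ks) sk).
(* Row k of G is - V_k, and V_k has a positive entry; coherence then makes all of V_k
   nonnegative. *)
have et : e = true.
  have [j vj] := hV k (mem_head _ _); have := he j; rewrite Gk.
  by case: (e) => //; rewrite mul1r oppr_ge0 leNgt vj.
have Vk j : 0 <= V k j by have := he j; rewrite Gk et mulrNN mul1r.
have sk1 := mut_skewD k sk; set B1 := mut_sq k B in sk1 hs.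
have fl := flip (s := false) sk src; rewrite -/B1 in fl.
have nk i : i \in l -> (i == k) = false by move=> h; apply: contraNF kl => /eqP <-.
(* After the mutation coordinate k tends to 0, so its row of V is dropped. The other y_i keep their
   order and constant, because y_k^b (1 + y_k)^(-b) tends to 1. *)
pose V' i j := if i == k then 0 else V i j.
pose z i s := Ym B k (fun i => y i s) i.
pose th' i := if i == k then (th k)^-1 else th i.
have eG : Gp B1 (k :: ks) = Hmat B k false *m Gp B ks by rewrite (G_cons sk he) et.
have [| | | | | |V'0 hF] := IH B1 (k :: ks) V' z th' sk1 ul hs.
- by move=> i il j; rewrite /V'; case: eqP => // /eqP ik; rewrite V0 // inE negb_or ik.
- move=> i il j; rewrite eG mulHmx nk // hG ?inE ?il ?orbT // Gk /V' nk //.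
  rewrite mul1r (bigD1 k) //= [in RHS](bigD1 k) //= eqxx mulr0 add0r.
  under [X in _ = - (_ - X)]eq_bigr => m mk do rewrite (negPf mk) fl nk // (negPf mk).
  ring.
- by move=> i il; have [|j vj] := hV i; [by rewrite inE il orbT|exists j; rewrite /V' nk].
- by move=> i s s0; apply: Ym_gt0 => i'; exact: y0.
- by move=> i; rewrite /th'; case: ifP; rewrite ?invr_gt0.
- move=> i; rewrite /z /Ym /th'; case: (eqVneq i k) => [->|ik].
    rewrite (negPf kl); have := hy k; rewrite inE eqxx => h.
    have := asyXz (-1) h; rewrite mul1r exprN1; apply: asy_ext => s _; by rewrite exprN1.
  have := hy k; rewrite inE eqxx /= => hk.
  have h1 : asy (fun s => 1 + y k s) (th k) 1 by apply: asy1D_big hk => // s; exact: y0.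
  have := hy i; rewrite inE (negPf ik) /= => hi.
  have := asyM (asyM hi (asyXz (posp (B k i)) hk)) (asyXz (- B k i) h1).
  rewrite posp_id; last by have := src i; rewrite mul1r.
  by rewrite !mul1r addrK -mulrA -expfzDr ?lt0r_neq0 // subrr expr0z mulr1.
have hV0 i j : 0 <= V i j.
  by have := V'0 i j; rewrite /V'; case: eqP => [->|].
split=> // j; have hk := hy k; rewrite inE eqxx /= in hk.
have h1 : asy (fun s => 1 + y k s) (th k) 1 by apply: asy1D_big hk => // s; exact: y0.
have := asyM (asyXz (V k j) h1) (hF j); rewrite mul1r.
have -> : V k j + \sum_i V' i j = \sum_i V i j.
  rewrite (bigD1 k) //= [in RHS](bigD1 k) //= {1}/V' eqxx add0r; congr (_ + _).
  by apply: eq_bigr => i /negPf ik; rewrite /V' ik.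
have -> : th k ^ V k j * \prod_i th' i ^ V' i j = \prod_i th i ^ V i j.
  rewrite (bigD1 k) //= [in RHS](bigD1 k) //= {1}/V' eqxx expr0z mul1r; congr (_ * _).
  by apply: eq_bigr => i /negPf ik; rewrite /V' /th' ik.
apply: asy_ext => s s0; have hz i : 0 < z i s by apply: Ym_gt0 => i'; exact: y0.
have := F_cons j sk he hz; rewrite -/B1 => ->.
rewrite et Gk /= {1}/z /Ym eqxx exprN1 invrK mulrA -expfzDr; last first.
  by rewrite lt0r_neq0 // addr_gt0 // y0.
rewrite addrN expr0z mul1r; apply: eq_Fp => i.
by apply: (YmK k sk) => i'; exact: y0.
Qed.

End Top.

Section ConeForm.
Variables (n : nat) (d : 'I_n -> nat) (B : 'M[int]_n) (ks l : seq 'I_n) (V : 'I_n -> 'I_n -> int).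
Hypotheses (sk : skewD d B) (ul : uniq l) (lT : forall i, i \in l) (hs : srcs false B l).
Hypothesis hG : forall i j, Gp B ks i j = - (V i j - \sum_m posp (- B i m) * V m j).
Hypothesis hV : forall i, exists j, 0 < V i j.

Lemma F_top_ray (th : 'I_n -> rat) : (forall i, 0 < th i) ->
  (forall i j, 0 <= V i j) /\
  forall j, asy (fun s => Fp B ks (fun i => th i * s) j) (\prod_i th i ^ V i j) (\sum_i V i j).
Proof.
move=> th0; have t0 := th0; apply: (F_top (l := l) (y := fun i s => th i * s)) sk ul hs _ _ _ _ th0 _.
- by move=> i; rewrite lT.
- by move=> i _; exact: hG.
- by move=> i _; exact: hV.
- by move=> i s s0; rewrite mulr_gt0.
move=> i; rewrite lT; apply: lim1_ext lim1_cst => s s0.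
by rewrite expr1z divff // mulf_neq0 // lt0r_neq0.
Qed.

Lemma V_ge0 i j : 0 <= V i j.
Proof. exact: (proj1 (F_top_ray (fun=> ltr01))). Qed.

Lemma cone_form j m : \sum_i (d i)%:Z * Gp B ks i m * V i j <= 0.
Proof.
have [p [hp p0 _]] := row_coherence sk (okpathT (ks := ks) sk).
pose mV : 'X_{1..n} := [multinom absz (V i j) | i < n].
have mVs : mV \in msupp (p j).
  apply: (@mpoly_lead_mono _ _ (fun=> 1) (\sum_i V i j)) => th th0.
  have y0 i s : 0 < s -> 0 < th i * s by move=> s0; rewrite mulr_gt0.
  have [_ h] := F_top_ray th0.
  have -> : \prod_i th i ^+ mV i = \prod_i th i ^ V i j.
    by apply: eq_bigr => i _; rewrite mnmE -[in RHS](gez0_abs (V_ge0 i j)).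
  apply: asy_ext (h j) => s s0; rewrite hp => [|i]; last exact: y0.
  by apply: meval_eq => i; rewrite expr1z.
pose a l' := \sum_i (d i)%:Z * Gp B ks i l' * V i j.
have key (lam : 'I_n -> int) : (forall i, 0 < lam i) -> \sum_l' lam l' * a l' <= 0.
  move=> lam0; pose r i := (d i)%:Z * \sum_j Gp B ks i j * lam j.
  have [|h _] := @mpoly_lead _ (p j) r 0 (fun=> 1).
    move=> th th0; split=> //.
    pose z i s := th i * s ^ r i.
    have z0 i s : 0 < s -> 0 < z i s by move=> s0; rewrite mulr_gt0 // exprz_gt0.
    have hz i : exists2 c, 0 < c & asy (z i) c (r i).
      exists (th i) => //; apply: lim1_ext lim1_cst => s s0.
      by rewrite divff // mulf_neq0 ?expfz_neq0 // lt0r_neq0.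
    apply: lim1_ext (F_interior sk lam0 z0 hz j) => s s0.
    by rewrite expr0z mulr1 hp => // i; exact: z0.
  have := h _ mVs; congr (_ <= _); under eq_bigr => i _ do rewrite mnmE gez0_abs ?V_ge0 //.
  rewrite /a; under [RHS]eq_bigr => i _ do rewrite mulr_sumr.
  rewrite exchange_big; apply: eq_bigr => i _.
  rewrite /r mulr_sumr mulr_suml; apply: eq_bigr => i' _; ring.
rewrite -/(a m) leNgt; apply/negP => am.
(* [key] needs strictly positive weights; the weight |b| + 2 on m lets a positive integer [a m]
   outweigh all other terms. *)
pose b := \sum_i a i.
have := key (fun i => if i == m then `|b| + 2 else 1).
rewrite (bigD1 m) //= eqxx; under eq_bigr => i im do rewrite (negPf im) mul1r.
have -> : \sum_(i | i != m) a i = b - a m by rewrite /b [in RHS](bigD1 m) //= addrAC subrr add0r.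
move=> h; have {}h : (`|b| + 2) * a m + (b - a m) <= 0.
  by apply: h => i; case: ifP => // _; lia.
have : (`|b| + 1) * 1 <= (`|b| + 1) * a m by rewrite ler_pM2l //; lia.
move: (a m) am h => c c0 h h2.
have : (`|b| + 2) * c = (`|b| + 1) * c + c by ring.
lia.
Qed.

End ConeForm.

(** * Density forces semidefiniteness *)

Section Indefinite.
Variables (R : realType) (n : nat) (d : 'I_n -> nat) (B : 'M[int]_n).
Hypothesis sk : skewD d B.
Implicit Types (x y : 'cV[R]_n).

Let q x := bf (Sm R d B) x x.

Lemma form_abs x : q (\col_i `|x i 0|) <= q x.
Proof.
rewrite /q !bf_sum; apply: ler_sum => i _; apply: ler_sum => j _.
rewrite !(SmE R i j sk) !mxE; case: (eqVneq i j) => [->|ij].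
  move: (x j 0) ((d j)%:R * _) => a c.
  by rewrite -!mulrA ![_ * (c * _)]mulrCA -normrM ger0_norm // -expr2 sqr_ge0.
have c0 : (d i)%:R * (- `|B i j|)%:~R <= 0 :> R.
  by rewrite mulr_ge0_le0 ?ler0n // lerz0 oppr_le0.
move: (x i 0) (x j 0) (_ * _) c0 => a b c c0.
by rewrite -!mulrA ![_ * (c * _)]mulrCA -normrM ler_wnM2l // ler_norm.
Qed.

Lemma form_open x : q x < 0 ->
  exists2 del, 0 < del & forall y, (forall i, `|y i 0 - x i 0| <= del) -> q y < 0.
Proof.
move=> qx; pose S := Sm R d B.
pose K := \sum_i \sum_j `|S i j| * (1 + `|x i 0| + `|x j 0|).
have K0 : 0 <= K by do 2!apply: sumr_ge0 => ? _; rewrite mulr_ge0 // !addr_ge0.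
pose del := Num.min 1 (- q x / (K + 1)).
have K1 : 0 < K + 1 by rewrite ltr_wpDl.
have d0 : 0 < del by rewrite lt_min ltr01 divr_gt0 // oppr_gt0.
have d1 : del <= 1 by rewrite ge_min lexx.
have d2 : del <= - q x / (K + 1) by rewrite ge_min lexx orbT.
exists del => // y hy.
suff h : q y - q x <= del * K.
  by move: d2; rewrite ler_pdivlMr //; lra.
rewrite /q !bf_sum -sumrB /K mulr_sumr; apply: ler_sum => i _.
rewrite -sumrB mulr_sumr; apply: ler_sum => j _; rewrite -/S.
have -> : y i 0 * S i j * y j 0 - x i 0 * S i j * x j 0 =
  S i j * ((y i 0 - x i 0) * (y j 0 - x j 0) + (y i 0 - x i 0) * x j 0 + x i 0 * (y j 0 - x j 0)).
  by ring.
apply: le_trans (ler_norm _) _; rewrite normrM mulrCA ler_wpM2l //.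
apply: le_trans (ler_normD _ _) _; apply: le_trans (lerD (ler_normD _ _) (lexx _)) _.
rewrite !normrM; have hi := hy i; have hj := hy j.
have h1 : `|y i 0 - x i 0| * `|y j 0 - x j 0| <= del * 1 by rewrite ler_pM // (le_trans hj).
have h2 : `|y i 0 - x i 0| * `|x j 0| <= del * `|x j 0| by rewrite ler_wpM2r.
have h3 : `|x i 0| * `|y j 0 - x j 0| <= del * `|x i 0| by rewrite mulrC ler_wpM2r.
by rewrite !mulrDr; lra.
Qed.

(** [-B]_+ strictly lowers heights, so the Neumann series for the inverse of 1 - [-B]_+ is finite. W
    truncates it at t, and every t above [f i] gives the same row i. *)
Lemma V_ex f (G : 'M[int]_n) : hgt f B ->
  exists V : 'I_n -> 'I_n -> int, forall i j, G i j = - (V i j - \sum_m posp (- B i m) * V m j).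
Proof.
move=> hf; pose W := fix W t i j : int :=
  if t is t'.+1 then - G i j + \sum_m posp (- B i m) * W t' m j else 0.
have WS t i j : W t.+1 i j = - G i j + \sum_m posp (- B i m) * W t m j by [].
clearbody W; have fN i m : (f i <= f m)%N -> posp (- B i m) = 0.
  move=> h; apply: posp_0; rewrite oppr_le0 leNgt; apply/negP => bim.
  have := skew_sign (s := true) (i := i) (j := m) sk; rewrite mulN1r oppr_ge0 (ltW bim) => /(_ isT).
  have := proj2 sk i m; have di := skewD_gt0 i sk; have dm := skewD_gt0 m sk => e _.
  have /hf : 0 < B m i by rewrite -(pmulr_rgt0 _ dm) -[_ * _]opprK -e oppr_gt0 pmulr_rlt0.
  by rewrite ltnNge h.
have st t t' i j : (f i < t)%N -> (f i < t')%N -> W t i j = W t' i j.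
  elim: t t' i => // t IH [|t'] i // h h'; rewrite !WS; congr (_ + _); apply: eq_bigr => m _.
  case: (leqP (f i) (f m)) => fm; first by rewrite fN // !mul0r.
  by rewrite (IH t') // (leq_trans fm).
exists (fun i j => W (f i).+1 i j) => i j.
rewrite [W (f i).+1 i j]WS opprB [X in X - _](_ : _ = \sum_m posp (- B i m) * W (f i) m j); first by rewrite opprD addrCA subrr addr0 opprK.
apply: eq_bigr => m _; case: (leqP (f i) (f m)) => fm; first by rewrite fN // !mul0r.
by rewrite (st (f m).+1 (f i)).
Qed.

Theorem dense_psd f x : hgt f B -> (forall p : 'I_n -> R, cov B p) -> 0 <= q x.
Proof.
move=> hf hcov; rewrite leNgt; apply/negP => qx.
have [del1 d10 h1] := form_open (le_lt_trans (form_abs x) qx).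
pose v : 'cV[R]_n := \col_i (`|x i 0| + del1).
have qv : q v < 0 by apply: h1 => i; rewrite !mxE addrAC subrr add0r ger0_norm // ltW.
have [del2 d20 h2] := form_open qv.
(* The bound del2 keeps q u negative, and del1 / 2 keeps u positive. *)
pose del := Num.min del2 (del1 / 2).
have del0 : 0 < del by rewrite lt_min d20 divr_gt0.
have dl2 : del <= del2 by rewrite ge_min lexx.
have dl1 : del <= del1 / 2 by rewrite ge_min lexx orbT.
pose A := Em R d (- B); have uA : A \in unitmx.
  by rewrite /A -(Em_tr R sk) unitmx_tr; exact: Em_unit hf.
(* K bounds the inverse of the map from u to [pt u], so an error eps in the point moves u by at most
   del. *)
pose K := \sum_i \sum_j `|invmx A i j| * (d j)%:R.
have K0 : 0 <= K by do 2!apply: sumr_ge0 => ? _; rewrite mulr_ge0.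
have K1 : 0 < K + 1 by rewrite ltr_wpDl.
pose eps := del / (K + 1); have e0 : 0 < eps by rewrite divr_gt0.
pose pt (u : 'cV[R]_n) i := - (u i 0 - \sum_m (posp (- B i m))%:~R * u m 0).
have ptE u i : (A *m u) i 0 = - ((d i)%:R * pt u i).
  rewrite /A EmE /pt mulrN opprK; congr (_ * (_ - _)); apply: eq_bigr => m _; by rewrite mxE.
have [ks [w [[lam [l0 hw]] hpw]]] := hcov (pt v) eps e0.
have [V hV] := V_ex (Gp B ks) hf.
pose u : 'cV[R]_n := \col_i \sum_j lam j * (V i j)%:~R.
have wu i : w i = pt u i.
  rewrite hw /pt mxE; under [X in _ - X]eq_bigr => m _ do rewrite mxE mulr_sumr.
  rewrite exchange_big -sumrB -sumrN; apply: eq_bigr => j _.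
  rewrite hV rmorphN rmorphB rmorph_sum /= mulrN mulrBr mulr_sumr; congr (- (_ - _)).
  by apply: eq_bigr => m _; rewrite rmorphM /= mulrCA.
have uv i : `|u i 0 - v i 0| <= del.
  have e : u - v = invmx A *m (\col_i ((d i)%:R * (pt v i - w i))).
    rewrite -[LHS](mulKmx uA); congr (_ *m _); apply/matrixP => a b; rewrite ord1 mulmxBr.
    by rewrite mxE [X in _ + X]mxE !ptE mxE wu; ring.
  have := congr1 (fun M : 'cV[R]_n => M i 0) e; rewrite !mxE => ->.
  apply: le_trans (ler_norm_sum _ _ _) _; apply: le_trans (_ : K * eps <= _); last first.
    by rewrite /eps mulrA ler_pdivrMr // mulrC ler_pM2l //; lra.
  rewrite /K [X in _ <= X * _](bigD1 i) //= mulrDl; apply: ler_wpDr.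
    apply: mulr_ge0; last exact: ltW.
    by do 2!apply: sumr_ge0 => ? _; rewrite mulr_ge0.
  rewrite mulr_suml; apply: ler_sum => j _; rewrite mxE !normrM mulrA.
  by rewrite [X in _ * X * _]ger0_norm // ler_wpM2l ?mulr_ge0 // ltW.
have u0 i : 0 < u i 0.
  have := uv i; rewrite ler_norml => /andP[+ _]; rewrite [v i 0]mxE.
  have := normr_ge0 (x i 0); lra.
have Vpos i : exists j, 0 < V i j.
  apply: boolp.contrapT => h; have := u0 i; rewrite mxE ltNge; apply/negP/negPn.
  apply: sumr_le0 => j _; rewrite mulr_ge0_le0 // lerz0 leNgt.
  by apply/negP => vj; apply: h; exists j.
have [l [ul lT hs]] := hgt_srcs false sk hf.
have qu : q u < 0 by apply: h2 => i; apply: le_trans (uv i) dl2.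
have : 0 <= q u.
  have eA : A = (Em R d B)^T by rewrite (Em_tr R sk).
  have -> : q u = bf A u u *+ 2 by rewrite /q bf_S -(bf_tr (Em R d B)) -eA mulr2n.
  rewrite mulrn_wge0 // bfE dotE; under eq_bigr => i _ do rewrite ptE mulrN -wu hw.
  rewrite sumrN oppr_ge0.
  rewrite (eq_bigr (fun i => \sum_m \sum_j lam m * lam j * ((d i)%:Z * Gp B ks i m * V i j)%:~R)); last first.
    move=> i _; rewrite mxE mulr_suml exchange_big /=; apply: eq_bigr => j _.
    rewrite mulrCA mulr_sumr mulr_sumr; apply: eq_bigr => m _.
    rewrite !rmorphM /= pmulrn; ring.
  rewrite exchange_big sumr_le0 // => m _; rewrite exchange_big sumr_le0 // => j _.
  rewrite -mulr_sumr mulr_ge0_le0 ?mulr_ge0 // -rmorph_sum /= lerz0.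
  exact: (cone_form sk ul lT hs hV Vpos).
by rewrite leNgt qu.
Qed.

End Indefinite.

(** * Cartan matrices of finite and affine type *)

Section Cartan.
Variables (R : realType) (n : nat) (d : 'I_n -> nat) (B : 'M[int]_n).
Hypothesis sk : skewD d B.
Implicit Types (x y u : 'cV[R]_n).

Let S := Sm R d B.
Let A := Defs.realmx R (cartan_companion B).

Let dpos i : 0 < (d i)%:R :> R.
Proof. by rewrite ltr0n (proj1 sk). Qed.

Lemma Sm_realmx u i : (S *m u) i 0 = (d i)%:R * (A *m u) i 0.
Proof.
rewrite !mxE mulr_sumr; apply: eq_bigr => j _.
by rewrite [S i j](SmE R i j sk) [A i j]mxE mulrA.
Qed.

Lemma Sm_sym i j : S i j = S j i.
Proof. by rewrite /S /Sm !mxE addrC. Qed.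

Lemma Sm_off i j : i != j -> S i j <= 0.
Proof.
move=> ij; rewrite [S i j](SmE R i j sk) mxE (negPf ij).
by rewrite mulr_ge0_le0 ?ler0n // lerz0 oppr_le0.
Qed.

Lemma Sm_ker u : S *m u = 0 <-> A *m u = 0.
Proof.
split=> /matrixP e; apply/matrixP => i j; rewrite ord1 [RHS]mxE; have := e i 0; rewrite [RHS]mxE.
  by rewrite Sm_realmx => /eqP; rewrite mulf_eq0 gt_eqF //= => /eqP.
by rewrite Sm_realmx => ->; rewrite mulr0.
Qed.

(* q(v) = sum_i (S u)_i v_i^2 / u_i
     - 1/2 sum_ij S_ij u_i u_j (v_i / u_i - v_j / u_j)^2. *)
Lemma form_lower u y : pos_vec u ->
  \sum_i (S *m u) i 0 * (y i 0 ^+ 2 / u i 0) <= bf S y y.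
Proof.
move=> u0; have un i : u i 0 != 0 by rewrite lt0r_neq0.
pose a i := y i 0 / u i 0.
pose T := \sum_i \sum_j S i j * u i 0 * u j 0 * (a i - a j) ^+ 2.
have T0 : T <= 0.
  apply: sumr_le0 => i _; apply: sumr_le0 => j _; case: (eqVneq i j) => [->|ij].
    by rewrite subrr expr0n mulr0.
  apply: mulr_le0_ge0; last exact: sqr_ge0.
  by do 2![apply: mulr_le0_ge0; last exact: ltW]; exact: Sm_off.
suff : T = 2 * (\sum_i (S *m u) i 0 * (y i 0 ^+ 2 / u i 0) - bf S y y) by lra.
pose P := \sum_i \sum_j S i j * u i 0 * u j 0 * a i ^+ 2.
have e1 : \sum_i (S *m u) i 0 * (y i 0 ^+ 2 / u i 0) = P.
  apply: eq_bigr => i _; rewrite mxE mulr_suml; apply: eq_bigr => j _.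
  by rewrite /a; field.
have e2 : P = \sum_i \sum_j S i j * u i 0 * u j 0 * a j ^+ 2.
  rewrite /P exchange_big; apply: eq_bigr => i _; apply: eq_bigr => j _.
  by rewrite Sm_sym; ring.
have e3 : bf S y y = \sum_i \sum_j S i j * u i 0 * u j 0 * (a i * a j).
  rewrite bf_sum; apply: eq_bigr => i _; apply: eq_bigr => j _; rewrite /a.
  by field; rewrite !un.
have -> : T = P + (\sum_i \sum_j S i j * u i 0 * u j 0 * a j ^+ 2) -
    2 * \sum_i \sum_j S i j * u i 0 * u j 0 * (a i * a j).
  rewrite /T /P mulr_sumr -big_split -sumrB; apply: eq_bigr => i _.
  by rewrite mulr_sumr -big_split -sumrB; apply: eq_bigr => j _ /=; ring.
by rewrite -e2 e1 e3; ring.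
Qed.

Lemma Fin_PD : finite_type_GCM R (cartan_companion B) -> PD R d B.
Proof.
case=> _ [u [u0 Au]] _ y y0; apply: lt_le_trans (form_lower y u0).
have ex : exists i, y i 0 != 0.
  apply: boolp.contrapT => h; move/eqP: y0; apply; apply/matrixP => i j; rewrite ord1 [RHS]mxE.
  by apply/eqP/negPn/negP => yi; apply: h; exists i.
have [i yi] := ex.
have t i' : 0 <= (S *m u) i' 0 * (y i' 0 ^+ 2 / u i' 0).
  rewrite Sm_realmx; apply: mulr_ge0; first by rewrite mulr_ge0 // ltW.
  by rewrite mulr_ge0 ?sqr_ge0 // invr_ge0 ltW.
rewrite (bigD1 i) //=; apply: ltr_wpDr; first by apply: sumr_ge0 => j _.
have y2 : 0 < y i 0 ^+ 2 by rewrite exprn_even_gt0.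
by rewrite Sm_realmx; apply: mulr_gt0; [rewrite mulr_gt0|rewrite divr_gt0].
Qed.

Lemma Sm_DA : S = diag_mx (\row_i (d i)%:R) *m A.
Proof.
by apply/matrixP => i j; rewrite [LHS](SmE R i j sk) mul_diag_mx !mxE.
Qed.

Lemma rank_Sm : \rank S = \rank A.
Proof.
rewrite Sm_DA -mxrank_tr trmx_mul mxrankMfree ?mxrank_tr //.
rewrite tr_diag_mx row_free_unit unitmxE det_diag unitfE; apply/prodf_neq0 => i _.
by rewrite mxE lt0r_neq0.
Qed.

Lemma Aff_PSD : affine_type_GCM R (cartan_companion B) ->
  exists de : 'cV[R]_n, [/\ forall x, 0 <= bf S x x, forall i, 0 < de i 0, S *m de = 0 & (\rank S).+1 = n].
Proof.
case=> hr [u [u0 Au]] _; have Su : S *m u = 0 by apply/Sm_ker.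
exists u; split=> //; last by rewrite rank_Sm.
move=> x; apply: le_trans (form_lower x u0); rewrite Su big1 // => i _.
by rewrite mxE mul0r.
Qed.

Hypothesis con : connected B.

(** At a zero of y, (S y)_i is a sum of nonpositive terms; if it is nonnegative, y vanishes at all
    neighbours, and connectedness spreads the zero. *)
Lemma connected_zero y : nneg_vec y -> (forall i, y i 0 = 0 -> 0 <= (S *m y) i 0) ->
  pos_vec y \/ y = 0.
Proof.
move=> y0 h; case: (pickP (fun i => y i 0 == 0)) => [i0 /eqP z|nz]; last first.
  by left=> i; rewrite lt_neqAle eq_sym nz y0.
right; apply/matrixP => j j'; rewrite ord1 [RHS]mxE.
have st i j1 : y i 0 = 0 -> B i j1 != 0 -> y j1 0 = 0.
  move=> yi bij; have := h i yi; rewrite mxE => hi.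
  have t l : S i l * y l 0 <= 0.
    case: (eqVneq i l) => [<-|il]; first by rewrite yi mulr0.
    by rewrite mulr_le0_ge0 // Sm_off.
  have s0 : \sum_l - (S i l * y l 0) = 0.
    apply/eqP; rewrite sumrN oppr_eq0 eq_le hi andbT; exact: sumr_le0.
  have nn l : true -> 0 <= - (S i l * y l 0) by rewrite oppr_ge0.
  move/eqP: s0; rewrite (psumr_eq0 _ nn) => /allP/(_ j1 (mem_index_enum _)).
  rewrite /= oppr_eq0 mulf_eq0 [S i j1](SmE R i j1 sk) mxE.
  have -> : (i == j1) = false by apply: contraNF bij => /eqP ->; rewrite (skewD_diag j1 sk).
  by rewrite mulf_eq0 (gt_eqF (dpos i)) intr_eq0 oppr_eq0 normr_eq0 (negPf bij) => /eqP.
have /connectP[p hp ->] := con i0 j.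
elim: p i0 z hp {h} => //= a p IH i0 z /andP[ha hp]; apply: IH => //; exact: st ha.
Qed.

Lemma PSD_split : (forall x, 0 <= bf S x x) ->
  finite_type_GCM R (cartan_companion B) \/ affine_type_GCM R (cartan_companion B).
Proof.
move=> psd.
have ker x : bf S x x = 0 -> S *m x = 0 by exact: psd_ker.
case: (boolp.pselect (exists x, x != 0 /\ bf S x x = 0)) => [[x [x0 qx]]|npd].
  (* The absolute values of a null vector again form a null vector, hence a kernel vector, without
     zero coordinates by connectedness. *)
  right; pose de : 'cV[R]_n := \col_i `|x i 0|.
  have Sde : S *m de = 0.
    by apply: ker; apply/eqP; rewrite eq_le psd andbT -qx; exact: form_abs.
  have de0 : pos_vec de.
    have [||//|z] := @connected_zero de.
    - by move=> i; rewrite mxE.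
    - by move=> i _; rewrite Sde mxE.
    case/eqP: x0; apply/matrixP => i j; rewrite ord1 [RHS]mxE; apply/eqP.
    by rewrite -normr_eq0; have /matrixP/(_ i 0) := z; rewrite !mxE => ->.
  split.
  - rewrite -rank_Sm; have n0 : (0 < n)%N.
      case: (posnP n) => // e; case/eqP: x0; apply/matrixP => i; by have := ltn_ord i; rewrite {2}e.
    have kr : (kermx S <= de^T)%MS.
      apply/rV_subP => v /sub_kermxP vS; pose y := v^T.
      have Sy : S *m y = 0.
        apply: trmx_inj; rewrite trmx_mul trmxK trmx0 -[RHS]vS; congr (_ *m _).
        by apply/matrixP => i j; rewrite mxE Sm_sym.
      (* Subtracting de times the least ratio keeps a kernel vector nonnegative and creates a zero,
         so the difference vanishes and the kernel is a line. *)
      pose i0 := Ordinal n0; pose i1 := [arg min_(i < i0) (y i 0 / de i 0)]%O.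
      pose c := y i1 0 / de i1 0.
      have [||p|z] := @connected_zero (y - c *: de).
      + move=> i; rewrite !mxE; rewrite /c /i1; case: arg_minP => // m _ /(_ i isT).
        rewrite -[v 0 i]/(v 0 i) => hm; have := hm; rewrite ler_pdivlMr //.
        by rewrite [de i 0]mxE [y i 0]mxE subr_ge0.
      + by move=> i _; rewrite mulmxBr Sy -scalemxAr Sde scaler0 subr0 mxE.
      + by have := p i1; rewrite !mxE /c -[`|x i1 0|]/(`|x i1 0|) -[v 0 i1]/(v 0 i1) ; have := de0 i1; rewrite !mxE => h; rewrite divfK ?lt0r_neq0 // subrr ltxx.
      apply/sub_rVP; exists c; apply: trmx_inj; rewrite linearZ /= trmxK -/y.
      by apply/eqP; rewrite -subr_eq0 z.
    have k1 : (0 < \rank (kermx S))%N.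
      rewrite lt0n mxrank_eq0; apply/negP => /eqP k0.
      have : (de^T <= kermx S)%MS.
        apply/sub_kermxP; apply: trmx_inj; rewrite trmx_mul trmxK trmx0 -[RHS]Sde; congr (_ *m _).
        by apply/matrixP => i j; rewrite mxE Sm_sym.
      rewrite k0 submx0 => /eqP e; have := de0 (Ordinal n0).
      by have /matrixP/(_ 0 (Ordinal n0)) := e; rewrite [LHS]mxE => ->; rewrite mxE ltxx.
    have k2 : (\rank (kermx S) <= 1)%N by apply: leq_trans (mxrankS kr) (rank_leq_row _).
    by move: k1 k2; rewrite mxrank_ker; have := rank_leq_row S; lia.
  - by exists de; split=> //; apply/Sm_ker.
  move=> u Au; apply/Sm_ker.
  have Su i : 0 <= (S *m u) i 0 by rewrite Sm_realmx mulr_ge0 // ltW.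
  have z : \sum_i de i 0 * (S *m u) i 0 = 0.
    rewrite -dotE -bfE bf_sum exchange_big big1 // => i _.
    transitivity ((S *m de) i 0 * u i 0); last by rewrite Sde mxE mul0r.
    by rewrite mxE mulr_suml; apply: eq_bigr => j _; rewrite Sm_sym; ring.
  have nn i : true -> 0 <= de i 0 * (S *m u) i 0 by rewrite mulr_ge0 // ltW.
  move/eqP: z; rewrite (psumr_eq0 _ nn) => /allP z.
  apply/matrixP => i j; rewrite ord1 [RHS]mxE; have := z i (mem_index_enum _).
  by rewrite /= mulf_eq0 gt_eqF //= => /eqP.
left; have pd x : bf S x x = 0 -> x = 0.
  by move=> qx; apply/eqP/negPn/negP => x0; apply: npd; exists x.
have kerA x : A *m x = 0 -> x = 0.
  by move=> /Sm_ker e; apply: pd; rewrite bfE e /dot mulmx0 mxE.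
have third u : nneg_vec (A *m u) -> pos_vec u \/ u = 0.
  move=> Au; have Su i : 0 <= (S *m u) i 0 by rewrite Sm_realmx mulr_ge0 // ltW.
  apply: connected_zero => // i.
  (* The negative part of u. It has disjoint support from u + m, so S(m, u + m) <= 0, while S(m, u)
     >= 0; hence S(m, m) <= 0 and m = 0. *)
  pose m : 'cV[R]_n := \col_i Num.max (- u i 0) 0.
  have m0 i' : 0 <= m i' 0 by rewrite mxE le_max lexx orbT.
  have mu l : (m l 0 = 0 /\ 0 <= u l 0) \/ (0 <= m l 0 /\ (u + m) l 0 = 0).
    rewrite [(u + m) l 0]mxE [m l 0]mxE; case: (lerP 0 (u l 0)) => hu.
      by left; split=> //; apply/max_idPr; rewrite oppr_le0.
    have e : Num.max (- u l 0) 0 = - u l 0 by apply/max_idPl; rewrite oppr_ge0 ltW.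
    by right; rewrite e addrN oppr_ge0 ltW.
  have h1 : 0 <= bf S m u by rewrite bfE dotE; apply: sumr_ge0 => j _; rewrite mulr_ge0.
  have h2 : bf S m (u + m) <= 0.
    rewrite bf_sum; apply: sumr_le0 => i1 _; apply: sumr_le0 => i2 _.
    case: (eqVneq i1 i2) => [->|i12].
      by case: (mu i2) => [[-> _]|[_ ->]]; rewrite ?mul0r ?mulr0.
    rewrite -mulrA; apply: mulr_ge0_le0 => //; apply: mulr_le0_ge0; first exact: Sm_off.
    by rewrite [X in 0 <= X]mxE; case: (mu i2) => [[-> ?]|[_]]; rewrite ?addr0 // mxE => ->.
  have mz : m = 0.
    by apply: pd; apply/eqP; rewrite eq_le psd andbT; move: h2; rewrite bfDr; lra.
  have /matrixP/(_ i 0) := mz; rewrite !mxE => /eqP; rewrite eq_le => /andP[+ _].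
  by rewrite ge_max oppr_le0 => /andP[].
have uA : A \in unitmx.
  rewrite -unitmx_tr unitmxE unitfE; apply/negP => /det0P[v v0 hv]; case/eqP: v0.
  by apply: trmx_inj; rewrite trmx0; apply: kerA; apply: trmx_inj; rewrite trmx_mul trmxK trmx0.
split=> //; first by move: uA; rewrite unitmxE unitfE.
pose u : 'cV[R]_n := invmx A *m const_mx 1; have Au : A *m u = const_mx 1 by rewrite mulKVmx.
exists u; rewrite Au; split; last by move=> i; rewrite mxE.
have [|//|u0 i] := third u; first by rewrite Au => i; rewrite mxE.
by have := congr1 (fun M : 'cV[R]_n => M i 0) Au; rewrite u0 mulmx0 !mxE => /esym/eqP; rewrite oner_eq0.
Qed.

End Cartan.

Section Connected.
Variables (n : nat) (d : 'I_n -> nat).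
Implicit Types B : 'M[int]_n.

(** If mutation cancels the entry (i, j), then b_ik and b_kj are nonzero and the path through k
    replaces the edge. *)
Lemma connected_mut B k : connected B -> connected (mut_sq k B).
Proof.
move=> con; have sub : subrel (connect (fun a b => B a b != 0)) (connect (fun a b => mut_sq k B a b != 0)).
  apply: connect_sub => i j bij.
  have ek a b : (a == k) || (b == k) -> mut_sq k B a b = - B a b by move=> h; rewrite mxE h.
  case: (boolP ((i == k) || (j == k))) => ijk.
    by apply: connect1; rewrite ek // oppr_eq0.
  case: (eqVneq (mut_sq k B i j) 0) => [e|]; last exact: connect1.
  have bik : B i k != 0.
    apply: contraNneq bij => z; move: e; rewrite mxE (negPf ijk) z oppr0 posp0 !mul0r !addr0.
    by move=> ->.
  have bkj : B k j != 0.
    apply: contraNneq bij => z; move: e; rewrite mxE (negPf ijk) z posp0 !mulr0 !addr0.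
    by move=> ->.
  apply: (connect_trans (y := k)); apply: connect1; rewrite ek ?eqxx ?orbT // oppr_eq0 //.
by move=> i j; apply: sub; exact: con.
Qed.

Lemma connected_equiv B B' : connected B -> mut_equiv B B' -> connected B'.
Proof. by move=> con; elim=> // C k _; exact: connected_mut. Qed.

End Connected.

Theorem theorem1p1 (R : realType) (n : nat) (B : 'M[int]_n) :
  skew_symmetrizable B -> connected B ->
  (exists B' : 'M[int]_n, [/\ mut_equiv B B', skew_symmetrizable B' & acyclic B']) ->
  (gfan_dense R B <-> finite_type R B \/ affine_type R B).
Proof.
move=> [d sk] con [B' [eqv sk' ac]]; rewrite (gfan_denseE R sk); split.
  have [skB' [covB _]] := cov_equiv R sk eqv => /covB cov'.
  have [f hf] := acyclic_hgt ac; have conB' := connected_equiv con eqv.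
  have [h|h] := PSD_split skB' conB' (fun x => dense_psd skB' x hf cov'); [left|right];
    by exists B'; split.
move=> [] [C [eqC _ acC hC]]; have [skC [_ covC]] := cov_equiv R sk eqC;
  have hC' := acyclic_hgt acC; apply: covC.
  exact: PD_cov skC hC' (Fin_PD skC hC).
have [de [psd de0 hde hr]] := Aff_PSD skC hC.
exact: PSD_cov skC hC' psd de0 hde hr.
Qed.
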